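(* Let $M$ be a closed aspherical manifold of dimension at most $4$ that possesses a Thurston solvable geometry, and suppose that $\pi_1(M)$ is irreducible. Then $\pi_1(M)$ is not IIPP.
   Context: A group is reducible if it has a finite index subgroup isomorphic to a direct product of two infinite groups, and irreducible otherwise. An infinite group $\Gamma$ is infinite-index presentable by products (IIPP) if there is a homomorphism $\varphi\colon\Gamma_1\times\Gamma_2\to\Gamma$ onto a finite index subgroup of $\Gamma$ such that both images $\varphi(\Gamma_1),\varphi(\Gamma_2)$ have infinite index in $\Gamma$; otherwise $\Gamma$ is not IIPP. Geometries: let $\mathbb{X}^n$ be a complete simply connected $n$-dimensional Riemannian manifold (in the sense of Thurston geometries, with isometry group acting transitively). A closed manifold $M$ possesses the geometry $\mathbb{X}^n$ if it is diffeomorphic to a quotient of $\mathbb{X}^n$ by a lattice in its isometry group; this lattice is $\pi_1(M)$. The solvable geometries (those whose model space is a solvable Lie group) in dimensions $\le 4$ are: $\mathbb{R}$; $\mathbb{R}^2$; $\mathbb{R}^3$, $Nil^3$ (the 3-dimensional real Heisenberg group), $Sol^3$ (that is, $\mathbb{R}^2\rtimes\mathbb{R}$ with $t\mapsto\mathrm{diag}(e^t,e^{-t})$); and in dimension four $\mathbb{R}^4$, $Nil^3\times\mathbb{R}$, $Sol^3\times\mathbb{R}$, $Nil^4$, $Sol^4_{m\neq n}$, $Sol^4_0$, $Sol^4_1$. Here: - $Nil^4=\mathbb{R}^3\rtimes\mathbb{R}$, with $t\mapsto\exp\begin{pmatrix}0&t&0\\0&0&t\\0&0&0\end{pmatrix}$;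 - $Sol^4_{m\ne n}=\mathbb{R}^3\rtimes\mathbb{R}$, with $t\mapsto\mathrm{diag}(e^{at},e^{bt},e^{ct})$, where $m\ne n$ are positive integers, $a>b>c$ are reals with $a+b+c=0$ and $e^a,e^b,e^c$ are the roots of $\lambda^3-m\lambda^2+n\lambda-1=0$; - $Sol^4_0=\mathbb{R}^3\rtimes\mathbb{R}$, with $t\mapsto\mathrm{diag}(e^t,e^t,e^{-2t})$; - $Sol^4_1=Nil^3\rtimes\mathbb{R}$, where $t$ acts on $Nil^3$ by sending the unipotent upper triangular matrix with entries $(x,y,z)$ to $\begin{pmatrix}1&e^{-t}x&z\\0&1&e^ty\\0&0&1\end{pmatrix}$. *)

(* Defs.v *)
From HB Require Import structures.
From mathcomp Require Import all_boot all_order all_algebra.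
From mathcomp Require Import generic_quotient.
From mathcomp Require Import all_classical all_reals all_analysis.

Set Implicit Arguments.
Unset Strict Implicit.
Unset Printing Implicit Defensive.

Import Order.TTheory GRing.Theory Num.Theory.
Import numFieldNormedType.Exports.

Local Open Scope classical_set_scope.
Local Open Scope ring_scope.

Definition finite_index (G : groupType) (H : set G) : Prop :=
  finite_set [set [set (g * h)%g | h in H] | g in [set: G]].

(* The finite index subgroup isomorphic to A * B is the range of f. *)
Definition reducible (G : groupType) : Prop :=
  exists (A B : groupType) (f : {multiplicative (A * B)%type -> G}),
    [/\ injective f, finite_index (range f),
        infinite_set [set: A] & infinite_set [set: B]].

Definition irreducible (G : groupType) : Prop := ~ reducible G.

(* Infinite-index presentable by products. *)
Definition IIPP (G : groupType) : Prop :=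
  infinite_set [set: G] /\
  exists (G1 G2 : groupType) (phi : {multiplicative (G1 * G2)%type -> G}),
    [/\ finite_index (range phi),
        ~ finite_index (range (fun x : G1 => phi (x, 1%g))) &
        ~ finite_index (range (fun y : G2 => phi (1%g, y)))].

(* The operations of a Lie group whose underlying manifold is R^gdim and whose
   neutral element is 0; the group laws are not part of the record, as only the
   concrete models of solvable_geometry below are used. *)
Record lie_model (R : realType) := LieModel {
  gdim : nat;
  gmul : 'rV[R]_gdim -> 'rV[R]_gdim -> 'rV[R]_gdim;
  ginv : 'rV[R]_gdim -> 'rV[R]_gdim
}.

(* The left-invariant Riemannian metric which at 0 is the standard inner
   product: tangent vectors at p are translated back to 0 by p^-1. *)
Definition metric (R : realType) (X : lie_model R)
    (p u v : 'rV[R]_(gdim X)) : R :=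
  let L : 'rV[R]_(gdim X) -> 'rV[R]_(gdim X) := gmul (ginv p) in
  \sum_(i < gdim X) ('d L p u) 0 i * ('d L p v) 0 i.

Fixpoint class_C (R : realType) (V W : normedModType R) (k : nat)
    (f : V -> W) : Prop :=
  if k is k'.+1 then
    (forall x, differentiable f x) /\ (forall v, class_C k' (fun x => 'D_v f x))
  else continuous f.

Definition smooth (R : realType) (V W : normedModType R) (f : V -> W) : Prop :=
  forall k, class_C k f.

Definition riemannian_isometry (R : realType) (X : lie_model R)
    (f : 'rV[R]_(gdim X) -> 'rV[R]_(gdim X)) : Prop :=
  [/\ smooth f,
      exists f', [/\ cancel f f', cancel f' f & smooth f'] &
      forall p u v, metric (f p) ('d f p u) ('d f p v) = metric p u v].

Record group_action (G : groupType) (T : Type) := GroupAction {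
  act :> G -> T -> T;
  act1 : forall x, act 1%g x = x;
  actM : forall g h x, act (g * h)%g x = act g (act h x)
}.

Section OrbitSpace.
Variables (G : groupType) (T : topologicalType) (a : group_action G T).

Definition same_orbit (x y : T) : bool := `[< exists g, a g x = y >].

Lemma same_orbit_refl : reflexive same_orbit.
Proof. by move=> x; apply/asboolP; exists 1%g; rewrite act1. Qed.

Lemma same_orbit_sym : symmetric same_orbit.
Proof.
suff H x y : same_orbit x y -> same_orbit y x.
  by move=> x y; apply/idP/idP; exact: H.
by move=> /asboolP[g <-]; apply/asboolP; exists g^-1%g; rewrite -actM mulVg act1.
Qed.

Lemma same_orbit_trans : transitive same_orbit.
Proof.
move=> y x z /asboolP[g <-] /asboolP[h <-].
by apply/asboolP; exists (h * g)%g; rewrite actM.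
Qed.

Definition orbit_equiv : equiv_rel T :=
  EquivRel same_orbit same_orbit_refl same_orbit_sym same_orbit_trans.

Definition orbit_space : topologicalType :=
  quotient_topology {eq_quot orbit_equiv}%qT.

End OrbitSpace.

(* A closed manifold possessing the geometry X, presented as the quotient of
   the space of X by its fundamental group pi1, a lattice in the isometry group
   of X.  Discreteness is with respect to the compact-open topology; freeness of
   the action (equivalently, torsion-freeness of pi1) makes the quotient a
   manifold with fundamental group pi1, and aspherical since the space of X is
   contractible; a discrete group with compact quotient has finite covolume. *)
Record closed_manifold (R : realType) (X : lie_model R) := ClosedManifold {
  pi1 : groupType;
  deck : group_action pi1 'rV[R]_(gdim X);
  deck_isometry : forall g, riemannian_isometry (deck g);
  deck_discrete :
    let S := range deck : set {compact-open, 'rV[R]_(gdim X) -> 'rV[R]_(gdim X)} in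
    S `<=` isolated S;
  deck_free : forall g x, deck g x = x -> g = 1%g;
  deck_compact : compact [set: orbit_space deck]
}.

Definition vec (R : realType) (n : nat) (s : seq R) : 'rV[R]_n :=
  \row_(i < n) s`_i.

Definition euclid (R : realType) (n : nat) : lie_model R :=
  @LieModel R n (fun x y => x + y) (fun x => - x).

(* N ><| R for a one-parameter group phi of automorphisms of N; the last
   coordinate is the one in R. *)
Definition semidirect (R : realType) (N : lie_model R)
    (phi : R -> 'rV[R]_(gdim N) -> 'rV[R]_(gdim N)) : lie_model R :=
  @LieModel R (gdim N + 1)
    (fun x y => row_mx (gmul (lsubmx x) (phi (rsubmx x 0 0) (lsubmx y)))
                       (rsubmx x + rsubmx y))
    (fun x => row_mx (phi (- rsubmx x 0 0) (ginv (lsubmx x))) (- rsubmx x)).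

Definition times_line (R : realType) (N : lie_model R) : lie_model R :=
  semidirect (fun (_ : R) (x : 'rV[R]_(gdim N)) => x).

(* The matrix A t acts on column vectors, hence the transpose. *)
Definition euclid_by (R : realType) (n : nat) (A : R -> 'M[R]_n) :
    lie_model R :=
  @semidirect R (euclid R n) (fun t v => v *m (A t)^T).

(* The row (x, y, z) stands for the unipotent upper triangular matrix with
   entries x at (1,2), y at (2,3) and z at (1,3). *)
Definition nil3 (R : realType) : lie_model R :=
  @LieModel R 3
    (fun u v => let x := u 0 0 in let y' := v 0 1 in
       u + v + vec 3 [:: 0; 0; x * y'])
    (fun u => - u + vec 3 [:: 0; 0; u 0 0 * u 0 1]).

Definition sol3 (R : realType) : lie_model R :=
  @euclid_by R 2 (fun t => diag_mx (vec 2 [:: expR t; expR (- t)])).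

(* The nilpotent matrix with two unit entries above the diagonal; its cube is
   zero, so its exponential series stops after the square. *)
Definition jordan3 (R : realType) : 'M[R]_3 :=
  \matrix_(i < 3, j < 3) (i.+1 == j :> nat)%:R.

Definition nil4 (R : realType) : lie_model R :=
  @euclid_by R 3 (fun t => \sum_(k < 3) k`!%:R^-1 *: (t *: jordan3 R) ^+ k).

Definition sol4mn (R : realType) (a b c : R) : lie_model R :=
  @euclid_by R 3 (fun t =>
    diag_mx (vec 3 [:: expR (a * t); expR (b * t); expR (c * t)])).

Definition sol40 (R : realType) : lie_model R :=
  @euclid_by R 3 (fun t =>
    diag_mx (vec 3 [:: expR t; expR t; expR (- (t *+ 2))])).

Definition sol41 (R : realType) : lie_model R :=
  @semidirect R (nil3 R)
    (fun t v => vec 3 [:: expR (- t) * v 0 0; expR t * v 0 1; v 0 2%:R]).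

(* The standard metric of each of these models has maximal isometry group among
   the left-invariant ones, i.e. the isometry group of the geometry.  Distinct
   a, b, c make e^a, e^b, e^c simple roots. *)
Inductive solvable_geometry (R : realType) : lie_model R -> Prop :=
| Geo_Euclid n : (0 < n)%N -> solvable_geometry (euclid R n)
| Geo_Nil3 : solvable_geometry (nil3 R)
| Geo_Sol3 : solvable_geometry (sol3 R)
| Geo_Nil3R : solvable_geometry (times_line (nil3 R))
| Geo_Sol3R : solvable_geometry (times_line (sol3 R))
| Geo_Nil4 : solvable_geometry (nil4 R)
| Geo_Sol4mn (m n : nat) (a b c : R) :
    (0 < m)%N -> (0 < n)%N -> m != n ->
    a > b -> b > c -> a + b + c = 0 ->
    (forall l : R, l ^+ 3 - m%:R * l ^+ 2 + n%:R * l - 1 = 0 <->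
       l \in [:: expR a; expR b; expR c]) ->
    solvable_geometry (sol4mn a b c)
| Geo_Sol40 : solvable_geometry (sol40 R)
| Geo_Sol41 : solvable_geometry (sol41 R).

(* Main.v *)
Require Import Defs.
From HB Require Import structures.
From mathcomp Require Import all_boot all_order all_algebra.
From mathcomp Require Import zify ring lra.
From mathcomp Require Import all_classical all_reals all_analysis.
Set Implicit Arguments.
Unset Strict Implicit.
Unset Printing Implicit Defensive.
Import Order.TTheory GRing.Theory Num.Theory.
Import numFieldNormedType.Exports.
Local Open Scope classical_set_scope.
Local Open Scope ring_scope.

(** Let phi : G1 * G2 -> pi1 M witness that pi1 M is IIPP. The images A and B
    of the two factors commute, the product set A B has finite index, and
    neither A nor B has. Suppose that B is a lattice, i.e. isomorphic to a
    discrete subgroup of some R^k. Linear algebra in R^k gives a subgroup D of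
    B that complements A /\ B up to finite index; then A D is a direct product
    and still has finite index, so pi1 M is reducible
    ([reducible_of_lattice]). Hence the theorem follows once a finite index
    subgroup H of pi1 M is found such that, for commuting subgroups A and B of
    H with A B of finite index, A or B is virtually a lattice
    ([commuting_pairs_split], [not_IIPP]).

    To find H one computes the isometries of each model. In a left-invariant
    orthonormal frame the derivative of an isometry is an orthogonal matrix
    Q(x). Since an isometry preserves the Levi-Civita connection, the
    derivatives of Q are given by Q and the structure constants ([fD_rot]), and
    differentiating once more, Q commutes with the Ricci tensor ([Ric_rot]).
    The eigenspaces of the Ricci tensor are so small in the models which are
    not flat that these two facts determine Q up to signs and rotations, and
    make it constant where it matters. The coordinates of the isometry can then
    be integrated: a subgroup H of finite index acts by affine maps
    y |-> y L(g) + w(g) in suitable global coordinates ([affine_chart]).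
    Cocompactness and discreteness of the deck group become two statements
    about such maps: an H-invariant continuous function is bounded
    ([invariant_bounded]), and there are finitely many g in H with w(g) in a
    given ball ([chart_proper]).

    Let a be an element of A. If L(a) - 1 has the same kernel as its square,
    the centralizer of a, and with it B, preserves an affine subspace with
    direction ker (L(a) - 1); if B acts trivially on that direction, B acts on
    the subspace by translations, and discreteness makes it a lattice
    ([centralizer_lattice]). The geometries are treated as follows.
    - Diagonal extensions (Sol^3, Sol^3 x R, Sol^4_(m,n), Sol^4_0), Nil^4 and
      Sol^4_1: H translates the height, the coordinate in the acting line. An
      element of A or B which changes the height has a centralizer that is a
      lattice. If there is no such element, the height is invariant under A B,
      hence bounded, which is absurd ([split_by_height]). For Nil^4, where L(a)
      is unipotent, the centralizer is computed by hand ([nil4_split]).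
    - Nil^3 and Nil^3 x R: the same argument applies to an element that rotates
      the horizontal plane. Without rotations, commuting elements have parallel
      horizontal parts; if neither A nor B has vanishing horizontal parts, all
      of them are parallel to one line, and the coordinate transverse to it
      would be bounded ([heis_split]).
    - Flat manifolds: in dimension at most four a rotation Q <> 1 of
      determinant one fixes a subspace of dimension at most two. The
      translation vector of a along its axis lies there and is fixed by the
      centralizer of a, which therefore acts by translations, up
      to a sign, on the affine subspace through the axis ([eu_virtually]). *)

(** * Finite index subgroups and direct complements *)

(** The factors of a reducible group must be groups themselves, which is why
    [sub_type] equips the carrier of a subgroup with a group structure. *)
Record subgrp (G : groupType) := Subgrp {
  sub_set :> set G;
  sub1 : sub_set 1%g;
  subM : forall x y, sub_set x -> sub_set y -> sub_set (x * y)%g;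
  subV : forall x, sub_set x -> sub_set (x^-1)%g
}.

Definition sub_pred (G : groupType) (H : subgrp G) : pred G :=
  fun x => `[< sub_set H x >].

Lemma sub_pred_closed (G : groupType) (H : subgrp G) :
  group_closed (sub_pred H).
Proof.
split=> [|x y]; first by apply/asboolP; exact: sub1.
by move=> /asboolP Hx /asboolP Hy; apply/asboolP/subM => //; exact: subV.
Qed.

Record sub_type (G : groupType) (H : subgrp G) :=
  SubType { sub_val : G; _ : sub_pred H sub_val }.
HB.instance Definition _ (G : groupType) (H : subgrp G) :=
  [isSub for @sub_val G H].
HB.instance Definition _ (G : groupType) (H : subgrp G) :=
  [Choice of sub_type H by <:].
HB.instance Definition _ (G : groupType) (H : subgrp G) :=
  SubChoice_isSubGroup.Build G (sub_pred H) (sub_type H) (sub_pred_closed H).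

Section FiniteIndex.
Variable G : groupType.
Implicit Types (H K : subgrp G) (A B L : set G) (x y g : G).
Local Open Scope group_scope.

(** For subgroups A of L this is finiteness of the index. It is stated for
    arbitrary sets so as to apply to a product set A B without a proof that
    it is a subgroup. *)
Definition fcover A L := exists s : seq G,
  forall g, L g -> exists2 x, x \in s & A (x^-1 * g).

Lemma fcoverS A A' L : A `<=` A' -> fcover A L -> fcover A' L.
Proof. by move=> AA' [s sP]; exists s => g /sP[x xs /AA']; exists x. Qed.

Lemma fcover_sub A L L' : L' `<=` L -> fcover A L -> fcover A L'.
Proof. by move=> LL' [s sP]; exists s => g /LL'/sP. Qed.

Lemma fcover_refl A : fcover A A.
Proof. by exists [:: 1] => g Ag; exists 1; rewrite ?inE// invg1 mul1g. Qed.

Lemma fcover_trans A L L' : fcover A L -> fcover L L' -> fcover A L'.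
Proof.
move=> [s sP] [t tP]; exists [seq x * y | x <- t, y <- s] => g /tP[x xt].
move=> /sP[y ys Ag]; exists (x * y); first by apply/allpairsP; exists (x, y).
by rewrite invgM -mulgA.
Qed.

(** A coset x H that meets A is also the coset of any of its elements in A. *)
Lemma fcover_reps H A : fcover H A -> exists s : seq G,
  (forall x, x \in s -> A x) /\
  (forall g, A g -> exists2 x, x \in s & sub_set H (x^-1 * g)).
Proof.
move=> [s sP]; pose P x y := A y /\ sub_set H (x^-1 * y).
have /choice[f fP] : forall x, exists z, (exists y, P x y) -> P x z.
  move=> x; have [[y Py]|nP] := pselect (exists y, P x y); first by exists y.
  by exists 1.
exists [seq f x | x <- s & `[< exists y, P x y >]]; split=> [y|g Ag].
  by move=> /mapP[x]; rewrite mem_filter => /andP[/asboolP/fP[]] ? _ _ ->.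
have [x xs Hx] := sP g Ag.
have ex : exists y, P x y by exists g; split.
exists (f x); first by apply/mapP; exists x => //; rewrite mem_filter xs andbT; apply/asboolP.
have [_ Hfx] := fP x ex.
suff -> : (f x)^-1 * g = (x^-1 * f x)^-1 * (x^-1 * g) by apply: subM => //; exact: subV.
by rewrite invgM invgK -mulgA mulVKg.
Qed.

Lemma fcoverI H K L : K `<=` L -> fcover H L -> fcover (H `&` K) K.
Proof.
move=> KL /(fcover_sub KL)/fcover_reps[s [sK sP]]; exists s => g Kg.
have [x xs Hx] := sP g Kg; exists x => //; split=> //.
by apply: subM => //; apply/subV/sK.
Qed.

Lemma finite_indexP H : finite_index H <-> fcover H [set: G].
Proof.
rewrite /finite_index; set C := [set _ | g in _]; split=> [/finite_seqP[s sC]|].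
  have /choice[f fP] : forall c, exists z, C c -> [set z * h | h in H] = c.
    move=> c; have [[g _ <-]|nC] := pselect (C c); first by exists g.
    by exists 1.
  exists (map f s) => g _; pose c := [set g * h | h in H].
  have Cc : C c by exists g.
  exists (f c); first by apply: map_f; move: Cc; rewrite sC.
  have : c g by exists 1; [exact: sub1|rewrite mulg1].
  by rewrite -{1}(fP c Cc) => -[h Hh <-]; rewrite mulKg.
move=> [s sP]; apply: (@sub_finite_set _ _ ((fun x => [set x * h | h in H]) @` [set` s])).
  move=> c [g _ <-]; have [x xs Hx] := sP g I; exists x => //=.
  apply/seteqP; split=> y [h Hh <-].
    by exists (g^-1 * x * h); rewrite -?mulgA ?mulVKg// mulgA; apply: subM => //;
      rewrite -[g^-1 * x]invgK invgM invgK; apply: subV.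
  by exists (x^-1 * g * h); rewrite -?mulgA ?mulVKg// mulgA; apply: subM.
exact/finite_image/finite_seq.
Qed.

Definition prodset A B : set G := [set x * y | x in A & y in B].

Lemma fcover_prod H K A B : (forall x y, A x -> B y -> x * y = y * x) ->
  fcover H A -> fcover K B -> H `<=` A -> fcover (prodset H K) (prodset A B).
Proof.
move=> AB /fcover_reps[s [sA sP]] /fcover_reps[t [tB tP]] HA.
exists [seq x * y | x <- s, y <- t] => _ [a Aa [b Bb <-]].
have [x xs Hx] := sP a Aa; have [y yt Hy] := tP b Bb.
exists (x * y); first by apply/allpairsP; exists (x, y).
exists (x^-1 * a) => //; exists (y^-1 * b) => //.
have e := AB _ _ (HA _ Hx) (tB _ yt); set h := x^-1 * a in e *.
have e' : h * y^-1 = y^-1 * h by rewrite -{1}[h](mulKg y) -e mulgA mulgK.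
by rewrite mulgA e' /h invgM !mulgA.
Qed.

End FiniteIndex.
Arguments fcover_trans {G A} L {L'}.

Section Discrete.
Variables (R : realType) (G : groupType).
Local Open Scope group_scope.

(** B is isomorphic to a discrete subgroup of R^k. In this form, produced by
    orbits of translations, linear algebra over R can replace the structure
    theory of finitely generated abelian groups. *)
Definition lattice_like (B : set G) := exists (k : nat) (tau : G -> 'rV[R]_k),
  [/\ forall x y, B x -> B y -> tau (x * y) = (tau x + tau y)%R,
      forall x, B x -> tau x = 0%R -> x = 1 &
      forall r : R, finite_set [set x | B x /\ (`|tau x| <= r)%R]].

End Discrete.

Section Span.
Variables (R : realType) (V : vectType R).

(** Induction on the codimension of the span of u. *)
Lemma free_extension (S : set V) (u : seq V) : free u ->
  exists s : seq V, [/\ free (s ++ u), forall v, v \in s -> S v &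
    forall v, S v -> v \in span (s ++ u)].
Proof.
have [m] := ubnP (\dim {:V} - size u); elim: m u => // m IHm u lem fu.
have [[v [Sv vu]]|nex] := pselect (exists v, S v /\ v \notin <<u>>%VS); last first.
  exists [::]; split=> // v Sv /=; apply/negPn/negP => vu.
  by apply: nex; exists v.
have fvu : free (v :: u) by rewrite free_cons vu.
have szu : (size (v :: u) <= \dim {:V})%N.
  by move: fvu; rewrite /free => /eqP <-; exact/dimvS/subvf.
have [|s [fs sS Ss]] := IHm (v :: u) _ fvu.
  by move: lem szu => /=; lia.
exists (rcons s v); split.
- by rewrite cat_rcons.
- by move=> w; rewrite mem_rcons inE => /predU1P[->|/sS].
- by move=> w /Ss; rewrite cat_rcons.
Qed.

End Span.

Section Criterion.
Variables (R : realType) (G : groupType).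
Implicit Types (A B C : subgrp G).
Local Open Scope group_scope.

Definition commuting (A B : set G) :=
  forall x y, A x -> B y -> x * y = y * x.

(** Take a basis u of the span of tau C in tau C, and extend it by vectors s
    in tau B to a basis of the span of tau B. The complement D is the part
    of B over the span of s. Then tau (C D) contains the lattice spanned by
    s and u, from which every element of tau B differs by a vector of
    bounded norm, so that discreteness leaves finitely many cosets. *)
Lemma lattice_complement B C : sub_set C `<=` sub_set B ->
  lattice_like R (sub_set B) ->
  exists D : subgrp G, [/\ sub_set D `<=` sub_set B,
    forall x, sub_set C x -> sub_set D x -> x = 1 &
    fcover (prodset (sub_set C) (sub_set D)) (sub_set B)].
Proof.
move=> CB [k [tau [tauM tau_inj tau_disc]]].
have tau1 : tau 1 = 0%R.
  by apply: (@addrI _ (tau 1)); rewrite -tauM ?mulg1 ?addr0//; exact: sub1.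
have tauV x : sub_set B x -> tau x^-1 = (- tau x)%R.
  move=> Bx; apply: (@addrI _ (tau x)).
  by rewrite -tauM ?mulgV ?tau1 ?subrr//; exact: subV.
have [u [fu uC Cu]] := @free_extension R _ (tau @` sub_set C) [::] (nil_free _).
rewrite cats0 in fu Cu.
have [s [fsu sB Bsu]] := free_extension (tau @` sub_set B) fu.
pose Ds : set G := [set x | sub_set B x /\ tau x \in span s].
have D1 : Ds 1 by split; [exact: sub1|rewrite tau1 mem0v].
have DM x y : Ds x -> Ds y -> Ds (x * y).
  by move=> [? ?] [? ?]; split; [exact: subM|rewrite tauM// memvD].
have DV x : Ds x -> Ds x^-1.
  by move=> [? ?]; split; [exact: subV|rewrite tauV// memvN].
exists (Subgrp D1 DM DV); split=> /=; first by move=> x [].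
  move=> x Cx [Bx sx]; apply: tau_inj => //.
  move: fsu; rewrite cat_free => /and3P[_ _ /directv_addP su].
  by apply/eqP; rewrite -memv0 -su memv_cap sx Cu//; exists x.
pose X := in_tuple (s ++ u).
pose r := (\sum_(i < size (s ++ u)) `|X`_i|)%R.
have /finite_seqP[F FP] := tau_disc r.
pose T : set 'rV[R]_k := tau @` prodset (sub_set C) Ds.
have T0 : T 0%R.
  by exists 1 => //; exists 1; [exact: sub1|exists 1 => //; rewrite mulg1].
have TM a b : T a -> T b -> T (a + b)%R.
  move=> [_ [c1 Cc1 [d1 [Bd1 sd1] <-]] <-] [_ [c2 Cc2 [d2 [Bd2 sd2] <-]] <-].
  have Bc1 := CB _ Cc1; have Bc2 := CB _ Cc2.
  exists ((c1 * c2) * (d1 * d2)); last first.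
    by rewrite !tauM//; [rewrite addrACA|exact: subM..].
  by exists (c1 * c2); [exact: subM|exists (d1 * d2) => //; exact: DM].
have TV a : T a -> T (- a)%R.
  move=> [_ [c Cc [d [Bd sd] <-]] <-]; have Bc := CB _ Cc.
  exists (c^-1 * d^-1); last by rewrite !tauM ?tauV ?opprD//; exact: subV.
  by exists c^-1; [exact: subV|exists d^-1 => //; exact: DV].
have TZ (m : int) a : T a -> T (a *~ m)%R.
  move=> Ta; have Tn n : T (a *+ n)%R by elim: n => [|n ?]; rewrite ?mulr0n// mulrS; exact: TM.
  by case: m => n; [exact: Tn|rewrite NegzE mulrNz; apply/TV/Tn].
have TX i : (i < size (s ++ u))%N -> T (X`_i)%R.
  rewrite /= nth_cat size_cat => isu; case: ltnP => [ilt|ige].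
    have [x Bx xE] := sB _ (mem_nth 0%R ilt); exists x => //.
    exists 1; first exact: sub1.
    by exists x; [split=> //; rewrite xE memv_span// mem_nth|rewrite mul1g].
  have /uC[x Cx xE] : (u`_(i - size s))%R \in u by rewrite mem_nth// ltn_subLR.
  by exists x => //; exists x => //; exists 1; [|rewrite mulg1].
(* The remainder of b after rounding down its coordinates lies in the finite set F. *)
exists F => b Bb.
have bX : tau b \in span X by apply: Bsu; exists b.
pose c i := coord X i (tau b).
have [e De eE] : T (\sum_(i < size (s ++ u)) X`_i *~ Num.floor (c i))%R.
  elim/big_ind: _ => // i _; exact/TZ/TX.
have Be : sub_set B e.
  by case: De => x Cx [d [Bd _] <-]; apply: subM => //; exact: CB.
have Bbe : sub_set B (b * e^-1) by apply: subM => //; exact: subV.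
exists (b * e^-1); last first.
  rewrite invgM invgK -mulgA.
  suff -> : b^-1 * b = 1 by rewrite mulg1.
  by rewrite mulVg.
have : [set` F] (b * e^-1); last by [].
rewrite -FP; split=> //; rewrite tauM// ?tauV//; last exact: subV.
rewrite eE {1}(coord_span bX) -sumrB /r; apply: le_trans (ler_norm_sum _ _ _) _.
apply: ler_sum => i _; rewrite -scaler_int -scalerBl normrZ ler_piMl//.
by rewrite ger0_norm ?subr_ge0 ?floor_le// lerBlDl -[1%R]/(1%:~R)%R -intrD ltW// floorD1_gt.
Qed.

(** Multiplication identifies A * D with the subgroup A D of finite index.
    If one of the factors were finite, the other one would have finite
    index. *)
Lemma reducible_of_direct A D : commuting (sub_set A) (sub_set D) ->
  (forall x, sub_set A x -> sub_set D x -> x = 1) ->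
  fcover (prodset (sub_set A) (sub_set D)) [set: G] ->
  ~ fcover (sub_set A) [set: G] -> ~ fcover (sub_set D) [set: G] -> reducible G.
Proof.
move=> AD AD1 cAD nA nD.
pose f (p : sub_type A * sub_type D) : G := sub_val p.1 * sub_val p.2.
have vM (S : subgrp G) (x y : sub_type S) : sub_val (x * y) = sub_val x * sub_val y.
  exact: (valM x y).
have v1 (S : subgrp G) : sub_val (1 : sub_type S) = 1 by exact: val1.
have valA (x : sub_type A) : sub_set A (sub_val x) by have /asboolP := valP x.
have valD (x : sub_type D) : sub_set D (sub_val x) by have /asboolP := valP x.
have fM : {morph f : x y / x * y}.
  move=> [x1 x2] [y1 y2]; rewrite /f; change (sub_val (x1 * y1) * sub_val (x2 * y2) =
    sub_val x1 * sub_val x2 * (sub_val y1 * sub_val y2)).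
  rewrite !vM -!mulgA; congr (_ * _).
  by rewrite !mulgA; congr (_ * _); apply: AD.
have f1 : f 1 = 1.
  by change (sub_val (1 : sub_type A) * sub_val (1 : sub_type D) = 1); rewrite !v1 mulg1.
pose fm : {multiplicative (sub_type A * sub_type D)%type -> G} :=
  HB.pack f (isMultiplicative.Build _ _ f fM).
exists (sub_type A), (sub_type D), fm; split.
- move=> [x1 x2] [y1 y2] /=; rewrite /f /= => e.
  have e' : (sub_val y1)^-1 * sub_val x1 = sub_val y2 * (sub_val x2)^-1.
    by apply: (mulgI (sub_val y1)); rewrite mulVKg mulgA -e mulgK.
  have e1 : (sub_val y1)^-1 * sub_val x1 = 1.
    apply: AD1; first by apply: subM => //; exact: subV.
    by rewrite e'; apply: subM => //; exact: subV.
  congr pair; apply: val_inj.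
    by apply: (mulgI (sub_val y1)^-1); rewrite e1 mulVg.
  by apply: (mulIg (sub_val x2)^-1); rewrite -e' e1 mulgV.
- have fr1 : range f 1 by exists 1.
  have frM x y : range f x -> range f y -> range f (x * y).
    by move=> [p _ <-] [q _ <-]; exists (p * q) => //; rewrite fM.
  have frV x : range f x -> range f x^-1.
    move=> [p _ <-]; exists p^-1 => //; apply: (mulgI (f p)).
    by rewrite -fM !mulgV f1.
  apply/(finite_indexP (Subgrp fr1 frM frV)) => /=.
  apply: fcoverS cAD => _ [x Ax [y Dy <-]].
  have Ax' : sub_pred A x by apply/asboolP.
  have Dy' : sub_pred D y by apply/asboolP.
  by exists (SubType Ax', SubType Dy').
- move=> /finite_seqP[s sP]; apply: nD.
  apply: (fcover_trans _ _ cAD); exists (map (@sub_val _ _) s) => _ [x Ax [y Dy <-]].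
  have Ax' : sub_pred A x by apply/asboolP.
  exists x; last by rewrite mulKg.
  apply/mapP; exists (SubType Ax') => //.
  by have : [set` s] (SubType Ax') by rewrite -sP.
- move=> /finite_seqP[s sP]; apply: nA.
  apply: (fcover_trans _ _ cAD); exists (map (@sub_val _ _) s) => _ [x Ax [y Dy <-]].
  have Dy' : sub_pred D y by apply/asboolP.
  exists y; last by rewrite AD// mulKg.
  apply/mapP; exists (SubType Dy') => //.
  by have : [set` s] (SubType Dy') by rewrite -sP.
Qed.

(** A and B may intersect, so B is replaced by a complement D of A /\ B in
    B: the product A D is direct, and it has finite index because A absorbs
    A /\ B. *)
Lemma reducible_of_lattice A B : commuting (sub_set A) (sub_set B) ->
  fcover (prodset (sub_set A) (sub_set B)) [set: G] ->
  ~ fcover (sub_set A) [set: G] -> ~ fcover (sub_set B) [set: G] ->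
  lattice_like R (sub_set B) -> reducible G.
Proof.
move=> AB cAB nA nB latB.
pose Cs := sub_set A `&` sub_set B.
have C1 : Cs 1 by split; exact: sub1.
have CM x y : Cs x -> Cs y -> Cs (x * y) by move=> [? ?] [? ?]; split; exact: subM.
have CV x : Cs x -> Cs x^-1 by move=> [? ?]; split; exact: subV.
have [|D [DB CD cD]] := @lattice_complement B (Subgrp C1 CM CV) _ latB.
  by move=> x [].
have AD : commuting (sub_set A) (sub_set D) by move=> x y Ax /DB; exact: AB.
apply: (@reducible_of_direct A D) => //.
- by move=> x Ax Dx; apply: CD => //; split=> //; exact: DB.
- apply: (fcover_trans _ _ cAB).
  have /= [s sP] := cD.
  have sB : exists t : seq G, (forall x, x \in t -> sub_set B x) /\
      (forall g, sub_set B g -> exists2 x, x \in t & prodset Cs (sub_set D) (x^-1 * g)).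
    exists [seq x <- s | sub_pred B x]; split=> [x|g Bg].
      by rewrite mem_filter => /andP[/asboolP].
    have [x xs xg] := sP g Bg; exists x => //; rewrite mem_filter xs andbT.
    apply/asboolP; case: xg => c [_ Bc] [d /DB Bd e].
    have -> : x = g * (c * d)^-1 by rewrite e invgM invgK mulVKg.
    by apply: subM => //; apply/subV/subM.
  have [t [tB tP]] := sB; exists t => _ [a Aa [b Bb <-]].
  have [x xt [c [Ac Bc] [d Dd e]]] := tP b Bb; exists x => //.
  exists (a * c); first exact: subM.
  exists d => //; rewrite -mulgA e mulgA (AB a x^-1)//; last exact/subV/tB.
  by rewrite mulgA.
- move=> cD'; apply: nB; apply: fcoverS cD'; exact: DB.
Qed.

End Criterion.

(** * Commuting pairs of subgroups *)

Section NotIIPP.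
Variables (R : realType) (G : groupType).
Implicit Types (A B C H : subgrp G).
Local Open Scope group_scope.

Definition virtually_lattice_like B := exists B0 : subgrp G,
  [/\ sub_set B0 `<=` sub_set B, fcover (sub_set B0) (sub_set B) &
      lattice_like R (sub_set B0)].

(** The only property of a fundamental group that the geometric part has to
    establish. Passing to H disposes of the reflections in the isometry
    groups. *)
Definition commuting_pairs_split := exists H : subgrp G,
  fcover (sub_set H) [set: G] /\
  forall A B, sub_set A `<=` sub_set H -> sub_set B `<=` sub_set H ->
    commuting (sub_set A) (sub_set B) ->
    fcover (prodset (sub_set A) (sub_set B)) [set: G] ->
    virtually_lattice_like A \/ virtually_lattice_like B.

Definition subI A H : subgrp G :=
  @Subgrp G (sub_set A `&` sub_set H) (conj (sub1 A) (sub1 H))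
    (fun x y Hx Hy => conj (subM Hx.1 Hy.1) (subM Hx.2 Hy.2))
    (fun x Hx => conj (subV Hx.1) (subV Hx.2)).

Lemma commutingC (A B : set G) : commuting A B -> commuting B A.
Proof. by move=> AB x y Bx Ay; exact/esym/AB. Qed.

Lemma prodsetC (A B : set G) : commuting A B -> prodset A B = prodset B A.
Proof.
move=> AB; apply/seteqP; split=> _ [x Ax [y By <-]].
  by exists y => //; exists x => //; exact/esym/AB.
by exists y => //; exists x => //; exact/AB.
Qed.

Lemma reducible_of_virtually_lattice A B :
  commuting (sub_set A) (sub_set B) ->
  fcover (prodset (sub_set A) (sub_set B)) [set: G] ->
  ~ fcover (sub_set A) [set: G] -> ~ fcover (sub_set B) [set: G] ->
  virtually_lattice_like B -> reducible G.
Proof.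
move=> AB cAB nA nB [B0 [B0B cB0 lB0]].
apply: (@reducible_of_lattice R G A B0) => //.
- by move=> x y Ax /B0B; exact: AB.
- apply: (fcover_trans _ _ cAB); apply: fcover_prod => //.
  exact: fcover_refl.
- move=> c; apply: nB; exact: fcoverS c.
Qed.

(** The commuting images of the two factors are intersected with H; their
    indices remain infinite. *)
Lemma not_IIPP : commuting_pairs_split -> irreducible G -> ~ IIPP G.
Proof.
move=> [H [cH HP]] irrG [infG [G1 [G2 [phi [fi1 nA nB]]]]]; apply: irrG.
pose fA (x : G1) := phi (x, 1); pose fB (y : G2) := phi (1, y).
have fAM x y : fA (x * y) = fA x * fA y.
  by rewrite /fA -gmulfM; congr (phi _); congr pair; rewrite mulg1.
have fBM x y : fB (x * y) = fB x * fB y.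
  by rewrite /fB -gmulfM; congr (phi _); congr pair; rewrite mulg1.
have fAB x y : fA x * fB y = phi (x, y).
  by rewrite /fA /fB -gmulfM; congr (phi _); congr pair; rewrite ?mulg1 ?mul1g.
have fBA x y : fB y * fA x = phi (x, y).
  by rewrite /fA /fB -gmulfM; congr (phi _); congr pair; rewrite ?mulg1 ?mul1g.
have rM (K : groupType) (f : K -> G) : {morph f : x y / x * y} ->
    [/\ range f 1, forall x y, range f x -> range f y -> range f (x * y) &
        forall x, range f x -> range f x^-1].
  move=> fM; have f1 : f 1 = 1 by apply: (mulgI (f 1)); rewrite -fM !mulg1.
  split; first by exists 1.
    by move=> _ _ [x _ <-] [y _ <-]; exists (x * y).
  by move=> _ [x _ <-]; exists x^-1 => //; apply: (mulgI (f x)); rewrite -fM !mulgV f1.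
have [A1 AM AV] := rM G1 fA fAM; have [B1 BM BV] := rM G2 fB fBM.
pose A := Subgrp A1 AM AV; pose B := Subgrp B1 BM BV.
have AB : commuting (sub_set A) (sub_set B).
  by move=> _ _ [x _ <-] [y _ <-]; rewrite fAB fBA.
have AB_cover : fcover (prodset (sub_set A) (sub_set B)) [set: G].
  have [P1 PM PV] := rM _ phi (@gmulfM _ _ phi).
  have /finite_indexP : finite_index (sub_set (Subgrp P1 PM PV)) by [].
  apply: fcoverS => _ [[x y] _ <-]; rewrite -fAB.
  by exists (fA x); [exists x|exists (fB y); [exists y|]].
have nA' : ~ fcover (sub_set A) [set: G] by move/finite_indexP.
have nB' : ~ fcover (sub_set B) [set: G] by move/finite_indexP.
have cI (S : subgrp G) : fcover (sub_set (subI H S)) (sub_set S).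
  exact: (@fcoverI _ H S setT).
have sI (S : subgrp G) : sub_set (subI H S) `<=` sub_set S by move=> x [].
have sIH (S : subgrp G) : sub_set (subI H S) `<=` sub_set H by move=> x [].
have AB0 : commuting (sub_set (subI H A)) (sub_set (subI H B)).
  by move=> x y /sI Ax /sI; exact: AB.
have cAB0 : fcover (prodset (sub_set (subI H A)) (sub_set (subI H B))) [set: G].
  by apply: (fcover_trans _ _ AB_cover); apply: fcover_prod.
have [lA|lB] := HP _ _ (@sIH A) (@sIH B) AB0 cAB0.
- apply: (@reducible_of_virtually_lattice (subI H B) (subI H A)) => //.
  + exact: commutingC.
  + by rewrite prodsetC//; exact: commutingC.
  + by move=> c; apply: nB'; apply: fcoverS c; exact: sI.
  + by move=> c; apply: nA'; apply: fcoverS c; exact: sI.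
- apply: (@reducible_of_virtually_lattice (subI H A) (subI H B)) => //.
  + by move=> c; apply: nA'; apply: fcoverS c; exact: sI.
  + by move=> c; apply: nB'; apply: fcoverS c; exact: sI.
Qed.

End NotIIPP.

(** * Smooth functions and partial derivatives *)

Section Smooth.
Variables (R : realType) (V : normedModType R).

Lemma class_CS (W : normedModType R) k (f : V -> W) :
  class_C k.+1 f -> class_C k f.
Proof.
elim: k f => [f [df _] x|k IHk f [df Df]]; first exact: differentiable_continuous.
by split=> // v; apply/IHk/Df.
Qed.

Lemma smooth_diff (W : normedModType R) (f : V -> W) x :
  smooth f -> differentiable f x.
Proof. by move=> /(_ 1%N)[]. Qed.

Lemma smooth_continuous (W : normedModType R) (f : V -> W) :
  smooth f -> continuous f.
Proof. by move=> /(_ 0%N). Qed.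

Lemma smoothD (W : normedModType R) (f : V -> W) v :
  smooth f -> smooth (fun x => 'D_v f x).
Proof. by move=> sf k; have [_] := sf k.+1; exact. Qed.

Lemma smooth_derivable (W : normedModType R) (f : V -> W) x v :
  smooth f -> derivable f x v.
Proof. by move=> /(smooth_diff x)/diff_derivable. Qed.

Lemma class_C_cst (W : normedModType R) k (c : W) : class_C k (fun _ : V => c).
Proof.
elim: k c => [|k IHk] c /=; first exact: cst_continuous.
split=> [x|v]; first exact: differentiable_cst.
have -> : (fun x => 'D_v (fun=> c) x) = (fun _ => 0) by apply/funext => x; exact: derive_cst.
exact: IHk.
Qed.

Lemma class_C_add k (f g : V -> R) : class_C k f -> class_C k g ->
  class_C k (fun x => f x + g x).
Proof.
elim: k f g => [|k IHk] f g /=; first by move=> cf cg x; apply: cvgD; [exact: cf|exact: cg].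
move=> [df Df] [dg Dg]; split=> [x|v]; first exact: differentiableD.
have -> : (fun x => 'D_v (fun x => f x + g x) x) = (fun x => 'D_v f x + 'D_v g x).
  by apply/funext => x; rewrite deriveD//; exact: diff_derivable.
exact: IHk.
Qed.

Lemma deriveM_real (f g : V -> R) x v : differentiable f x -> differentiable g x ->
  'D_v (fun x => f x * g x) x = 'D_v f x * g x + f x * 'D_v g x.
Proof.
move=> df dg; rewrite deriveM; [|exact: diff_derivable..].
by rewrite /GRing.scale /= addrC [g x * _]mulrC.
Qed.

Lemma class_C_mul k (f g : V -> R) : class_C k f -> class_C k g ->
  class_C k (fun x => f x * g x).
Proof.
elim: k f g => [|k IHk] f g; first by move=> cf cg x; apply: cvgM; [exact: cf|exact: cg].
move=> Cf Cg; have [df Df] := Cf; have [dg Dg] := Cg.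
split=> [x|v]; first exact: differentiableM.
have -> : (fun x => 'D_v (fun x => f x * g x) x) =
  (fun x => 'D_v f x * g x + f x * 'D_v g x).
  by apply/funext => x; rewrite deriveM_real.
by apply: class_C_add; apply: IHk; first [exact: Df|exact: Dg|exact: class_CS].
Qed.

Lemma is_derive_expR_comp (f : V -> R) x v : differentiable f x ->
  is_derive x v (fun x => expR (f x)) (expR (f x) * 'D_v f x).
Proof.
move=> df; have de : differentiable expR (f x) by exact/derivable1_diffP/derivable_expR.
have dfe : differentiable (expR \o f) x by exact: differentiable_comp.
apply: DeriveDef; first exact: (diff_derivable dfe).
rewrite -/(expR \o f) deriveE// diff_comp//= diff1E// derive1E.
have -> : 'D_1 expR (f x) = expR (f x) by have h := is_derive_expR (f x); rewrite derive_val.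
by rewrite -deriveE// /GRing.scale /= mulrC.
Qed.

Lemma differentiable_exp (f : V -> R) x : differentiable f x ->
  differentiable (fun x => expR (f x)) x.
Proof.
move=> df; apply: (@differentiable_comp _ _ _ _ f expR) => //.
exact/derivable1_diffP/derivable_expR.
Qed.

Lemma class_C_exp k (f : V -> R) : class_C k f -> class_C k (fun x => expR (f x)).
Proof.
elim: k f => [|k IHk] f.
  by move=> cf x; apply: continuous_comp; [exact: cf|exact: continuous_expR].
move=> Cf; have [df Df] := Cf; split=> [x|v]; first exact: differentiable_exp.
have -> : (fun x => 'D_v (fun x => expR (f x)) x) = (fun x => expR (f x) * 'D_v f x).
  by apply/funext => x; have h := is_derive_expR_comp v (df x); rewrite derive_val.
by apply: class_C_mul; [apply/IHk/class_CS|exact: Df].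
Qed.

Lemma smooth_cst (c : R) : smooth (fun _ : V => c).
Proof. by move=> k; exact: class_C_cst. Qed.

Lemma smooth_add (f g : V -> R) : smooth f -> smooth g -> smooth (fun x => f x + g x).
Proof. by move=> sf sg k; exact: class_C_add. Qed.

Lemma smooth_mul (f g : V -> R) : smooth f -> smooth g -> smooth (fun x => f x * g x).
Proof. by move=> sf sg k; exact: class_C_mul. Qed.

Lemma smooth_exp (f : V -> R) : smooth f -> smooth (fun x => expR (f x)).
Proof. by move=> sf k; exact: class_C_exp. Qed.

Lemma smooth_opp (f : V -> R) : smooth f -> smooth (fun x => - f x).
Proof.
move=> sf; have -> : (fun x => - f x) = (fun x => -1 * f x).
  by apply/funext => x; rewrite mulN1r.
by apply: smooth_mul => //; exact: smooth_cst.
Qed.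

Lemma smooth_sum (I : Type) (r : seq I) (P : pred I) (f : I -> V -> R) :
  (forall i, smooth (f i)) -> smooth (fun x => \sum_(i <- r | P i) f i x).
Proof.
move=> sf; elim: r => [|i r IHr].
  have -> : (fun x => \sum_(i <- [::] | P i) f i x) = (fun=> 0).
    by apply/funext => x; rewrite big_nil.
  exact: smooth_cst.
have -> : (fun x => \sum_(i <- i :: r | P i) f i x) =
    (fun x => (if P i then f i x else 0) + \sum_(i <- r | P i) f i x).
  by apply/funext => x; rewrite big_cons; case: ifP => // _; rewrite add0r.
by apply: smooth_add => //; case: (P i) => //; exact: smooth_cst.
Qed.

Lemma derive_expR_comp (f : V -> R) x v : differentiable f x ->
  'D_v (fun x => expR (f x)) x = expR (f x) * 'D_v f x.
Proof. by move=> df; have h := is_derive_expR_comp v df; rewrite derive_val. Qed.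

Lemma derive_sum_real (I : Type) (r : seq I) (f : I -> V -> R) x v :
  (forall i, smooth (f i)) ->
  'D_v (fun x => \sum_(i <- r) f i x) x = \sum_(i <- r) 'D_v (f i) x.
Proof.
move=> sf; elim: r => [|i r IHr].
  have -> : (fun x => \sum_(i <- [::]) f i x) = (fun=> 0).
    by apply/funext => y; rewrite big_nil.
  by rewrite derive_cst big_nil.
have -> : (fun x => \sum_(i <- i :: r) f i x) =
    (fun x => f i x + \sum_(i <- r) f i x).
  by apply/funext => y; rewrite big_cons.
rewrite deriveD; last 2 first.
  - exact: smooth_derivable.
  - exact/smooth_derivable/smooth_sum.
by rewrite IHr big_cons.
Qed.

Lemma deriveN_real (f : V -> R) x v : differentiable f x ->
  'D_v (fun x => - f x) x = - 'D_v f x.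
Proof. by move=> df; rewrite deriveN//; exact: diff_derivable. Qed.

Lemma deriveD_real (f g : V -> R) x v : differentiable f x -> differentiable g x ->
  'D_v (fun x => f x + g x) x = 'D_v f x + 'D_v g x.
Proof. by move=> df dg; rewrite deriveD//; exact: diff_derivable. Qed.

End Smooth.

Section Coordinates.
Variables (R : realType) (n : nat).
Implicit Types (x v : 'rV[R]_n) (h : 'rV[R]_n -> R).

Lemma diff_coord m (f : 'rV[R]_n -> 'rV[R]_m) x j : differentiable f x ->
  differentiable (fun x => f x 0 j) x.
Proof.
move=> df; apply: (@differentiable_comp _ _ _ _ f (fun y : 'rV[R]_m => y 0 j)) => //.
exact: differentiable_coord.
Qed.

Lemma derive_coord m (f : 'rV[R]_n -> 'rV[R]_m) x v j : differentiable f x ->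
  'D_v (fun x => f x 0 j) x = ('D_v f x) 0 j.
Proof.
by move=> df; rewrite derive_mx ?mxE//; exact: diff_derivable.
Qed.

Lemma smooth_comp_coord m (f : 'rV[R]_n -> 'rV[R]_m) j :
  smooth f -> smooth (fun x => f x 0 j).
Proof.
move=> sf k; elim: k f sf => [|k IHk] f sf.
  move=> x; apply: (@continuous_comp _ _ _ f (fun y : 'rV[R]_m => y 0 j)).
    exact: smooth_continuous.
  exact: coord_continuous.
split=> [x|v]; first exact/diff_coord/smooth_diff.
have -> : (fun x => 'D_v (fun x => f x 0 j) x) = (fun x => ('D_v f x) 0 j).
  by apply/funext => x; rewrite derive_coord//; exact: smooth_diff.
by apply: IHk; exact: smoothD.
Qed.

Lemma smooth_coord j : smooth (fun x => x 0 j).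
Proof.
apply: smooth_comp_coord => -[|k]; first by move=> x; exact: cvg_id.
split=> [x|v]; first by have [] := is_diff_id x.
have -> : (fun x : 'rV[R]_n => 'D_v (fun x => x) x) = (fun=> v).
  by apply/funext => x; rewrite derive_id.
exact: class_C_cst.
Qed.

Lemma derive_coord_id x v j : 'D_v (fun x : 'rV[R]_n => x 0 j) x = v 0 j.
Proof. by rewrite (@derive_coord n id) ?derive_id//. Qed.

Definition pd (a : 'I_n) h x : R := 'D_(delta_mx 0 a) h x.

Lemma derive_pd h x v : differentiable h x -> 'D_v h x = \sum_a v 0 a * pd a h x.
Proof.
move=> dh; rewrite deriveE// {1}(row_sum_delta v) linear_sum /=.
by apply: eq_bigr => a _; rewrite linearZ /= /pd deriveE.
Qed.

Lemma smooth_pd a h : smooth h -> smooth (pd a h).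
Proof. exact: smoothD. Qed.

End Coordinates.

(** * Symmetry of second derivatives *)

Section Schwarz.
Variables (R : realType) (V : normedModType R).
Implicit Types (x u v : V) (h : V -> R).

Lemma is_derive_line h x u (r : R) : differentiable h (x + r *: u) ->
  is_derive r 1 (fun r => h (x + r *: u)) ('D_u h (x + r *: u)).
Proof.
move=> dh; have E : (fun k : R => k^-1 *: ((((fun r => h (x + r *: u)) \o shift r) (k *: 1)) - h (x + r *: u))) =
    (fun k : R => k^-1 *: ((h \o shift (x + r *: u)) (k *: u) - h (x + r *: u))).
  apply/funext => k /=.
  by rewrite [_%:A]mulr1 scalerDl addrCA.
have dd : derivable h (x + r *: u) u by exact: diff_derivable.
apply: DeriveDef; first by rewrite /derivable E.
by rewrite /derive E.
Qed.

Lemma MVT_line h x u (s : R) : (forall y, differentiable h y) -> 0 <= s ->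
  exists2 r, 0 <= r <= s & h (x + s *: u) - h x = 'D_u h (x + r *: u) * s.
Proof.
move=> dh s0; pose f r := h (x + r *: u).
have df (r : R) : is_derive r 1 f ('D_u h (x + r *: u)) by exact: is_derive_line.
have [|r r0s] := @MVT_segment R f (fun r => 'D_u h (x + r *: u)) 0 s s0
    (fun r _ => df r).
  apply: continuous_subspaceT => r.
  apply: differentiable_continuous; apply/derivable1_diffP.
  by have [] := df r.
rewrite /f scale0r addr0 subr0 => E; exists r => //.
Qed.

(** Apply the mean value theorem to the increment y |-> h (y + s v) - h y
    along u, and then to its derivative along v. *)
Lemma second_difference h x u v (s : R) : smooth h -> 0 < s ->
  exists r q, [/\ 0 <= r <= s, 0 <= q <= s &
    h (x + s *: u + s *: v) - h (x + s *: u) - (h (x + s *: v) - h x) =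
    'D_v (fun y => 'D_u h y) (x + r *: u + q *: v) * s * s].
Proof.
move=> sh s0; have s0' := ltW s0.
pose k y := h (y + s *: v) - h y.
have diag_shift y : differentiable (fun y => h (y + s *: v)) y.
  apply: (@differentiable_comp _ _ _ _ (fun y => y + s *: v) h); last exact: smooth_diff.
  by apply: differentiableD.
have dk y : differentiable k y.
  by apply: differentiableB => //; exact: smooth_diff.
have [r r0s] := @MVT_line k x u s dk s0'.
have Dk y : 'D_u k y = 'D_u h (y + s *: v) - 'D_u h y.
  rewrite /k deriveB; [|exact/diff_derivable/diag_shift|exact: smooth_derivable].
  congr (_ - _); rewrite /derive.
  set F1 := fun _ : R => _; set F2 := fun _ : R => _; suff -> : F1 = F2 by [].
  by apply/funext => t; rewrite /F1 /F2 /= addrA.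
rewrite Dk /k => kE.
have [|q q0s qE] := @MVT_line (fun y => 'D_u h y) (x + r *: u) v s _ s0'.
  by move=> y; apply/smooth_diff/smoothD.
exists r, q; split => //.
by rewrite kE qE.
Qed.

(** The second difference of h is symmetric in u and v. By
    [second_difference] it is s^2 times a value of each mixed derivative
    near x, and both are continuous. *)
Lemma schwarz h x u v : smooth h ->
  'D_v (fun y => 'D_u h y) x = 'D_u (fun y => 'D_v h y) x.
Proof.
move=> sh; apply/eqP/negPn/negP => neq.
set A := fun y => 'D_v (fun y => 'D_u h y) y; set B := fun y => 'D_u (fun y => 'D_v h y) y.
have cA : continuous A by apply: smooth_continuous; do 2 apply: smoothD.
have cB : continuous B by apply: smooth_continuous; do 2 apply: smoothD.
pose e := `|A x - B x| / 2.
have e0 : 0 < e by rewrite divr_gt0// normr_gt0 subr_eq0.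
have /cvgrPdist_lt/(_ e e0) nA := cA x; have /cvgrPdist_lt/(_ e e0) nB := cB x.
have /nbhs_normP[d /= d0 dP] : \forall y \near x, `|A x - A y| < e /\ `|B x - B y| < e.
  exact: filterI nA nB.
pose N := `|u| + `|v| + 1.
have N0 : 0 < N by rewrite ltr_wpDl// addr_ge0.
pose s := d / 2 / N.
have s0 : 0 < s by rewrite !divr_gt0.
have near_x r q : 0 <= r <= s -> 0 <= q <= s -> ball_ Num.norm x d (x + r *: u + q *: v).
  move=> /andP[r0 rs] /andP[q0 qs]; rewrite /ball_ /= -addrA opprD addrA subrr sub0r normrN.
  apply: le_lt_trans (ler_normD _ _) _; rewrite !normrZ !ger0_norm//.
  apply: (@le_lt_trans _ _ (s * N)).
    rewrite /N !mulrDr mulr1 -[leLHS]addr0; apply: lerD; last exact: ltW.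
    by apply: lerD; rewrite ler_wpM2r.
  by rewrite /s divfK ?gt_eqF// ltr_pdivrMr// ltr_pMr// ltr1n.
clearbody s.
have [r [q [r0s q0s E1]]] := @second_difference h x u v s sh s0.
have [r' [q' [r0s' q0s' E2]]] := @second_difference h x v u s sh s0.
have [Ay _] := dP _ (near_x _ _ r0s q0s).
have [_] := dP _ (near_x _ _ q0s' r0s').
rewrite [x + _ + _]addrAC => By.
have AB : A (x + r *: u + q *: v) = B (x + r' *: v + q' *: u).
  have ss0 : s * s != 0 by rewrite mulf_neq0// lt0r_neq0.
  have cancel_s (a b : R) : a * s * s = b * s * s -> a = b.
    by move=> ab; apply: (mulIf ss0); rewrite !mulrA; exact: ab.
  apply: cancel_s; transitivity (h (x + s *: u + s *: v) - h (x + s *: u) - (h (x + s *: v) - h x)).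
    exact: esym E1.
  transitivity (h (x + s *: v + s *: u) - h (x + s *: v) - (h (x + s *: u) - h x)); last exact: E2.
  by rewrite [x + s *: v + s *: u]addrAC; move: (h _) (h (x + _)) (h (x + s *: v)) (h x) => *; ring.
move: Ay By; rewrite AB; set b := B _ => Ay By; clear E1 E2 AB.
move: (A x) (B x) b @e e0 {nA nB dP} Ay By => a0 b0 b e e0 Ay By.
have : `|a0 - b0| < e + e.
  have -> : a0 - b0 = (a0 - b) - (b0 - b) by ring.
  apply: le_lt_trans (ler_normB _ _) _; exact: ltrD.
by rewrite /e -splitr ltxx.
Qed.

Lemma derive0_cst h : (forall y, differentiable h y) ->
  (forall y u, 'D_u h y = 0) -> forall x y, h x = h y.
Proof.
move=> dh Dh x y; have [r _] := @MVT_line h y (x - y) 1 dh ler01.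
by rewrite scale1r subrKC Dh mul0r => /eqP; rewrite subr_eq0 => /eqP.
Qed.

End Schwarz.

Section Affine.
Variables (R : realType) (n : nat).
Implicit Types (x v : 'rV[R]_n) (h : 'rV[R]_n -> R).

Lemma affine_of_pd h (m : 'I_n -> R) : smooth h ->
  (forall a x, pd a h x = m a) -> forall x, h x = h 0 + \sum_a x 0 a * m a.
Proof.
move=> sh hm x.
pose l a (y : 'rV[R]_n) := y 0 a * m a.
have sl a : smooth (l a) by apply: smooth_mul; [exact: smooth_coord|exact: smooth_cst].
pose k y := h y + - \sum_a l a y.
have sk : smooth k.
  apply: smooth_add => //; apply: smooth_opp; exact: smooth_sum.
have Dk y u : 'D_u k y = 0.
  rewrite deriveD_real; [|exact: smooth_diff|exact/smooth_diff/smooth_opp/smooth_sum].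
  rewrite deriveN_real; last exact/smooth_diff/smooth_sum.
  rewrite derive_sum_real// derive_pd; last exact: smooth_diff.
  rewrite -sumrB big1// => a _; rewrite hm /l deriveM_real.
  - by rewrite derive_coord_id derive_cst mulr0 addr0 subrr.
  - exact/smooth_diff/smooth_coord.
  - exact/smooth_diff/smooth_cst.
have := derive0_cst (fun y => smooth_diff y sk) Dk x 0.
rewrite /k /l [X in _ = _ + - X]big1 => [|a _]; last by rewrite mxE mul0r.
by rewrite subr0 => /eqP; rewrite subr_eq => /eqP.
Qed.

End Affine.

(** * Frames with constant structure coefficients *)

(** The rows of [fr x] are vector fields forming a basis at each point, with
    inverse matrix [cofr x], whose brackets have constant coefficients
    [brk], as for the left-invariant fields of a Lie group. Smoothness is
    asked after composition with a map f because the frame is also evaluated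
    at the image of an isometry. *)
Record frame (R : realType) (n : nat) := Frame {
  fr : 'rV[R]_n -> 'M[R]_n;
  cofr : 'rV[R]_n -> 'M[R]_n;
  brk : 'I_n -> 'I_n -> 'I_n -> R;
  frK : forall x, fr x *m cofr x = 1%:M;
  fr_smooth : forall f : 'rV[R]_n -> 'rV[R]_n, (forall b, smooth (fun x => f x 0 b)) ->
    forall i j, smooth (fun x => fr (f x) i j);
  cofr_smooth : forall f : 'rV[R]_n -> 'rV[R]_n, (forall b, smooth (fun x => f x 0 b)) ->
    forall i j, smooth (fun x => cofr (f x) i j);
  brkN : forall k l m, brk k l m = - brk l k m;
  fr_brk : forall x k l b,
    \sum_a fr x k a * pd a (fun y => fr y l b) x -
    \sum_a fr x l a * pd a (fun y => fr y k b) x = \sum_m brk k l m * fr x m b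
}.

Section FrameCalculus.
Variables (R : realType) (n : nat) (F : frame R n).
Implicit Types (x : 'rV[R]_n) (h : 'rV[R]_n -> R) (k l m : 'I_n).

(** The derivative of h along the k-th field of the frame. *)
Definition fD k h x : R := \sum_a fr F x k a * pd a h x.

Lemma cofrK x : cofr F x *m fr F x = 1%:M.
Proof. exact/mulmx1C/frK. Qed.

Lemma fr_sm i j : smooth (fun x => fr F x i j).
Proof. by apply: (@fr_smooth _ _ F id) => b; exact: smooth_coord. Qed.

Lemma fD_cst k (c : R) x : fD k (fun=> c) x = 0.
Proof. by rewrite /fD big1// => a _; rewrite /pd derive_cst mulr0. Qed.

Lemma fD_add k h1 h2 x : smooth h1 -> smooth h2 ->
  fD k (fun y => h1 y + h2 y) x = fD k h1 x + fD k h2 x.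
Proof.
move=> s1 s2; rewrite /fD -big_split; apply: eq_bigr => a _.
by rewrite /pd deriveD_real ?mulrDr//; exact: smooth_diff.
Qed.

Lemma fD_opp k h x : smooth h -> fD k (fun y => - h y) x = - fD k h x.
Proof.
move=> s; rewrite /fD -sumrN; apply: eq_bigr => a _.
by rewrite /pd deriveN_real ?mulrN//; exact: smooth_diff.
Qed.

Lemma fD_mul k h1 h2 x : smooth h1 -> smooth h2 ->
  fD k (fun y => h1 y * h2 y) x = fD k h1 x * h2 x + h1 x * fD k h2 x.
Proof.
move=> s1 s2; rewrite /fD mulr_suml mulr_sumr -big_split /=; apply: eq_bigr => a _.
by rewrite /pd deriveM_real; [ring|exact: smooth_diff..].
Qed.

Lemma fD_sum k (I : Type) (r : seq I) (g : I -> 'rV[R]_n -> R) x :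
  (forall i, smooth (g i)) ->
  fD k (fun y => \sum_(i <- r) g i y) x = \sum_(i <- r) fD k (g i) x.
Proof.
move=> sg; rewrite /fD exchange_big; apply: eq_bigr => a _.
by rewrite /pd derive_sum_real// mulr_sumr.
Qed.

Lemma pdC a b h x : smooth h -> pd a (pd b h) x = pd b (pd a h) x.
Proof. by move=> sh; rewrite /pd (schwarz x (delta_mx 0 b) (delta_mx 0 a) sh). Qed.

(** The second derivatives cancel by symmetry; what remains is the
    derivative along the bracket of the two fields. *)
Lemma fD_comm k l h x : smooth h ->
  fD k (fD l h) x - fD l (fD k h) x = \sum_m brk F k l m * fD m h x.
Proof.
move=> sh.
pose P k' l' := \sum_b (\sum_a fr F x k' a * pd a (fun y => fr F y l' b) x) * pd b h x.
pose S k' l' := \sum_b \sum_a fr F x l' b * fr F x k' a * pd a (pd b h) x.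
have E k' l' : fD k' (fD l' h) x = P k' l' + S k' l'.
  rewrite (@fD_sum k' _ _ (fun b y => fr F y l' b * pd b h y)); last first.
    by move=> b; apply: smooth_mul; [exact: fr_sm|exact: smooth_pd].
  rewrite -big_split; apply: eq_bigr => b _.
  rewrite fD_mul; [|exact: fr_sm|exact: smooth_pd].
  congr (_ + _); rewrite /fD mulr_sumr; apply: eq_bigr => a _.
  by rewrite mulrA.
have SC : S k l = S l k.
  rewrite /S exchange_big; apply: eq_bigr => a _; apply: eq_bigr => b _.
  by rewrite (pdC _ _ x sh) (mulrC (fr F x l b)).
rewrite !E SC opprD addrACA subrr addr0 /P -sumrB.
under eq_bigr do rewrite -mulrBl fr_brk mulr_suml.
rewrite exchange_big; apply: eq_bigr => m _.
by rewrite /fD mulr_sumr; apply: eq_bigr => b _; rewrite mulrA.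
Qed.

Lemma pd_fD a h x : pd a h x = \sum_k cofr F x a k * fD k h x.
Proof.
rewrite /fD; under eq_bigr do rewrite mulr_sumr.
rewrite exchange_big (bigD1 a)//= [X in _ + X]big1 ?addr0 => [|b ba].
  under eq_bigr do rewrite mulrA.
  rewrite -mulr_suml; have /matrixP/(_ a a) := cofrK x.
  by rewrite !mxE eqxx => ->; rewrite mul1r.
under eq_bigr do rewrite mulrA.
rewrite -mulr_suml; have /matrixP/(_ a b) := cofrK x.
by rewrite !mxE eq_sym (negbTE ba) => ->; rewrite mul0r.
Qed.

Lemma fD0_cst h : smooth h -> (forall k x, fD k h x = 0) -> forall x, h x = h 0.
Proof.
move=> sh h0 x; apply: derive0_cst; first by move=> y; exact: smooth_diff.
move=> y u; rewrite derive_pd; last exact: smooth_diff.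
by rewrite big1// => a _; rewrite pd_fD big1 ?mulr0// => k _; rewrite h0 mulr0.
Qed.

(** The coefficients of the Levi-Civita connection of the metric for which
    the frame is orthonormal, given by the Koszul formula: the covariant
    derivative of the i-th field along the k-th one has j-th coordinate [om
    k i j]. They are characterized by [om_anti] (compatibility with the
    metric) and [om_torsion]. *)
Definition om k i j : R := (brk F k i j - brk F i j k + brk F j k i) / 2.

Lemma om_anti k i j : om k i j = - om k j i.
Proof.
rewrite /om (brkN F i k j) (brkN F i j k) (brkN F j k i) (brkN F k i j) (brkN F j i k).
rewrite (brkN F k j i) (brkN F i k j) -?mulNr; congr (_ / _); ring.
Qed.

Lemma om_torsion k i j : om k i j - om i k j = brk F k i j.
Proof.
rewrite /om (brkN F i k j) (brkN F k j i) (brkN F j i k); lra.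
Qed.

Definition OM k : 'M[R]_n := \matrix_(i, j) om k i j.
(** The curvature operator of the k-th and l-th fields, acting on row
    vectors of coordinates. Its trace [Ric] is the Ricci tensor up to sign. *)
Definition Rm k l : 'M[R]_n :=
  OM l *m OM k - OM k *m OM l - \sum_m brk F k l m *: OM m.
Definition Ric : 'M[R]_n := \matrix_(l, j) \sum_k Rm k l k j.

Definition smoothM (A : 'rV[R]_n -> 'M[R]_n) := forall i j, smooth (fun x => A x i j).
Definition fDM k (A : 'rV[R]_n -> 'M[R]_n) x : 'M[R]_n :=
  \matrix_(i, j) fD k (fun y => A y i j) x.

Lemma smoothM_mul A B : smoothM A -> smoothM B -> smoothM (fun x => A x *m B x).
Proof.
move=> sA sB i j.
have -> : (fun x => (A x *m B x) i j) = (fun x => \sum_m A x i m * B x m j).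
  by apply/funext => x; rewrite mxE.
by apply: smooth_sum => m; exact: smooth_mul.
Qed.

Lemma smoothM_cst A : smoothM (fun _ => A).
Proof. by move=> i j; exact: smooth_cst. Qed.

Lemma fDM_mul k A B x : smoothM A -> smoothM B ->
  fDM k (fun y => A y *m B y) x = fDM k A x *m B x + A x *m fDM k B x.
Proof.
move=> sA sB; apply/matrixP => i j; rewrite !mxE.
have -> : (fun x => (A x *m B x) i j) = (fun x => \sum_m A x i m * B x m j).
  by apply/funext => y; rewrite mxE.
rewrite (@fD_sum k _ _ (fun m y => A y i m * B y m j)); last first.
  by move=> m; exact: smooth_mul.
rewrite -big_split /=; apply: eq_bigr => m _ /=.
by rewrite fD_mul// !mxE.
Qed.

Lemma fDM_cst k A x : fDM k (fun=> A) x = 0.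
Proof. by apply/matrixP => i j; rewrite !mxE fD_cst. Qed.

Lemma fDM_sub k A B x : smoothM A -> smoothM B ->
  fDM k (fun y => A y - B y) x = fDM k A x - fDM k B x.
Proof.
move=> sA sB; apply/matrixP => i j; rewrite !mxE.
have -> : (fun x => (A x - B x) i j) = (fun x => A x i j + - B x i j).
  by apply/funext => y; rewrite !mxE.
by rewrite fD_add ?fD_opp//; exact: smooth_opp.
Qed.

Lemma fDM_comm k l A x : smoothM A ->
  fDM k (fDM l A) x - fDM l (fDM k A) x = \sum_m brk F k l m *: fDM m A x.
Proof.
move=> sA; apply/matrixP => i j; rewrite !mxE summxE.
have E k' l' : (fun y => fDM l' A y i j) = fD l' (fun y => A y i j).
  by apply/funext => y; rewrite mxE.
rewrite !E// fD_comm//; apply: eq_bigr => m _; by rewrite !mxE.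
Qed.

End FrameCalculus.

(** * Isometries, connection and curvature *)

Lemma mxDE (R : nmodType) m n (A B : 'M[R]_(m, n)) i j : (A + B) i j = A i j + B i j.
Proof. by rewrite mxE. Qed.

Lemma mxNE (R : zmodType) m n (A : 'M[R]_(m, n)) i j : (- A) i j = - A i j.
Proof. by rewrite mxE. Qed.

Section FrameIsometry.
Variables (R : realType) (n : nat) (F : frame R n) (f : 'rV[R]_n -> 'rV[R]_n).
Implicit Types (x : 'rV[R]_n) (h : 'rV[R]_n -> R) (k l m i j a b p : 'I_n).

Definition jac x : 'M[R]_n := \matrix_(a, b) pd a (fun y => f y 0 b) x.
(** The derivative of f at x, written in the frames at x and at f x. *)
Definition frot : 'rV[R]_n -> 'M[R]_n :=
  locked (fun x => fr F x *m jac x *m cofr F (f x)).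

Lemma rotE x : frot x = fr F x *m jac x *m cofr F (f x).
Proof. by rewrite /frot -lock. Qed.

Hypothesis f_smooth : forall b, smooth (fun x => f x 0 b).
Hypothesis f_diff : forall x, differentiable f x.
Hypothesis rot_orth : forall x, frot x *m (frot x)^T = 1%:M.

Lemma rot_orth' x : (frot x)^T *m frot x = 1%:M.
Proof. exact/mulmx1C/rot_orth. Qed.

Lemma fD_coord k b x : fD F k (fun y => f y 0 b) x = \sum_j frot x k j * fr F (f x) j b.
Proof.
transitivity ((fr F x *m jac x) k b).
  by rewrite mxE; apply: eq_bigr => a _; rewrite mxE.
by rewrite -[fr F x *m _]mulmx1 -(cofrK F (f x)) mulmxA -rotE mxE.
Qed.

Lemma rot_smooth : smoothM frot.
Proof.
rewrite /frot -lock.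
apply: smoothM_mul.
  apply: smoothM_mul; first exact: fr_sm.
  move=> a b; have -> : (fun x => jac x a b) = pd a (fun y => f y 0 b).
    by apply/funext => x; rewrite mxE.
  exact: smooth_pd.
by move=> i j; exact: cofr_smooth.
Qed.

Lemma fD_chain k h x : smooth h ->
  fD F k (fun y => h (f y)) x = \sum_l frot x k l * fD F l h (f x).
Proof.
move=> sh; have pdE a : pd a (fun y => h (f y)) x = \sum_b jac x a b * pd b h (f x).
  have dh : differentiable h (f x) by exact: smooth_diff.
  rewrite /pd deriveE; last exact: differentiable_comp.
  rewrite -/(h \o f) diff_comp//= -!deriveE// derive_pd//.
  apply: eq_bigr => b _; rewrite mxE; congr (_ * _).
  by rewrite /pd derive_coord.
rewrite /fD; under eq_bigr do rewrite pdE mulr_sumr.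
rewrite exchange_big /=.
under [RHS]eq_bigr do rewrite mulr_sumr.
rewrite [RHS]exchange_big /=; apply: eq_bigr => b _.
under eq_bigr do rewrite mulrA.
under [RHS]eq_bigr do rewrite mulrA.
rewrite -!mulr_suml; congr (_ * _).
transitivity ((fr F x *m jac x) k b); first by rewrite mxE.
by rewrite -[fr F x *m _]mulmx1 -(cofrK F (f x)) mulmxA -rotE mxE.
Qed.

Local Notation Q := frot.
Local Notation c := (brk F).

(** Along the frame, the derivatives of the coordinates of f are Q times the
    frame at f x ([fD_coord]). Differentiating again and antisymmetrizing,
    with [fD_comm] at x and the bracket relations at f x, leaves this
    equation for the derivatives of Q. *)
Lemma rot_torsion k i j x :
  fD F k (fun y => Q y i j) x - fD F i (fun y => Q y k j) x =
  \sum_m c k i m * Q x m j - \sum_l \sum_p Q x k l * Q x i p * c l p j.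
Proof.
pose T j := fD F k (fun y => Q y i j) x - fD F i (fun y => Q y k j) x.
pose S j := \sum_m c k i m * Q x m j - \sum_l \sum_p Q x k l * Q x i p * c l p j.
have sE j' b : smooth (fun y => fr F (f y) j' b) by exact: fr_smooth.
pose U k' i' b := \sum_j fD F k' (fun y => Q y i' j) x * fr F (f x) j b.
pose N k' i' b := \sum_l \sum_p Q x k' l * Q x i' p * fD F l (fun y => fr F y p b) (f x).
have E k' i' b : fD F k' (fD F i' (fun y => f y 0 b)) x = U k' i' b + N k' i' b.
  have -> : fD F i' (fun y => f y 0 b) = (fun y => \sum_j Q y i' j * fr F (f y) j b).
    by apply/funext => y; rewrite fD_coord.
  rewrite (@fD_sum _ _ F k' _ _ (fun j y => Q y i' j * fr F (f y) j b)); last first.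
    by move=> j'; apply: smooth_mul => //; exact: rot_smooth.
  rewrite /N [X in _ = _ + X]exchange_big -big_split /=; apply: eq_bigr => j' _ /=.
  rewrite fD_mul//; last exact: rot_smooth.
  congr (_ + _); rewrite (fD_chain k' x (fr_sm F j' b)) mulr_sumr.
  by apply: eq_bigr => l _; ring.
have key b : \sum_j T j * fr F (f x) j b = \sum_j S j * fr F (f x) j b.
  have := fD_comm F k i x (f_smooth b); rewrite !E.
  set T5 := \sum_m _ => e.
  have -> : \sum_j T j * fr F (f x) j b = U k i b - U i k b.
    by rewrite /U -sumrB; apply: eq_bigr => j' _; rewrite -mulrBl.
  suff : \sum_j S j * fr F (f x) j b = T5 - (N k i b - N i k b) by move=> ->; rewrite -e; ring.
  have -> : T5 = \sum_j (\sum_m c k i m * Q x m j) * fr F (f x) j b.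
    rewrite /T5; under eq_bigr do rewrite fD_coord mulr_sumr.
    rewrite exchange_big; apply: eq_bigr => j' _ /=; rewrite mulr_suml.
    by apply: eq_bigr => m _; rewrite mulrA.
  have -> : N k i b - N i k b = \sum_j (\sum_l \sum_p Q x k l * Q x i p * c l p j) * fr F (f x) j b.
    have -> : N i k b = \sum_l \sum_p Q x k l * Q x i p * fD F p (fun y => fr F y l b) (f x).
      rewrite /N exchange_big; apply: eq_bigr => l _; apply: eq_bigr => p _.
      by rewrite (mulrC (Q x i p)).
    rewrite /N -sumrB.
    under eq_bigr => l _.
      rewrite -sumrB.
      under eq_bigr => p _ do rewrite -mulrBr /fD fr_brk mulr_sumr.
      rewrite exchange_big /=.
      over.
    rewrite exchange_big; apply: eq_bigr => j' _ /=.
    rewrite mulr_suml; apply: eq_bigr => l _; rewrite mulr_suml.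
    by apply: eq_bigr => p _; rewrite mulrA.
  by rewrite -sumrB; apply: eq_bigr => j' _; rewrite -mulrBl.
have : \row_j T j = \row_j S j.
  rewrite -[LHS]mulmx1 -[RHS]mulmx1 -(frK F (f x)) !mulmxA; congr (_ *m _).
  apply/rowP => b; rewrite !mxE.
  under eq_bigr do rewrite mxE.
  under [RHS]eq_bigr do rewrite mxE.
  exact: key.
by move=> /rowP/(_ j); rewrite !mxE => e; exact: e.
Qed.

(* The entries of the derivative of Q times the transpose of Q. *)
Let P k i j x := \sum_m fD F k (fun y => Q y i m) x * Q x j m.

Lemma rot_sumr i j x : \sum_m Q x i m * Q x j m = (i == j)%:R.
Proof.
have /matrixP/(_ i j) := rot_orth x; rewrite !mxE => <-.
by apply: eq_bigr => m _; rewrite [_^T _ _]mxE.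
Qed.

Lemma rot_suml i j x : \sum_m Q x m i * Q x m j = (i == j)%:R.
Proof.
have /matrixP/(_ i j) := rot_orth' x; rewrite !mxE => <-.
by apply: eq_bigr => m _; rewrite [_^T _ _]mxE.
Qed.

Lemma P_antisym k i j x : P k i j x = - P k j i x.
Proof.
have h : fD F k (fun y => \sum_m Q y i m * Q y j m) x = 0.
  have -> : (fun y => \sum_m Q y i m * Q y j m) = (fun=> (i == j)%:R).
    by apply/funext => y; rewrite rot_sumr.
  by rewrite fD_cst.
rewrite (@fD_sum _ _ F k _ _ (fun m y => Q y i m * Q y j m)) in h; last first.
  by move=> m; apply: smooth_mul; exact: rot_smooth.
apply/eqP; rewrite -subr_eq0 opprK; apply/eqP; rewrite -[RHS]h /P -big_split /=.
apply: eq_bigr => m _; rewrite fD_mul; [|exact: rot_smooth..].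
by rewrite [X in _ + X]mulrC.
Qed.

Let omQ k i j x := \sum_l \sum_m \sum_p Q x k l * Q x i m * Q x j p * om F l m p.

Lemma omQ_anti k i j x : omQ k i j x = - omQ k j i x.
Proof.
rewrite /omQ -sumrN; apply: eq_bigr => l _; rewrite exchange_big -sumrN /=.
apply: eq_bigr => p _; rewrite -sumrN; apply: eq_bigr => m _.
by rewrite om_anti; ring.
Qed.

Lemma omQ_torsion k i j x : omQ k i j x - omQ i k j x =
  \sum_l \sum_m \sum_p Q x k l * Q x i m * Q x j p * c l m p.
Proof.
rewrite /omQ [X in _ - X]exchange_big -sumrB /=; apply: eq_bigr => l _.
rewrite -sumrB; apply: eq_bigr => m _; rewrite -sumrB; apply: eq_bigr => p _.
by rewrite -om_torsion; ring.
Qed.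

Lemma P_torsion k i j x : P k i j x - P i k j x =
  c k i j - \sum_l \sum_m \sum_p Q x k l * Q x i m * Q x j p * c l m p.
Proof.
rewrite /P -sumrB; under eq_bigr do rewrite -mulrBl rot_torsion mulrBl.
rewrite sumrB; congr (_ - _).
  under eq_bigr do rewrite mulr_suml.
  rewrite exchange_big /= (bigD1 j)//= [X in _ + X]big1 ?addr0 => [|m mj].
    by under eq_bigr do rewrite -mulrA; rewrite -mulr_sumr rot_sumr eqxx mulr1.
  by under eq_bigr do rewrite -mulrA; rewrite -mulr_sumr rot_sumr (negbTE mj) mulr0.
under eq_bigr do rewrite mulr_suml.
rewrite exchange_big /=; apply: eq_bigr => l _.
under eq_bigr do rewrite mulr_suml.
rewrite exchange_big /=; apply: eq_bigr => m _.
by apply: eq_bigr => p _; ring.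
Qed.

(** The difference of the two sides is antisymmetric in i, j and symmetric
    in k, i, hence zero: this is the uniqueness of the Levi-Civita
    connection. *)
Lemma PE k i j x : P k i j x = om F k i j - omQ k i j x.
Proof.
pose T k i j := P k i j x - (om F k i j - omQ k i j x).
have Ta k' i' j' : T k' i' j' = - T k' j' i'.
  by rewrite /T P_antisym om_anti omQ_anti; ring.
have Ts k' i' j' : T k' i' j' = T i' k' j'.
  apply/eqP; rewrite -subr_eq0; apply/eqP.
  have := P_torsion k' i' j' x; rewrite -omQ_torsion -om_torsion /T.
  move: (P k' i' j' x) (P i' k' j' x) (om F k' i' j') (om F i' k' j') => a b c' d.
  move: (omQ k' i' j' x) (omQ i' k' j' x) => e g; lra.
have : T k i j = - T k i j.
  by rewrite {1}Ts Ta Ts Ta opprK Ts Ta.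
move=> T2; have : T k i j = 0 by move: T2; lra.
by rewrite /T => /eqP; rewrite subr_eq0 => /eqP.
Qed.

(** An isometry carries the Levi-Civita connection to itself, so the
    derivatives of Q are expressed through Q. *)
Lemma fD_rot k i j x : fD F k (fun y => Q y i j) x =
  \sum_m om F k i m * Q x m j - \sum_l \sum_m Q x k l * Q x i m * om F l m j.
Proof.
have -> : fD F k (fun y => Q y i j) x = \sum_p P k i p x * Q x p j.
  rewrite /P; under eq_bigr do rewrite mulr_suml.
  rewrite exchange_big /= (bigD1 j)//= [X in _ + X]big1 ?addr0 => [|m mj].
    by under eq_bigr do rewrite -mulrA; rewrite -mulr_sumr rot_suml eqxx mulr1.
  by under eq_bigr do rewrite -mulrA; rewrite -mulr_sumr rot_suml (negbTE mj) mulr0.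
under eq_bigr do rewrite PE mulrBl.
rewrite sumrB; congr (_ - _).
rewrite /omQ; under eq_bigr do rewrite mulr_suml.
rewrite exchange_big /=; apply: eq_bigr => l _.
under eq_bigr do rewrite mulr_suml.
rewrite exchange_big /=; apply: eq_bigr => m _.
under eq_bigr do rewrite mulr_suml.
rewrite exchange_big /= (bigD1 j)//= [X in _ + X]big1 ?addr0 => [|p pj].
  rewrite (eq_bigr (fun p => (Q x p j * Q x p j) * (Q x k l * Q x i m * om F l m j))).
    by rewrite -mulr_suml rot_suml eqxx mul1r.
  by move=> p _; ring.
rewrite (eq_bigr (fun i0 => (Q x i0 p * Q x i0 j) * (Q x k l * Q x i m * om F l m p))).
  by rewrite -mulr_suml rot_suml (negbTE pj) mul0r.
by move=> i0 _; ring.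
Qed.

(** The connection matrix, at f x, in the direction of the image of the k-th
    field. *)
Definition OMQ k x : 'M[R]_n := \sum_l Q x k l *: OM F l.

Lemma fDM_rot k x : fDM F k Q x = OM F k *m Q x - Q x *m OMQ k x.
Proof.
apply/matrixP => i j; rewrite !mxE fD_rot; congr (_ - _).
  by apply: eq_bigr => m _; rewrite !mxE.
rewrite exchange_big; apply: eq_bigr => m _ /=; rewrite summxE mulr_sumr.
by apply: eq_bigr => l _; rewrite !mxE; ring.
Qed.

Lemma OMQ_smooth k : smoothM (OMQ k).
Proof.
move=> i j; have -> : (fun x => OMQ k x i j) = (fun x => \sum_l Q x k l * om F l i j).
  by apply/funext => x; rewrite summxE; apply: eq_bigr => l _; rewrite !mxE.
by apply: smooth_sum => l; apply: smooth_mul; [exact: rot_smooth|exact: smooth_cst].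
Qed.

Lemma fDM_OMQ k l x : fDM F k (OMQ l) x = \sum_p fD F k (fun y => Q y l p) x *: OM F p.
Proof.
apply/matrixP => i j; rewrite !mxE summxE.
have -> : (fun x => OMQ l x i j) = (fun x => \sum_p Q x l p * om F p i j).
  by apply/funext => y; rewrite summxE; apply: eq_bigr => p _; rewrite !mxE.
rewrite (@fD_sum _ _ F k _ _ (fun p y => Q y l p * om F p i j)); last first.
  by move=> p; apply: smooth_mul; [exact: rot_smooth|exact: smooth_cst].
apply: eq_bigr => p _; rewrite fD_mul; [|exact: rot_smooth|exact: smooth_cst].
by rewrite fD_cst mulr0 addr0 !mxE.
Qed.

Let mx0E i j : (0 : 'M[R]_n) i j = 0.
Proof. by rewrite mxE. Qed.

(** The integrability condition of the equation [fDM_rot]: an isometry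
    carries the curvature at x to the curvature at f x. *)
Lemma Rm_rot k l x :
  Rm F k l *m Q x = Q x *m (\sum_a \sum_b (Q x k a * Q x l b) *: Rm F a b).
Proof.
have := fDM_comm F k l x rot_smooth.
have E l' : fDM F l' Q = (fun y => OM F l' *m Q y - Q y *m OMQ l' y).
  by apply/funext => y; rewrite fDM_rot.
have E2 k' l' : fDM F k' (fDM F l' Q) x = OM F l' *m (OM F k' *m Q x - Q x *m OMQ k' x)
    - ((OM F k' *m Q x - Q x *m OMQ k' x) *m OMQ l' x + Q x *m fDM F k' (OMQ l') x).
  have sc A : smoothM (fun _ : 'rV[R]_n => A) by exact: smoothM_cst.
  have sQ := rot_smooth; have sO := OMQ_smooth l'.
  rewrite E fDM_sub; [|exact: smoothM_mul..].
  by rewrite !fDM_mul// fDM_cst mul0mx add0r fDM_rot.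
rewrite !E2.
under eq_bigr do rewrite fDM_rot scalerBr scalemxAl scalemxAr.
rewrite sumrB -mulmx_suml -mulmx_sumr.
have TO : fDM F k (OMQ l) x - fDM F l (OMQ k) x =
    \sum_m c k l m *: OMQ m x -
    \sum_a \sum_b (Q x k a * Q x l b) *: \sum_p c a b p *: OM F p.
  rewrite !fDM_OMQ -sumrB.
  under eq_bigr do rewrite -scalerBl rot_torsion scalerBl.
  rewrite sumrB; congr (_ - _).
    under eq_bigr do rewrite scaler_suml.
    rewrite exchange_big; apply: eq_bigr => m _ /=; rewrite /OMQ scaler_sumr.
    by apply: eq_bigr => p _; rewrite scalerA.
  under eq_bigr do rewrite scaler_suml.
  rewrite exchange_big; apply: eq_bigr => a _ /=.
  under eq_bigr do rewrite scaler_suml.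
  rewrite exchange_big; apply: eq_bigr => b _ /=; rewrite scaler_sumr.
  by apply: eq_bigr => p _; rewrite scalerA.
have OO k' l' : OMQ l' x *m OMQ k' x = \sum_a \sum_b (Q x k' a * Q x l' b) *: (OM F b *m OM F a).
  rewrite /OMQ mulmx_suml exchange_big /=; apply: eq_bigr => b _.
  rewrite mulmx_sumr; apply: eq_bigr => a _.
  by rewrite -scalemxAl -scalemxAr scalerA mulrC.
have -> : \sum_a \sum_b (Q x k a * Q x l b) *: Rm F a b = OMQ l x *m OMQ k x - OMQ k x *m OMQ l x
    - \sum_a \sum_b (Q x k a * Q x l b) *: \sum_p c a b p *: OM F p.
  rewrite OO OO [X in _ - X - _]exchange_big /= -!sumrB.
  apply: eq_bigr => a _; rewrite -!sumrB; apply: eq_bigr => b _.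
  by rewrite /Rm !scalerBr (mulrC (Q x l b)).
rewrite /Rm; move: TO; set X := \sum_a _; set Y := \sum_m _; set Z := \sum_m _.
move: (OM F k) (OM F l) (OMQ k x) (OMQ l x) (Q x) (fDM F k _ x) (fDM F l _ x) => A B A' B' q dB dA.
move=> TO; rewrite !(mulmxBr, mulmxBl, mulmxDr, mulmxN, mulNmx, mulmxA).
have {}TO : q *m dB = q *m dA + q *m Y - q *m X.
  by rewrite -addrA -mulmxBr -mulmxDr -TO addrC subrK.
rewrite TO => /eqP; rewrite -subr_eq0 => /eqP e.
apply/eqP; rewrite -subr_eq0; apply/eqP; rewrite -[RHS]e.
by apply/matrixP => i j; rewrite !(mxDE, mxNE, mx0E); ring.
Qed.

(** The trace of [Rm_rot]. As the Ricci tensor has constant coefficients in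
    the frame, the matrices Q of all isometries commute with one and the
    same matrix. *)
Lemma Ric_rot x : Ric F *m Q x = Q x *m Ric F.
Proof.
apply/matrixP => l j; rewrite !mxE.
transitivity (\sum_k (Rm F k l *m Q x) k j).
  under eq_bigr do rewrite mxE mulr_suml.
  rewrite exchange_big; apply: eq_bigr => k _ /=; rewrite !mxE.
  by apply: eq_bigr => i _.
under eq_bigr do rewrite Rm_rot mxE.
transitivity (\sum_a \sum_b \sum_m (\sum_k Q x k m * Q x k a) * (Q x l b * Rm F a b m j)).
  rewrite exchange_big /=.
  under eq_bigr => m _.
    under eq_bigr => k _.
      rewrite summxE mulr_sumr.
      under eq_bigr => a _ do rewrite summxE mulr_sumr.
      over.
    over.
  rewrite exchange_big /=.
  under eq_bigr => k _ do rewrite exchange_big /=.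
  rewrite exchange_big /=; apply: eq_bigr => a _.
  under eq_bigr => k _ do rewrite exchange_big /=.
  rewrite exchange_big /=; apply: eq_bigr => b _.
  rewrite exchange_big /=; apply: eq_bigr => m _; rewrite mulr_suml.
  by apply: eq_bigr => k _; rewrite mxE; ring.
rewrite exchange_big /=; apply: eq_bigr => b _; rewrite mxE mulr_sumr.
apply: eq_bigr => a _; rewrite (bigD1 a)//= [X in _ + X]big1 ?addr0 => [|m ma].
  by rewrite rot_suml eqxx mul1r.
by rewrite rot_suml (negbTE ma) mul0r.
Qed.

End FrameIsometry.

(** * Isometries of a left-invariant metric *)

Section LieFrame.
Variables (R : realType) (X : lie_model R) (F : frame R (gdim X)).
Local Notation n := (gdim X).
Implicit Types (f : 'rV[R]_n -> 'rV[R]_n) (x p u v : 'rV[R]_n).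

(** The coframe at p is the derivative at p of the left translation that
    carries p to 0; hence the frame is orthonormal for the metric of the
    model ([metricE]). *)
Definition left_invariant := forall p u, 'd (@gmul R X (ginv p)) p u = u *m cofr F p.

Hypothesis Flink : left_invariant.

Lemma metricE p u v :
  metric p u v = \sum_i (u *m cofr F p) 0 i * (v *m cofr F p) 0 i.
Proof. by apply: eq_bigr => i _; rewrite !Flink. Qed.

Section Isometry.
Variables (f : 'rV[R]_n -> 'rV[R]_n) (isof : riemannian_isometry f).

Lemma isom_smooth b : smooth (fun x => f x 0 b).
Proof. by apply: smooth_comp_coord; case: isof. Qed.

Lemma isom_diff x : differentiable f x.
Proof. by apply: smooth_diff; case: isof. Qed.

Lemma diff_jac x u : 'd f x u = u *m jac f x.
Proof.
rewrite -deriveE; last exact: isom_diff.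
apply/rowP => b; rewrite -derive_coord; last exact: isom_diff.
rewrite derive_pd; last exact/smooth_diff/isom_smooth.
by rewrite mxE; apply: eq_bigr => a _; rewrite mxE.
Qed.

Lemma isom_rot_orth x : frot F f x *m (frot F f x)^T = 1%:M.
Proof.
apply/matrixP => i j; rewrite mxE.
pose u : 'rV[R]_n := delta_mx 0 i *m fr F x; pose v : 'rV[R]_n := delta_mx 0 j *m fr F x.
have [_ _ /(_ x u v)] := isof; rewrite !metricE !diff_jac => e.
transitivity (\sum_k (u *m jac f x *m cofr F (f x)) 0 k * (v *m jac f x *m cofr F (f x)) 0 k).
  apply: eq_bigr => k _; rewrite [_^T _ _]mxE rotE; congr (_ * _).
    by rewrite /u -!mulmxA -rowE [RHS]mxE.
  by rewrite /v -!mulmxA -rowE [RHS]mxE.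
rewrite e /u /v -!mulmxA !frK !mulmx1 (bigD1 i)//= big1 ?addr0 => [|k ki].
  by rewrite !mxE !eqxx /= mul1r eq_sym.
by rewrite mxE (negbTE ki) /= ?andbF mul0r.
Qed.

End Isometry.

Lemma jac_comp f (g : 'rV[R]_n -> 'rV[R]_n) x : (forall x, differentiable f x) -> (forall x, differentiable g x) ->
  jac (fun y => f (g y)) x = jac g x *m jac f (g x).
Proof.
move=> df dg; apply/matrixP => a b; rewrite !mxE.
rewrite /pd derive_coord; last exact: differentiable_comp.
rewrite deriveE; last exact: differentiable_comp.
rewrite -/(f \o g) diff_comp//= -!deriveE// -derive_coord//.
rewrite derive_pd; last exact: diff_coord.
by apply: eq_bigr => c _; rewrite !mxE /pd -derive_coord.
Qed.

Lemma rot_comp f (g : 'rV[R]_n -> 'rV[R]_n) x : (forall x, differentiable f x) -> (forall x, differentiable g x) ->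
  frot F (fun y => f (g y)) x = frot F g x *m frot F f (g x).
Proof.
move=> df dg; rewrite !rotE jac_comp// -!mulmxA; congr (_ *m (_ *m _)).
by rewrite !mulmxA cofrK mul1mx.
Qed.

Lemma rot_id x : frot F id x = 1%:M.
Proof.
rewrite rotE; suff -> : jac id x = 1%:M by rewrite mulmx1 frK.
by apply/matrixP => a b; rewrite !mxE /pd derive_coord_id mxE eq_sym.
Qed.

(** A matrix that commutes with a diagonal matrix preserves its eigenspaces. *)
Lemma Ric_diag_rot0 f (r : 'I_n -> R) x i j : riemannian_isometry f ->
  Ric F = diag_mx (\row_i r i) -> r i != r j -> frot F f x i j = 0.
Proof.
move=> isof RicE rij.
have := Ric_rot (isom_smooth isof) (isom_diff isof) (isom_rot_orth isof) x.
rewrite RicE => /matrixP/(_ i j); rewrite mul_diag_mx mul_mx_diag !mxE => /eqP.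
rewrite mulrC -subr_eq0 -mulrBr mulf_eq0 subr_eq0 (negbTE rij) orbF.
by move/eqP.
Qed.

Section FixedLine.
Variables (f : 'rV[R]_n -> 'rV[R]_n) (i : 'I_n) (isof : riemannian_isometry f).
Hypothesis row0 : forall x j, j != i -> frot F f x i j = 0.

Lemma rot_diag_sqr x : frot F f x i i * frot F f x i i = 1.
Proof.
have := rot_sumr (isom_rot_orth isof) i i x.
by rewrite (bigD1 i)//= big1 ?addr0 ?eqxx// => j ji; rewrite row0// mul0r.
Qed.

Lemma rot_col0 x j : j != i -> frot F f x j i = 0.
Proof.
move=> ji; have := rot_sumr (isom_rot_orth isof) i j x.
rewrite (bigD1 i)//= big1 ?addr0 => [|k ki]; last by rewrite row0// mul0r.
rewrite eq_sym (negbTE ji) => /eqP; rewrite mulf_eq0 => /orP[/eqP e|/eqP//].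
by have := rot_diag_sqr x; rewrite e mul0r => /eqP; rewrite eq_sym oner_eq0.
Qed.

(** The entry has constant square 1, so its derivative vanishes. *)
Lemma rot_diag_cst x : frot F f x i i = frot F f 0 i i.
Proof.
pose h x := frot F f x i i; rewrite -/(h x) -/(h 0).
have sh : smooth h by apply: (rot_smooth F (isom_smooth isof)).
apply: (@fD0_cst _ _ F h sh) => k y.
have : fD F k (fun z => h z * h z) y = 0.
  have -> : (fun z => h z * h z) = (fun=> 1) by apply/funext => z; exact: rot_diag_sqr.
  exact: fD_cst.
rewrite fD_mul// mulrC -mulrDr => /eqP; rewrite mulf_eq0 => /orP[/eqP hy|].
  by have := rot_diag_sqr y; rewrite -/(h y) hy mul0r => /eqP; rewrite eq_sym oner_eq0.
by move=> /eqP dd; lra.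
Qed.

Lemma rot_diag_sign x : frot F f x i i = 1 \/ frot F f x i i = -1.
Proof.
have /eqP := rot_diag_sqr x; rewrite -expr2 sqrf_eq1 => /orP[] /eqP; by [left|right].
Qed.

End FixedLine.

Section Deck.
Variable M : closed_manifold X.
Local Notation dk := (deck M).

Lemma deckM g h x : dk (g * h)%g x = dk g (dk h x).
Proof. exact: actM. Qed.

Lemma deck1 x : dk 1%g x = x.
Proof. exact: act1. Qed.

Lemma rot_deckM g h x :
  frot F (dk (g * h)%g) x = frot F (dk h) x *m frot F (dk g) (dk h x).
Proof.
have -> : dk (g * h)%g = (fun y => dk g (dk h y)) :> (_ -> _).
  by apply/funext => y; exact: deckM.
by apply: rot_comp => y; apply: isom_diff; exact: deck_isometry.
Qed.

Lemma rot_deck1 x : frot F (dk 1%g) x = 1%:M.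
Proof.
have -> : dk 1%g = id :> (_ -> _) by apply/funext => y; exact: deck1.
exact: rot_id.
Qed.

Variable I : pred 'I_n.
Hypothesis rowI : forall g x i j, I i -> j != i -> frot F (dk g) x i j = 0.

Let sg g i := frot F (dk g) 0 i i.

Let sgM g h i : I i -> sg (g * h)%g i = sg g i * sg h i.
Proof.
move=> Ii; rewrite /sg rot_deckM mxE (bigD1 i)//= big1 ?addr0 => [|j ji].
  rewrite mulrC; congr (_ * _).
  by rewrite (@rot_diag_cst _ i (deck_isometry g))// => x j ji; exact: rowI.
by rewrite rowI// mul0r.
Qed.

Let sg1 i : sg 1%g i = 1.
Proof. by rewrite /sg rot_deck1 mxE eqxx. Qed.

Definition oriented_set : set (pi1 M) := [set g | forall i, I i -> sg g i = 1].

Lemma oriented1 : oriented_set 1%g.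
Proof. by move=> i Ii; exact: sg1. Qed.

Lemma orientedM g h : oriented_set g -> oriented_set h -> oriented_set (g * h)%g.
Proof. by move=> gI hI i Ii; rewrite sgM// gI// hI// mulr1. Qed.

Lemma orientedV g : oriented_set g -> oriented_set g^-1%g.
Proof.
by move=> gI i Ii; have := sgM g^-1%g g Ii; rewrite mulVg sg1 gI// mulr1 => ->.
Qed.

Definition oriented : subgrp (pi1 M) := Subgrp oriented1 orientedM orientedV.

(** The signs on the preserved lines take finitely many values, and elements
    with the same signs differ by an element that preserves all
    orientations. *)
Lemma oriented_cover : fcover (sub_set oriented) [set: pi1 M].
Proof.
pose s g : {ffun 'I_n -> bool} := [ffun i => sg g i == 1].
have /choice[r rP] : forall e : {ffun 'I_n -> bool}, exists g, (exists h, s h = e) -> s g = e.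
  move=> e; have [[g ge]|ne] := pselect (exists h, s h = e); first by exists g.
  by exists 1%g.
exists [seq r e | e <- enum {ffun 'I_n -> bool}] => g _.
exists (r (s g)); first by apply: map_f; rewrite mem_enum.
move=> i Ii; have /ffunP/(_ i) : s (r (s g)) = s g by apply: rP; exists g.
rewrite !ffunE; set a := r (s g) => e.
have sgn h : sg h i = 1 \/ sg h i = -1.
  by apply: (rot_diag_sign (deck_isometry h)) => x j ji; exact: rowI.
have aV : sg a^-1%g i = sg a i.
  have := sgM a^-1%g a Ii; rewrite mulVg sg1 => h1.
  by case: (sgn a) (sgn a^-1%g) h1 => -> [] -> //; rewrite ?mulr1 ?mul1r// => ->.
have n1 : (-1 == 1 :> R) = false by apply/eqP; lra.
rewrite sgM// aV; move: e; case: (sgn a) => ->; case: (sgn g) => ->;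
  by rewrite ?eqxx ?n1 ?mulr1 ?mulrNN ?mulr1.
Qed.

Lemma orientedE g x i : sub_set oriented g -> I i -> frot F (dk g) x i i = 1.
Proof.
move=> gI Ii; rewrite (@rot_diag_cst _ i (deck_isometry g)); first exact: gI.
by move=> y j ji; exact: rowI.
Qed.

End Deck.
End LieFrame.

(** * Cocompactness and discreteness of the deck group *)

Section MatrixNorm.
Variable R : realType.

Lemma entry_le_norm m n (A : 'M[R]_(m, n)) i j : `|A i j| <= `|A|.
Proof.
rewrite {2}/Num.norm /= mx_normrE.
exact: (le_bigmax_cond 0 (fun ij : 'I_m * 'I_n => `|A ij.1 ij.2|) (j := (i, j))).
Qed.

Lemma norm_le_entry m n (A : 'M[R]_(m, n)) c :
  0 <= c -> (forall i j, `|A i j| <= c) -> `|A| <= c.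
Proof.
by move=> c0 Ac; rewrite {1}/Num.norm /= mx_normrE; apply/bigmax_leP; split=> // -[i j].
Qed.

Lemma norm_mulmx m n p (A : 'M[R]_(m, n)) (B : 'M[R]_(n, p)) :
  `|A *m B| <= n%:R * (`|A| * `|B|).
Proof.
apply: norm_le_entry; first by rewrite !mulr_ge0.
move=> i j; rewrite mxE; apply: le_trans (ler_norm_sum _ _ _) _.
apply: (@le_trans _ _ (\sum_(k < n) `|A| * `|B|)).
  by apply: ler_sum => k _; rewrite normrM ler_pM// entry_le_norm.
by rewrite sumr_const card_ord mulr_natl.
Qed.

End MatrixNorm.

Section Cocompact.
Variables (R : realType) (X : lie_model R) (M : closed_manifold X).
Local Notation n := (gdim X).
Local Notation dk := (deck M).

Lemma deck_continuous g : continuous (dk g).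
Proof. by apply: smooth_continuous; have [] := deck_isometry g. Qed.

(** The images in the orbit space of the open balls around 0 form an
    increasing open cover. *)
Lemma deck_bounded_domain : exists N : nat, forall x, exists g y, x = dk g y /\ `|y| <= N%:R.
Proof.
have /compact_near_coveringP cov := @deck_compact _ _ M.
pose Q := {eq_quot (orbit_equiv dk)}%qT.
pose P (N : nat) (q : orbit_space dk) := exists y, `|y| <= N%:R /\ q = \pi_Q%qT y.
have : \forall N \near \oo, [set: orbit_space dk] `<=` P N.
  apply: cov => q _.
  pose y : 'rV[R]_n := repr (q : Q).
  have qy : q = \pi_Q%qT y by rewrite reprK.
  pose U : set (orbit_space dk) := [set q' | exists z, `|z| < `|y| + 1 /\ q' = \pi_Q%qT z].
  have Uo : open U.
    rewrite /open /= /quotient_open.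
    have -> : (\pi_Q%qT @^-1` U) =
       \bigcup_(g in [set: pi1 M]) [set x | `|dk g x| < `|y| + 1].
      apply/seteqP; split=> x /=.
        move=> [z [zy /eqmodP/asboolP[g gx]]]; exists g => //=; by rewrite gx.
      move=> [g _ /= gx]; exists (dk g x); split=> //.
      by apply/eqmodP/asboolP; exists g.
    apply: bigcup_open => g _.
    have -> : [set x | `|dk g x| < `|y| + 1] = (fun x => `|dk g x|) @^-1` [set r | r < `|y| + 1].
      by [].
    apply: open_comp; last exact: open_lt.
    move=> x _; apply: continuous_comp; first exact: deck_continuous.
    exact: norm_continuous.
  have Uq : nbhs q U.
    by apply: open_nbhs_nbhs; split=> //; exists y; split=> //; rewrite ltrDl.
  exists (U, [set N | `|y| + 1 <= N%:R]).
    split=> //=; exact: nbhs_infty_ger.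
  move=> [q' N] /= [[z [zy ->]] yN]; exists z; split=> //.
  exact: le_trans (ltW zy) yN.
move=> [N _ /(_ N (leqnn N)) NP]; exists N => x.
have [y [yN /eqmodP/asboolP[g gx]]] := NP (\pi_Q%qT x) I.
exists g^-1%g, y; split=> //.
by rewrite -gx -deckM mulVg deck1.
Qed.

(** Every orbit of P meets one of finitely many translates of a bounded set,
    on each of which h is bounded. *)
Lemma invariant_bounded (P : set (pi1 M)) (h : 'rV[R]_n -> R) :
  fcover P [set: pi1 M] -> continuous h ->
  (forall g x, P g -> h (dk g x) = h x) -> exists C, forall x, `|h x| <= C.
Proof.
move=> [s sP] ch hP; have [N NP] := deck_bounded_domain.
have bnd g : exists C, forall y, `|y| <= N%:R -> `|h (dk g y)| <= C.
  have cK : compact [set y : 'rV[R]_n | `|y| <= N%:R].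
    apply: bounded_closed_compact.
      by exists N%:R; split=> // r Nr y /= yN; exact: le_trans yN (ltW Nr).
    have -> : [set y : 'rV[R]_n | `|y| <= N%:R] =
        (fun y : 'rV[R]_n => `|y|) @^-1` [set r | r <= N%:R] by [].
    apply: preimage_closed; last exact: closed_le.
    move=> y _; exact: norm_continuous.
  have cf : {within [set y | `|y| <= N%:R], continuous (fun y => `|h (dk g y)|)}.
    apply: continuous_subspaceT => y.
    apply: (@continuous_comp _ _ _ (h \o dk g) (fun r => `|r|)); last exact: norm_continuous.
    apply: continuous_comp; [exact: deck_continuous|exact: ch].
  have : compact ((fun y => `|h (dk g y)|) @` [set y | `|y| <= N%:R]) by exact: continuous_compact.
  move/compact_bounded => -[C [_ /(_ (C + 1))]].
  rewrite ltrDl ltr01 => /(_ isT) hC; exists (C + 1) => y yN.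
  by rewrite -[leLHS]normr_id; apply: hC; exists y.
have /choice[C CP] := bnd.
exists (\sum_(g <- s) `|C g^-1%g|) => x.
have [g [y [-> yN]]] := NP x.
have [a als Pa] := sP g^-1%g I.
have -> : h (dk g y) = h (dk a^-1%g y).
  rewrite -(hP _ (dk g y) Pa) -deckM; congr (h (dk _ y)).
  by rewrite mulgVK.
apply: le_trans (CP _ _ yN) _; apply: le_trans (ler_norm _) _.
rewrite (big_rem a)//= lerDl sumr_ge0//.
Qed.

End Cocompact.

Lemma infinite_pigeonhole (T : choiceType) (K : finType) (A : set T) (f : T -> K) :
  infinite_set A -> exists x y, [/\ A x, A y, x <> y & f x = f y].
Proof.
move=> infA; apply: contrapT => ninj; apply: infA.
have [r rP] : {r : K -> option T & forall k, (exists y, A y /\ f y = k) ->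
    exists x, [/\ r k = Some x, A x & f x = k]}.
  apply: (@choice _ _ (fun k o => (exists y, A y /\ f y = k) ->
    exists x, [/\ o = Some x, A x & f x = k])) => k.
  have [[y [Ay fy]]|ne] := pselect (exists y, A y /\ f y = k); last by exists None.
  by exists (Some y) => _; exists y.
have finr : finite_set (range r) by exact/finite_image/finite_finset.
have : finite_set (Some @` A).
  apply: sub_finite_set finr => _ [x Ax <-].
  have [|y [ry Ay fy]] := rP (f x); first by exists x.
  exists (f x) => //; rewrite ry; congr Some; apply: contrapT => yx.
  by apply: ninj; exists y, x.
move=> /(finite_image (fun o => if o is Some x then [set x] else set0)).
move=> /(finite_image (fun B : set T => B)) fin.
have : finite_set (\bigcup_(B in [set [set x] | x in A]) B).
  apply: bigcup_finite; last by move=> B [x _ <-]; exact: finite_set1.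
  apply: sub_finite_set fin => B [x Ax <-]; exists [set x] => //.
  by exists (Some x) => //; exists x.
apply: sub_finite_set => x Ax; exists [set x] => //; exists x => //.
Qed.

Section Proper.
Variables (R : realType) (X : lie_model R) (M : closed_manifold X).
Local Notation n := (gdim X).
Local Notation dk := (deck M).

(** The hypothesis is continuous convergence of the maps to the identity. It
    implies convergence in the compact-open topology, where the deck group
    is discrete. *)
Lemma deck_discrete_seq (g_ : nat -> pi1 M) :
  (forall (x : 'rV[R]_n) (O : set 'rV[R]_n), nbhs x O ->
     \forall x' \near x & m \near \oo, O (dk (g_ m) x')) ->
  \forall m \near \oo, g_ m = 1%g.
Proof.
move=> gO; pose u m : {compact-open, 'rV[R]_n -> 'rV[R]_n} := dk (g_ m).
have dk1 : dk 1%g = id :> (_ -> _) by apply/funext => x; exact: deck1.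
have ui : u @ \oo --> (dk 1%g : {compact-open, 'rV[R]_n -> 'rV[R]_n}).
  apply/compact_open_cvgP => K O cK oO; rewrite dk1 image_id => KO.
  have /compact_near_coveringP cov := cK.
  have : \forall m \near \oo, K `<=` (fun x => O (dk (g_ m) x)).
    apply: (cov nat \oo (fun m x => O (dk (g_ m) x))) => x Kx.
    by apply: gO; apply: open_nbhs_nbhs; split=> //; exact: KO.
  by apply: filterS => m mO _ [x Kx <-]; exact: mO.
have [_ [V nV VS]] := @deck_discrete _ _ M (dk 1%g) (ex_intro2 _ _ 1%g I erefl).
have nVu : \forall m \near \oo, V (u m) := ui V nV.
move: nVu; apply: filterS => m Vm.
have : (V `&` range dk) (u m) by split=> //; exists (g_ m).
rewrite VS /= => e.
suff e0 : dk (g_ m) 0 = 0 by exact: deck_free e0.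
by rewrite -[RHS](deck1 M 0); exact: (congr1 (fun f => f 0) e).
Qed.

End Proper.

(** Global coordinates in which H acts by affine maps. An element that
    carries some point of a ball into that ball has a bounded linear part by
    [lin_bound]; through this condition, discreteness of the deck group
    bears on the translation parts alone. *)
Record affine_chart (R : realType) (X : lie_model R) (M : closed_manifold X)
    (H : subgrp (pi1 M)) := AffineChart {
  chart : 'rV[R]_(gdim X) -> 'rV[R]_(gdim X);
  chart_inv : 'rV[R]_(gdim X) -> 'rV[R]_(gdim X);
  chartK : cancel chart chart_inv;
  chart_invK : cancel chart_inv chart;
  chart_cont : continuous chart;
  chart_inv_cont : continuous chart_inv;
  lin : pi1 M -> 'M[R]_(gdim X);
  tr : pi1 M -> 'rV[R]_(gdim X);
  chartE : forall g x, sub_set H g -> chart (deck M g x) = chart x *m lin g + tr g;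
  lin_bound : forall r : R, exists C : R, forall g y, sub_set H g ->
    `|y| <= r -> `|y *m lin g + tr g| <= r -> `|lin g| <= C
}.

Section ChartTheory.
Variables (R : realType) (X : lie_model R) (M : closed_manifold X).
Variables (H : subgrp (pi1 M)) (T : affine_chart H).
Local Notation n := (gdim X).
Local Notation dk := (deck M).
Local Notation L := (lin T).
Local Notation w := (tr T).

Definition aff g (y : 'rV[R]_n) := y *m L g + w g.

Lemma affE g y : sub_set H g -> aff g y = chart T (dk g (chart_inv T y)).
Proof. by move=> Hg; rewrite chartE// chart_invK. Qed.

Lemma affM g h y : sub_set H g -> sub_set H h -> aff (g * h)%g y = aff g (aff h y).
Proof.
by move=> Hg Hh; rewrite !affE//; [rewrite chartK deckM|exact: subM].
Qed.

Lemma aff1 y : aff 1%g y = y.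
Proof. by rewrite affE; [rewrite deck1 chart_invK|exact: sub1]. Qed.

Lemma aff_free g y : sub_set H g -> aff g y = y -> g = 1%g.
Proof.
move=> Hg; rewrite affE// => /(congr1 (chart_inv T)); rewrite chartK.
exact: deck_free.
Qed.

Lemma tr0 g : w g = aff g 0.
Proof. by rewrite /aff mul0mx add0r. Qed.

Lemma affB g y z : aff g y - aff g z = (y - z) *m L g.
Proof. by rewrite /aff mulmxBl opprD addrACA subrr addr0. Qed.

Lemma trM g h : sub_set H g -> sub_set H h -> w (g * h)%g = w h *m L g + w g.
Proof. by move=> Hg Hh; rewrite tr0 affM// -tr0. Qed.

Lemma lin_eq (A B : 'M[R]_n) : (forall y : 'rV[R]_n, y *m A = y *m B) -> A = B.
Proof. by move=> AB; apply/row_matrixP => i; rewrite !rowE. Qed.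

Lemma linM g h : sub_set H g -> sub_set H h -> L (g * h)%g = L h *m L g.
Proof.
move=> Hg Hh; apply: lin_eq => y; rewrite mulmxA -[y]subr0 -!affB.
by rewrite !affM.
Qed.

Lemma lin1 : L 1%g = 1%:M.
Proof. by apply: lin_eq => y; rewrite -[y]subr0 -affB !aff1 mulmx1. Qed.

Lemma linV g : sub_set H g -> L g *m L g^-1%g = 1%:M.
Proof. by move=> Hg; rewrite -linM ?mulVg ?lin1//; exact: subV. Qed.

Lemma trV g : sub_set H g -> w g^-1%g = - (w g *m L g^-1%g).
Proof.
move=> Hg; have := trM (subV Hg) Hg; rewrite mulVg tr0 aff1 => /eqP.
by rewrite eq_sym addrC addr_eq0 => /eqP.
Qed.

(** Infinitely many elements with bounded w would have bounded affine maps,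
    so that two different ones, g and h, could be found arbitrarily close to
    each other; then g^-1 h would be close to the identity on compact sets,
    against discreteness. *)
Lemma chart_proper r : finite_set [set g | sub_set H g /\ `|w g| <= r].
Proof.
apply: contrapT => infA; set A := [set g | _] in infA.
have [C0 C0P] := lin_bound T `|r|.
pose C : R := `|C0| + `|r| + 1.
have C_ge0 : 0 <= C by rewrite /C !addr_ge0.
have LC g : A g -> `|L g| <= C /\ `|L g^-1%g| <= C.
  move=> [Hg gr]; have gr' : `|w g| <= `|r| by apply: le_trans (ler_norm _).
  have l1 : `|L g| <= C0 by apply: (C0P g 0); rewrite ?normr0// -/(aff g 0) -tr0.
  have l2 : `|L g^-1%g| <= C0.
    apply: (C0P _ (w g)) => //; first exact: subV.
    by rewrite -/(aff _ _) tr0 -affM ?mulVg ?aff1 ?normr0//; exact: subV.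
  have C0C : C0 <= C by rewrite /C -addrA (le_trans (ler_norm _))// lerDl addr_ge0.
  by split; exact: le_trans C0C.
have wC g : A g -> `|w g| <= C.
  move=> [Hg gr]; apply: le_trans gr _; apply: le_trans (ler_norm _) _.
  by rewrite /C addrAC lerDr addr_ge0.
have [gs gsP] : {p : nat -> pi1 M * pi1 M & forall m,
   [/\ A (p m).1, A (p m).2, (p m).1 <> (p m).2,
   forall i j, `|(L (p m).2 - L (p m).1) i j| <= m.+1%:R^-1 &
   forall j, `|(w (p m).2 - w (p m).1) 0 j| <= m.+1%:R^-1]}.
  apply: (@choice _ _ (fun m p => [/\ A p.1, A p.2, p.1 <> p.2,
    forall i j, `|(L p.2 - L p.1) i j| <= m.+1%:R^-1 &
    forall j, `|(w p.2 - w p.1) 0 j| <= m.+1%:R^-1])) => m.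
  (* The interval from - C to C is cut into cells of width 1/(m+1). *)
  pose N := Num.truncn ((C + C) * m.+1%:R).
  pose cell (x : R) : 'I_N.+1 := inord (Num.truncn ((x + C) * m.+1%:R)).
  have cellP x y : `|x| <= C -> `|y| <= C -> cell x = cell y -> `|x - y| <= m.+1%:R^-1.
    have bd z : `|z| <= C -> (Num.truncn ((z + C) * m.+1%:R) < N.+1)%N.
      rewrite ler_norml => /andP[_ zC]; rewrite ltnS; apply: le_truncn.
      by rewrite ler_wpM2r// lerD2r.
    have itv z : `|z| <= C -> (Num.truncn ((z + C) * m.+1%:R))%:R <= (z + C) * m.+1%:R
        < (Num.truncn ((z + C) * m.+1%:R)).+1%:R.
      move=> zC; apply: truncn_itv; rewrite mulr_ge0//.
      by move: zC; rewrite ler_norml => /andP[? _]; lra.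
    move=> xC yC /(congr1 val); rewrite /= !inordK ?bd// => e.
    have := itv _ xC; have := itv _ yC; rewrite e -natr1.
    set t := (Num.truncn _)%:R => /andP[y1 y2] /andP[x1 x2].
    rewrite -[leRHS]mul1r ler_pdivlMr// -[X in `|_| * X]ger0_norm// -normrM ler_norml.
    apply/andP; split; lra.
  pose f g : {ffun ('I_n * 'I_n + 'I_n) -> 'I_N.+1} := [ffun i => match i with
    inl ij => cell (L g ij.1 ij.2) | inr j => cell (w g 0 j) end].
  have [g [h [Ag Ah gh fgh]]] := infinite_pigeonhole f infA.
  exists (g, h); split=> //= [i j|j].
    have /ffunP/(_ (inl (i, j))) := fgh; rewrite !ffunE /= => e.
    rewrite !mxE; apply: cellP => //.
      by apply: le_trans (entry_le_norm _ _ _) (LC _ Ah).1.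
    by apply: le_trans (entry_le_norm _ _ _) (LC _ Ag).1.
  have /ffunP/(_ (inr j)) := fgh; rewrite !ffunE /= => e.
  rewrite !mxE; apply: cellP => //.
    by apply: le_trans (entry_le_norm _ _ _) (wC _ Ah).
  by apply: le_trans (entry_le_norm _ _ _) (wC _ Ag).
pose g_ m := ((gs m).1^-1 * (gs m).2)%g.
have gE m y : aff (g_ m) y - y =
    y *m ((L (gs m).2 - L (gs m).1) *m L (gs m).1^-1%g) +
    (w (gs m).2 - w (gs m).1) *m L (gs m).1^-1%g.
  have [[H1 _] [H2 _] _ _ _] := gsP m; have HV := subV H1.
  have abel (a b c d : 'rV[R]_n) : a + b - c - d = a - d + (b - c).
    by rewrite addrAC [a + b - d]addrAC -addrA.
  by rewrite affM// {1}/aff trV// {1}/aff mulmxDl !mulmxBl linV// mulmxBr mulmx1 mulmxA abel.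
have gB m y : `|aff (g_ m) y - y| <= (n%:R * (n%:R * C) * `|y| + n%:R * C) * m.+1%:R^-1.
  have [A1 A2 _ Lm wm] := gsP m; have [_ LV] := LC _ A1.
  rewrite gE; apply: le_trans (ler_normD _ _) _; rewrite mulrDl; apply: lerD.
    apply: le_trans (norm_mulmx _ _) _; rewrite -!mulrA ler_wpM2l//.
    rewrite [leRHS](_ : _ = `|y| * (n%:R * (m.+1%:R^-1 * C))); last by ring.
    rewrite ler_wpM2l//; apply: le_trans (norm_mulmx _ _) _.
    by rewrite ler_wpM2l// ler_pM//; exact: norm_le_entry.
  apply: le_trans (norm_mulmx _ _) _; rewrite -mulrA ler_wpM2l// mulrC ler_pM//.
  by apply: norm_le_entry => // i j; rewrite ord1.
have : \forall m \near \oo, g_ m = 1%g.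
  apply: deck_discrete_seq => x O nO.
  have nO' : nbhs (chart_inv T (chart T x)) O by rewrite chartK.
  have /nbhs_normP[e /= e0 eO] := @chart_inv_cont _ _ _ _ T (chart T x) O nO'.
  pose K2 : R := n%:R * (n%:R * C) * (`|chart T x| + 1) + n%:R * C + 1.
  have K20 : 0 < K2 by rewrite /K2 ltr_pwDr// addr_ge0// !mulr_ge0// addr_ge0.
  (* Half of e absorbs the distance of x' from x, the other half the displacement of x' by g_ m. *)
  pose e2 : R := Num.min 1 (e / 2).
  have e20 : 0 < e2 by rewrite lt_min ltr01 divr_gt0.
  exists ([set x' | `|chart T x - chart T x'| < e2], [set m | m.+1%:R^-1 < e / 2 / K2]).
    split=> /=.
      have /cvgrPdist_lt := @chart_cont _ _ _ _ T x; exact.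
    have e3 : 0 < e / 2 / K2 by rewrite !divr_gt0.
    have := near_infty_natSinv_lt (PosNum e3); exact.
  move=> [x' m] /= [xx' me].
  have Hm : sub_set H (g_ m).
    by have [[H1 _] [H2 _] _ _ _] := gsP m; apply: subM => //; exact: subV.
  have -> : dk (g_ m) x' = chart_inv T (aff (g_ m) (chart T x')).
    by rewrite affE// !chartK.
  apply: eO; rewrite /ball_ /=.
  have -> : chart T x - aff (g_ m) (chart T x') =
     (chart T x - chart T x') - (aff (g_ m) (chart T x') - chart T x').
    by rewrite opprB addrA subrK.
  apply: le_lt_trans (ler_normB _ _) _; rewrite [ltRHS]splitr; apply: ltr_leD.
    by apply: lt_le_trans xx' _; rewrite ge_min lexx orbT.
  apply: le_trans (gB _ _) _.
  apply: (@le_trans _ _ (K2 * (e / 2 / K2))); last by rewrite mulrCA mulfV ?mulr1// gt_eqF.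
  apply: ler_pM => //; last exact: ltW.
    by rewrite addr_ge0// !mulr_ge0.
  rewrite /K2 ler_wpDr// lerD2r ler_wpM2l// ?mulr_ge0//.
  have -> : chart T x' = chart T x - (chart T x - chart T x') by rewrite subKr.
  apply: le_trans (ler_normB _ _) _; rewrite lerD2l; apply: ltW.
  by apply: lt_le_trans xx' _; rewrite ge_min lexx.
move=> [m _ /(_ m (leqnn m))]; rewrite /g_ /= => e.
have [_ _ + _ _] := gsP m; apply.
by rewrite -[LHS]mulg1 -e mulVKg.
Qed.

(** B acts on the image of orb through translations of R^k by tau. Freeness
    of the action makes tau injective, and [chart_proper] makes its image
    discrete. *)
Lemma lattice_like_of_orbit (B : subgrp (pi1 M)) k (tau : pi1 M -> 'rV[R]_k)
    (orb : 'rV[R]_k -> 'rV[R]_n) :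
  sub_set B `<=` sub_set H -> continuous orb ->
  (forall x y, sub_set B x -> sub_set B y -> tau (x * y)%g = tau x + tau y) ->
  (forall x, sub_set B x -> aff x (orb 0) = orb (tau x)) ->
  lattice_like R (sub_set B).
Proof.
move=> BH co tauM tauE; exists k, tau; split=> //.
  move=> x Bx tx; apply: (@aff_free x (orb 0)); first exact: BH.
  by rewrite tauE// tx.
move=> r.
have cK : compact [set y : 'rV[R]_k | `|y| <= r].
  apply: bounded_closed_compact.
    by exists r; split=> [|s rs y /= yr]; [exact: num_real|exact: le_trans yr (ltW rs)].
  have -> : [set y : 'rV[R]_k | `|y| <= r] = (fun y : 'rV[R]_k => `|y|) @^-1` [set s | s <= r] by [].
  apply: preimage_closed; last exact: closed_le.
  move=> y _; exact: norm_continuous.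
have : compact (orb @` [set y | `|y| <= r]).
  by apply: continuous_compact => //; exact: continuous_subspaceT.
move/compact_bounded => -[C [_ /(_ (C + 1))]].
rewrite ltrDl ltr01 => /(_ isT) orbC.
pose rr : R := Num.max (C + 1) `|orb 0|.
have [CL CLP] := lin_bound T rr.
apply: (@sub_finite_set _ _ [set g | sub_set H g /\ `|w g| <= rr + n%:R * (rr * `|CL|)]).
  move=> g [Bg gr]; split; first exact: BH.
  have og : `|aff g (orb 0)| <= rr.
    by rewrite tauE// le_max orbC//; exists (tau g).
  have Lg : `|L g| <= CL.
    by apply: (CLP g (orb 0)) => //; [exact: BH|rewrite le_max lexx orbT].
  have -> : w g = aff g (orb 0) - orb 0 *m L g by rewrite /aff [X in X - _]addrC addrK.
  apply: le_trans (ler_normB _ _) _; apply: lerD => //.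
  apply: le_trans (norm_mulmx _ _) _; rewrite ler_wpM2l// ler_pM//.
    by rewrite le_max lexx orbT.
  exact: le_trans Lg (ler_norm _).
exact: chart_proper.
Qed.

End ChartTheory.

(** * Centralizers of affine maps *)

Section Centralizers.
Variables (R : realType) (X : lie_model R) (M : closed_manifold X).
Variables (H : subgrp (pi1 M)) (T : affine_chart H).
Local Notation n := (gdim X).
Local Notation L := (lin T).
Local Notation w := (tr T).

(** The hypothesis says that K has the same kernel as its square, so that
    its kernel and its image are complementary. *)
Lemma fitting (K : 'M[R]_n) : (forall x : 'rV[R]_n, x *m K *m K = 0 -> x *m K = 0) ->
  forall v : 'rV[R]_n, exists x y, v = x *m K + y /\ y *m K = 0.
Proof.
move=> KK v.
have cap0 : (K :&: kermx K = 0)%MS.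
  apply/eqP; rewrite -submx0; apply/rV_subP => y.
  rewrite sub_capmx => /andP[/submxP[x ->] /sub_kermxP xKK].
  by rewrite (KK x)// sub0mx.
have full : row_full (K + kermx K)%MS.
  rewrite /row_full; have := mxrank_sum_cap K (kermx K).
  rewrite cap0 mxrank0 addn0 => ->; rewrite mxrank_ker subnKC//.
  exact: rank_leq_row.
have /sub_addsmxP[[x y] /= ->] : (v <= K + kermx K)%MS by exact: submx_full.
by exists x, (y *m kermx K); rewrite -[_ *m _ *m K]mulmxA mulmx_ker mulmx0.
Qed.

(** Split w a along the image and the kernel of L a - 1: the first component
    is absorbed by the choice of a base point p, which a then moves by a
    vector f fixed by L a. If b commutes with a, the point b p has the same
    property, whence the conclusions on b. *)
Lemma fixed_axis a : sub_set H a ->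
  (forall x : 'rV[R]_n, x *m (L a - 1%:M) *m (L a - 1%:M) = 0 -> x *m (L a - 1%:M) = 0) ->
  exists p f : 'rV[R]_n, [/\ aff T a p = p + f, f *m L a = f &
    forall b, sub_set H b -> (a * b = b * a)%g ->
      (aff T b p - p) *m L a = aff T b p - p /\ f *m L b = f].
Proof.
move=> Ha KK; set K := L a - 1%:M in KK.
have fixE (v : 'rV[R]_n) : v *m K = 0 <-> v *m L a = v.
  rewrite /K mulmxBr mulmx1; split=> [/eqP|->]; last by rewrite subrr.
  by rewrite subr_eq0 => /eqP.
have [x [f [wE fK]]] := fitting KK (w a).
exists (- x), f.
have aE : aff T a (- x) = - x + f.
  by rewrite /aff wE /K mulmxBr mulmx1 mulNmx !addrA addNr add0r.
split=> // [|b Hb ab]; first exact/fixE.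
set p := - x in aE *; set v := aff T b p - p.
have vK : v *m K = f *m L b - f.
  rewrite /K mulmxBr mulmx1 -(affB T) -(affM T p Ha Hb) ab (affM T p Hb Ha) aE.
  have -> : aff T b (p + f) = aff T b p + f *m L b.
    by rewrite /aff mulmxDl addrAC.
  by apply/rowP => i; rewrite /v !(mxDE, mxNE); ring.
have fLbK : f *m L b *m K = 0.
  by apply/fixE; rewrite -mulmxA -(linM T Ha Hb) ab (linM T Hb Ha) mulmxA (fixE f).1.
have vK0 : v *m K = 0.
  by apply: KK; rewrite vK mulmxBl fLbK fK subrr.
split; first exact/fixE.
by apply/eqP; rewrite -subr_eq0 -vK vK0.
Qed.

(** All displacements of p are fixed by the linear parts, so B acts on the
    orbit of p by translations. *)
Lemma orbit_lattice (B : subgrp (pi1 M)) (p : 'rV[R]_n) : sub_set B `<=` sub_set H ->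
  (forall x y, sub_set B x -> sub_set B y -> (aff T y p - p) *m L x = aff T y p - p) ->
  lattice_like R (sub_set B).
Proof.
move=> BH fixB.
apply: (@lattice_like_of_orbit _ _ _ _ T B _ (fun b => aff T b p - p) (fun v => p + v)) => //.
- by move=> v; apply: differentiable_continuous; apply: differentiableD.
- move=> x y Bx By; rewrite affM; [|exact: BH..].
  have -> : aff T x (aff T y p) = aff T x p + (aff T y p - p).
    by rewrite -[X in _ + X](fixB x y)// -affB addrC subrK.
  by apply/rowP => i; rewrite !(mxDE, mxNE); ring.
- by move=> x Bx; rewrite addr0 addrC subrK.
Qed.

(** The elements commuting with a move the point p of [fixed_axis] in the
    directions fixed by L a, and these are fixed by the linear part of B. *)
Lemma centralizer_lattice a (B : subgrp (pi1 M)) : sub_set H a ->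
  sub_set B `<=` sub_set H -> (forall b, sub_set B b -> (a * b = b * a)%g) ->
  (forall x : 'rV[R]_n, x *m (L a - 1%:M) *m (L a - 1%:M) = 0 -> x *m (L a - 1%:M) = 0) ->
  (forall b (v : 'rV[R]_n), sub_set B b -> v *m L a = v -> v *m L b = v) ->
  lattice_like R (sub_set B).
Proof.
move=> Ha BH aB KK fixB.
have [p [f [_ _ cen]]] := fixed_axis Ha KK.
apply: (@orbit_lattice B p) => // x y Bx By; apply: fixB => //.
by have [] := cen y (BH _ By) (aB _ By).
Qed.

(** The function y |-> y u is invariant under A B, hence bounded by
    cocompactness; but a bounded linear functional vanishes. *)
Lemma no_invariant_functional (A B : subgrp (pi1 M)) (u : 'cV[R]_n) :
  sub_set A `<=` sub_set H -> sub_set B `<=` sub_set H ->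
  fcover (prodset (sub_set A) (sub_set B)) [set: pi1 M] ->
  (forall g, sub_set A g \/ sub_set B g -> L g *m u = u /\ w g *m u = 0) -> u = 0.
Proof.
move=> AH BH cAB inv.
have ch : continuous (fun x => (chart T x *m u) 0 0).
  have sl : smooth (fun y : 'rV[R]_n => (y *m u) 0 0).
    have -> : (fun y : 'rV[R]_n => (y *m u) 0 0) = (fun y => \sum_i y 0 i * u i 0).
      by apply/funext => y; rewrite mxE.
    by apply: smooth_sum => i; apply: smooth_mul; [exact: smooth_coord|exact: smooth_cst].
  move=> x; apply: (@continuous_comp _ _ _ (chart T) (fun y : 'rV[R]_n => (y *m u) 0 0)).
    exact: chart_cont.
  exact: smooth_continuous sl _.
have [|C CP] := invariant_bounded cAB ch.
  move=> _ x [a Aa [b Bb <-]].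
  rewrite deckM (chartE T) ?(chartE T); [|exact: BH|exact: AH].
  have [La wa] := inv a (or_introl Aa); have [Lb wb] := inv b (or_intror Bb).
  by rewrite !mulmxDl -!mulmxA La Lb wa wb !addr0.
apply/eqP/negPn/negP => u0.
pose s := (u^T *m u) 0 0.
have s0 : 0 < s.
  rewrite /s mxE lt0r sumr_ge0 ?andbT => [|i _]; last by rewrite mxE -expr2 sqr_ge0.
  apply: contra u0 => /eqP e; apply/eqP/colP => i; rewrite mxE.
  have : u^T 0 i * u i 0 = 0.
    by apply: (psumr_eq0P _ e) => // j _; rewrite mxE -expr2 sqr_ge0.
  by rewrite mxE => /eqP; rewrite mulf_eq0 orbb => /eqP.
have C0 : 0 <= C by apply: le_trans (CP 0).
have := CP (chart_inv T (((C + 1) / s) *: u^T)).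
rewrite chart_invK -scalemxAl mxE -/s divfK ?gt_eqF// ger0_norm ?addr_ge0//.
by rewrite gerDl ler10.
Qed.

(** Call y |-> y u the height; H translates it. If an element of A changes
    the height then its centralizer contains B, and conversely. If neither A
    nor B changes it, the height is an invariant functional. *)
Lemma split_by_height (u : 'cV[R]_n) : fcover (sub_set H) [set: pi1 M] -> u != 0 ->
  (forall g, sub_set H g -> L g *m u = u) ->
  (forall a (B : subgrp (pi1 M)), sub_set H a -> w a *m u != 0 ->
    sub_set B `<=` sub_set H -> (forall b, sub_set B b -> (a * b = b * a)%g) ->
    lattice_like R (sub_set B)) ->
  commuting_pairs_split R (pi1 M).
Proof.
move=> cH u0 Lu cen; exists H; split=> // A B AH BH AB cAB.
have vl (C : subgrp (pi1 M)) : lattice_like R (sub_set C) -> virtually_lattice_like R C.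
  by move=> lC; exists C; split=> //; exact: fcover_refl.
have [[a [Aa wa]]|nA] := pselect (exists a, sub_set A a /\ w a *m u != 0).
  by right; apply/vl/(cen a) => // [|b Bb]; [exact: AH|exact: AB].
have [[b [Bb wb]]|nB] := pselect (exists b, sub_set B b /\ w b *m u != 0).
  by left; apply/vl/(cen b) => // [|a Aa]; [exact: BH|exact/esym/AB].
case/negP: u0; apply/eqP; apply: (no_invariant_functional AH BH cAB).
move=> g [Ag|Bg].
  split; first exact/Lu/AH.
  by apply/eqP/negPn/negP => wg; apply: nA; exists g.
split; first exact/Lu/BH.
by apply/eqP/negPn/negP => wg; apply: nB; exists g.
Qed.

End Centralizers.

(** * Flat manifolds *)

Section SignKernel.
Variables (R : realType) (G : groupType) (A : subgrp G) (s : G -> R).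
Hypothesis sM : forall x y, sub_set A x -> sub_set A y -> s (x * y)%g = s x * s y.
Hypothesis s_sign : forall x, sub_set A x -> s x = 1 \/ s x = -1.

Lemma sign1 : s 1%g = 1.
Proof.
have A1 := sub1 A; have := sM A1 A1; rewrite mulg1.
by case: (s_sign A1) => ->; rewrite ?mulrNN ?mulr1.
Qed.

Lemma signV x : sub_set A x -> s x^-1%g = s x.
Proof.
move=> Ax; have := sM (subV Ax) Ax; rewrite mulVg sign1.
case: (s_sign Ax) => ->; rewrite ?mulrN ?mulr1 => e; first by rewrite -e.
by rewrite e opprK.
Qed.

Definition sign_kernel : subgrp G := @Subgrp G [set x | sub_set A x /\ s x = 1]
  (conj (sub1 A) sign1)
  (fun x y Hx Hy => conj (subM Hx.1 Hy.1)
     (etrans (sM Hx.1 Hy.1) (etrans (congr2 *%R Hx.2 Hy.2) (mulr1 1))))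
  (fun x Hx => conj (subV Hx.1) (etrans (signV Hx.1) Hx.2)).

Lemma sign_kernel_cover : fcover (sub_set sign_kernel) (sub_set A).
Proof.
have [[a [Aa sa]]|na] := pselect (exists a, sub_set A a /\ s a = -1).
  exists [:: 1%g; a] => g Ag; have [sg|sg] := s_sign Ag.
    exists 1%g; first exact: mem_head.
    by split; rewrite invg1 mul1g.
  exists a; first by rewrite !inE eqxx orbT.
  split; first by apply: subM => //; exact: subV.
  by rewrite sM ?signV// ?sa ?sg ?mulrNN ?mulr1//; exact: subV.
exists [:: 1%g] => g Ag; exists 1%g; first exact: mem_head.
split; rewrite invg1 mul1g//.
by have [//|sg] := s_sign Ag; exfalso; apply: na; exists g.
Qed.

End SignKernel.

Section AffineDiff.
Variables (R : realType) (n : nat) (A : 'M[R]_n) (b : 'rV[R]_n).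

Lemma continuous_mulmxr : continuous (mulmxr A : 'rV[R]_n -> 'rV[R]_n).
Proof.
apply: bounded_linear_continuous; apply/linear_boundedP.
exists (n%:R * `|A|); split=> [|k kA y]; first exact: num_real.
apply: le_trans (norm_mulmx _ _) _.
by rewrite mulrCA mulrC ler_wpM2r// ltW.
Qed.

Lemma diff_affine (f : 'rV[R]_n -> 'rV[R]_n) p u :
  (forall y, f y = y *m A + b) -> 'd f p u = u *m A.
Proof.
move=> fE.
have df : differentiable f p.
  have -> : f = (fun y => (mulmxr A : 'rV[R]_n -> 'rV[R]_n) y + b) by apply/funext => y; rewrite fE.
  apply: differentiableD; last exact: differentiable_cst.
  by apply: linear_differentiable; exact: continuous_mulmxr.
rewrite -deriveE//; apply/rowP => j; rewrite -derive_coord//.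
have -> : (fun y => f y 0 j) = (fun y => \sum_i y 0 i * A i j + b 0 j).
  by apply/funext => y; rewrite fE !mxE.
have sl (i : 'I_n) : smooth (fun y : 'rV[R]_n => y 0 i * A i j).
  by apply: smooth_mul; [exact: smooth_coord|exact: smooth_cst].
rewrite deriveD_real; [|exact/smooth_diff/smooth_sum|exact: differentiable_cst].
rewrite derive_cst addr0 derive_sum_real// mxE; apply: eq_bigr => i _.
rewrite deriveM_real; [|exact/smooth_diff/smooth_coord|exact: differentiable_cst].
by rewrite derive_coord_id derive_cst mulr0 addr0.
Qed.

End AffineDiff.

Section Euclid.
Variables (R : realType) (n : nat).

Lemma pd_cst (c : R) (a : 'I_n) (x : 'rV[R]_n) : pd a (fun=> c) x = 0.
Proof. exact: derive_cst. Qed.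

Definition euclid_frame : frame R n.
Proof.
refine (@Frame R n (fun=> 1%:M) (fun=> 1%:M) (fun _ _ _ => 0) _ _ _ _ _).
- by move=> x; rewrite mulmx1.
- by move=> f sf i j; exact: smooth_cst.
- by move=> f sf i j; exact: smooth_cst.
- by move=> *; rewrite oppr0.
- move=> x k l b; rewrite [RHS]big1 => [|m _]; last by rewrite mul0r.
  by rewrite !big1 ?subrr// => a _; rewrite pd_cst mulr0.
Defined.

Lemma euclid_invariant : @left_invariant R (euclid R n) euclid_frame.
Proof.
move=> p u; apply: (@diff_affine _ _ _ (- p)) => y.
by rewrite mulmx1 addrC.
Qed.

(** Factor the block matrix with diagonal blocks 1, 1 and off-diagonal
    blocks - r, d in two ways. *)
Lemma det_rank_one (d : 'cV[R]_n) (r : 'rV[R]_n) : \det (1%:M + d *m r) = 1 + (r *m d) 0 0.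
Proof.
have e1 : block_mx (1%:M : 'M[R]_1) 0 d 1%:M *m block_mx 1%:M (- r) 0 (1%:M + d *m r) =
    block_mx 1%:M (- r) d 1%:M.
  by rewrite mulmx_block !(mul1mx, mul0mx, mulmx0, mulmx1, addr0, add0r, mulmxN) addrC addrK.
have e2 : block_mx 1%:M (- r) 0 (1%:M : 'M[R]_n) *m block_mx (1%:M + r *m d) 0 d 1%:M =
    block_mx 1%:M (- r) d 1%:M.
  by rewrite mulmx_block !(mul1mx, mul0mx, mulmx0, mulmx1, addr0, add0r, mulNmx) addrK.
have : \det (block_mx (1%:M : 'M[R]_1) (- r) d 1%:M) = \det (1%:M + d *m r).
  by rewrite -e1 det_mulmx det_lblock det_ublock !det1 !mul1r.
rewrite -e2 det_mulmx det_ublock det_lblock !det1 !mul1r mulr1 => <-.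
by rewrite det_mx11 !mxE.
Qed.

Definition sqn (v : 'rV[R]_n) := (v *m v^T) 0 0.

Lemma sqn_eq0 v : sqn v = 0 -> v = 0.
Proof.
rewrite /sqn mxE => e; apply/rowP => i; rewrite mxE.
have : v 0 i * v^T i 0 = 0.
  by apply: (psumr_eq0P _ e) => // j _; rewrite mxE -expr2 sqr_ge0.
by rewrite mxE => /eqP; rewrite mulf_eq0 orbb => /eqP.
Qed.

(** Otherwise Q = 1 + d r. The determinant gives r d = 0, and then
    orthogonality gives |r|^2 |d|^2 = 0. *)
Lemma rank_rotation (Q : 'M[R]_n) : Q *m Q^T = 1%:M -> \det Q = 1 -> Q != 1%:M ->
  (1 < \rank (Q - 1%:M)%R)%N.
Proof.
move=> QQ dQ Q1; set K := Q - 1%:M; rewrite ltnNge; apply/negP => rK.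
have K0 : K != 0 by rewrite subr_eq0.
have [i ri] : exists i, row i K != 0.
  apply/existsP; rewrite -negb_forall; apply: contra K0 => /forallP r0.
  by apply/eqP/row_matrixP => i; rewrite row0; apply/eqP.
set r := row i K in ri.
have rr : \rank r = 1%N by rewrite rank_rV ri.
have Kr : (K <= r)%MS.
  have [_] := mxrank_leqif_sup (row_sub i K); rewrite -/r rr => <-.
  by rewrite eqn_leq rK andbT -rr mxrankS// row_sub.
have /submxP[d KE] := Kr.
have QE : Q = 1%:M + d *m r by rewrite -KE /K addrC subrK.
have rd : r *m d = 0.
  apply/matrixP => a b; rewrite !ord1 [RHS]mxE.
  by move: dQ; rewrite QE det_rank_one => /eqP; rewrite -subr_eq0 addrC addKr => /eqP.
have e : d *m r + (d *m r)^T + d *m (r *m r^T) *m d^T = 0.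
  move: QQ; rewrite QE raddfD /= trmx1 mulmxDl mul1mx mulmxDr mulmx1 => /eqP.
  rewrite -subr_eq0 => /eqP <-; rewrite !trmx_mul !mulmxA.
  by rewrite -[1%:M + _ + _]addrA [1%:M + (_ + _)]addrC addrK addrCA addrA.
have e2 : (r *m r^T) *m (d^T *m d) = 0.
  have := congr1 (fun Z => r *m Z *m d) e.
  rewrite mulmx0 mul0mx !mulmxDr !mulmxDl !mulmxA rd !mul0mx add0r addr0 trmx_mul !mulmxA.
  exact.
have : sqn r * sqn d^T = 0.
  have /matrixP/(_ 0 0) := e2; rewrite [LHS]mxE big_ord1 [RHS]mxE.
  by rewrite /sqn trmxK.
move=> /eqP; rewrite mulf_eq0 => /orP[]/eqP/sqn_eq0.
  by move=> r0; rewrite r0 eqxx in ri.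
by move=> /(congr1 trmx); rewrite trmxK trmx0 => d0; rewrite KE d0 mul0mx eqxx in K0.
Qed.

(** The kernel and the image of Q - 1 are orthogonal. *)
Lemma orth_fitting (Q : 'M[R]_n) (x : 'rV[R]_n) : Q *m Q^T = 1%:M ->
  x *m (Q - 1%:M) *m (Q - 1%:M) = 0 -> x *m (Q - 1%:M) = 0.
Proof.
move=> QQ; set y := x *m _; rewrite mulmxBr mulmx1 => /eqP; rewrite subr_eq0 => /eqP yQ.
apply: sqn_eq0; have yQT : Q *m y^T = y^T.
  by rewrite -{2}(_ : y *m Q^T = y) ?trmx_mul ?trmxK// -{1}yQ -mulmxA QQ mulmx1.
by rewrite /sqn {1}/y -mulmxA mulmxBl yQT mul1mx subrr mulmx0 mxE.
Qed.

End Euclid.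

Lemma orth_norm_le1 (R : realType) n (Q : 'M[R]_n) : Q *m Q^T = 1%:M -> `|Q| <= 1.
Proof.
move=> QQ; apply: norm_le_entry => // i j.
have /matrixP/(_ i i) := QQ; rewrite !mxE eqxx (bigD1 j)//= mxE => e.
rewrite -[leRHS]sqrtr1 -sqrtr_sqr ler_sqrt ?ltr01// expr2 -[leRHS]e lerDl.
by rewrite sumr_ge0// => k _; rewrite mxE -expr2 sqr_ge0.
Qed.

Definition full_subgrp (G : groupType) : subgrp G :=
  @Subgrp G [set: G] I (fun _ _ _ _ => I) (fun _ _ => I).

Section EuclidManifold.
Variables (R : realType) (n : nat) (M : closed_manifold (euclid R n)).
Local Notation dk := (deck M).
Local Notation F := (euclid_frame R n).

Let isoM g := deck_isometry (c := M) g.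

Definition eu_rot g : 'M[R]_n := frot F (dk g) 0.

Lemma eu_orth g x : frot F (dk g) x *m (frot F (dk g) x)^T = 1%:M.
Proof. exact: (isom_rot_orth (@euclid_invariant R n) (isoM g)). Qed.

(** The connection coefficients of the constant frame vanish, so the
    derivatives of the rotation part do too. *)
Lemma eu_rot_cst g x : frot F (dk g) x = eu_rot g.
Proof.
have sm b : smooth (fun x : 'rV[R]_n => dk g x 0 b) by exact: (isom_smooth (isoM g)).
apply/matrixP => i j; pose h y := frot F (dk g) y i j; rewrite -/(h x) -/(h 0).
have sh : smooth h by exact: (rot_smooth F sm).
apply: (@fD0_cst _ _ F h sh) => k y.
have df z : differentiable (dk g) z by exact: (isom_diff (isoM g)).
rewrite (fD_rot sm df (eu_orth g)) !big1 ?subr0// => [l _|m _].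
  by rewrite big1// => m _; rewrite /om /= !subr0 addr0 mul0r mulr0.
by rewrite /om /= !subr0 addr0 !mul0r.
Qed.

Lemma eu_affine g x : dk g x = x *m eu_rot g + dk g 0.
Proof.
have sm b : smooth (fun x : 'rV[R]_n => dk g x 0 b) by exact: (isom_smooth (isoM g)).
apply/rowP => b; rewrite mxE addrC (@affine_of_pd _ _ (fun x => dk g x 0 b) (fun a => eu_rot g a b)).
- by rewrite [in RHS]mxE.
- exact: sm.
- move=> a y; have := fD_coord F (dk g) a b y.
  rewrite /fD /= (bigD1 a)//= big1 ?addr0 => [|c ca]; last by rewrite mxE eq_sym (negbTE ca) mul0r.
  rewrite mxE eqxx mul1r => ->.
  rewrite (bigD1 b)//= big1 ?addr0 => [|c cb]; last by rewrite mxE (negbTE cb) mulr0.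
  by rewrite mxE eqxx mulr1 eu_rot_cst.
Qed.

Lemma eu_rotM g h : eu_rot (g * h)%g = eu_rot h *m eu_rot g.
Proof.
have e : frot F (dk (g * h)%g) 0 = frot F (dk h) 0 *m frot F (dk g) (dk h 0) :=
  @rot_deckM R (euclid R n) F M g h 0.
by rewrite /eu_rot e (eu_rot_cst g (dk h 0)).
Qed.

Lemma eu_detM g h : sub_set (full_subgrp (pi1 M)) g -> sub_set (full_subgrp (pi1 M)) h ->
  \det (eu_rot (g * h)%g) = \det (eu_rot g) * \det (eu_rot h).
Proof. by move=> _ _; rewrite eu_rotM det_mulmx mulrC. Qed.

Lemma eu_det_sign g : sub_set (full_subgrp (pi1 M)) g ->
  \det (eu_rot g) = 1 \/ \det (eu_rot g) = -1.
Proof.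
move=> _; have /(congr1 determinant) := eu_orth g 0.
rewrite det_mulmx det_tr det1 -expr2 => /eqP; rewrite sqrf_eq1 => /orP[] /eqP; by [left|right].
Qed.

Definition eu_oriented := sign_kernel eu_detM eu_det_sign.

Definition eu_chart : affine_chart eu_oriented.
Proof.
refine (@AffineChart R (euclid R n) M eu_oriented id id _ _ _ _ eu_rot (fun g => dk g 0) _ _) => //.
- by move=> x; exact: cvg_id.
- by move=> x; exact: cvg_id.
- by move=> g x _; exact: eu_affine.
- by move=> r; exists 1 => g y _ _ _; apply: orth_norm_le1; exact: eu_orth.
Defined.

(** The space fixed by Q has dimension at most two by [rank_rotation]. It
    contains the vector f by which a moves its axis; f is nonzero because a
    has no fixed point, and it is fixed by all of B. The orthogonal
    direction in the fixed space, if there is one, is preserved up to sign;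
    the elements that preserve its orientation act on the axis by
    translations and have index at most two. *)
Lemma eu_virtually a (B : subgrp (pi1 M)) : (n <= 4)%N ->
  sub_set eu_oriented a -> eu_rot a != 1%:M -> sub_set B `<=` sub_set eu_oriented ->
  (forall b, sub_set B b -> (a * b = b * a)%g) -> virtually_lattice_like R B.
Proof.
move=> n4 Ha a1 BH aB; pose T := eu_chart; set Q := eu_rot a in a1.
have QQ : Q *m Q^T = 1%:M by exact: eu_orth.
have [p [f [ap fQ cen]]] := @fixed_axis _ _ _ _ T a Ha (fun x => @orth_fitting _ _ Q x QQ).
have f0 : f != 0.
  apply: contra a1 => /eqP f0; rewrite f0 addr0 in ap.
  by rewrite /Q (aff_free Ha ap) -[eu_rot 1%g]/(lin T 1%g) lin1.
have kerE (v : 'rV[R]_n) : (v <= kermx (Q - 1%:M))%MS = (v *m Q == v).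
  by rewrite sub_kermx mulmxBr mulmx1 subr_eq0.
have rkF : (\rank (kermx (Q - 1%:M)) <= 2)%N.
  rewrite mxrank_ker leq_subLR; have := rank_rotation QQ Ha.2 a1.
  by move: (\rank _) => k; move: n4; lia.
have orthB b (u v : 'rV[R]_n) : (u *m eu_rot b) *m (v *m eu_rot b)^T = u *m v^T.
  by rewrite trmx_mul -mulmxA (mulmxA (eu_rot b)) eu_orth mul1mx.
have dispF x y : sub_set B x -> sub_set B y -> (aff T y p - p) *m Q = aff T y p - p.
  by move=> _ By; have [] := cen y (BH _ By) (aB _ By).
have fB x : sub_set B x -> f *m eu_rot x = f.
  by move=> Bx; have [] := cen x (BH _ Bx) (aB _ Bx).
(* If it exists, v spans the orthogonal complement of f in the fixed space. *)
have [[v [vQ vf v0]]|nov] := pselect (exists v : 'rV[R]_n, [/\ v *m Q = v, v *m f^T = 0 & v != 0]); last first.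
  exists B; split=> //; first exact: fcover_refl.
  apply: (@orbit_lattice _ _ _ _ T B p) => // x y Bx By.
  set y' := aff T y p - p; have y'Q : y' *m Q = y' by exact: (dispF x).
  pose k := (y' *m f^T) 0 0 / sqn f.
  have sf : sqn f != 0 by apply: contra f0 => /eqP/sqn_eq0 ->.
  have : y' - k *: f = 0.
    apply/eqP/negPn/negP => d0; apply: nov; exists (y' - k *: f); split=> //.
      by rewrite mulmxBl -scalemxAl y'Q fQ.
    apply/matrixP => i j; rewrite !ord1 mulmxBl -scalemxAl !mxE.
    have -> : \sum_j f 0 j * f^T j 0 = sqn f by rewrite /sqn mxE.
    have -> : \sum_j y' 0 j * f^T j 0 = (y' *m f^T) 0 0 by rewrite mxE.
    by rewrite /k divfK// subrr.
  by move/eqP; rewrite subr_eq0 => /eqP ->; rewrite -scalemxAl fB.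
have sv : sqn v != 0 by apply: contra v0 => /eqP/sqn_eq0 ->.
have sfn : sqn f != 0 by apply: contra f0 => /eqP/sqn_eq0 ->.
have fv : f *m v^T = 0 by rewrite -[f]trmxK -trmx_mul vf trmx0.
have vv : v *m v^T = (sqn v)%:M by apply/matrixP => i j; rewrite !ord1 [RHS]mxE eqxx.
have ff : f *m f^T = (sqn f)%:M by apply/matrixP => i j; rewrite !ord1 [RHS]mxE eqxx.
have Fspan (y : 'rV[R]_n) : y *m Q = y -> exists al be, y = al *: f + be *: v.
  move=> /eqP yQ.
  have free2 : \rank (col_mx f v) = 2.
    apply/eqP; rewrite -[_ == _]/(row_free (col_mx f v)).
    apply/row_freeP; exists (row_mx ((sqn f)^-1 *: f^T) ((sqn v)^-1 *: v^T)).
    rewrite mul_col_row -!scalemxAr fv vf ff vv !scaler0 !scale_scalar_mx !mulVf//.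
    by rewrite -scalar_mx_block.
  have sub : (col_mx f v <= kermx (Q - 1%:M))%MS.
    by rewrite col_mx_sub !kerE fQ vQ !eqxx.
  have : (y <= col_mx f v)%MS.
    have [_] := mxrank_leqif_sup sub; rewrite free2.
    have := mxrankS sub; rewrite free2 => h; rewrite eqn_leq h rkF /= => /esym le.
    by apply: submx_trans le; rewrite kerE.
  move=> /submxP[D ->]; exists (lsubmx D 0 0), (rsubmx D 0 0).
  rewrite -{1}[D]hsubmxK mul_row_col; congr (_ + _).
    by rewrite -mul_scalar_mx; congr (_ *m _); apply/matrixP => i j; rewrite !ord1 !mxE.
  by rewrite -mul_scalar_mx; congr (_ *m _); apply/matrixP => i j; rewrite !ord1 !mxE.
pose s b := (v *m eu_rot b *m v^T) 0 0 / sqn v.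
have sE b : sub_set B b -> v *m eu_rot b = s b *: v.
  move=> Bb; have [|al [be e]] := Fspan (v *m eu_rot b).
    have ab : eu_rot a *m eu_rot b = eu_rot b *m eu_rot a by rewrite -!eu_rotM aB.
    by rewrite -mulmxA /Q -ab mulmxA vQ.
  have al0 : al = 0.
    have := orthB b v f; rewrite fB// vf e mulmxDl -!scalemxAl ff vf scaler0 addr0.
    rewrite scale_scalar_mx => /matrixP/(_ 0 0); rewrite !mxE eqxx mulr1n => /eqP.
    by rewrite mulf_eq0 (negbTE sfn) orbF => /eqP.
  rewrite e al0 scale0r add0r /s e al0 scale0r add0r -scalemxAl vv.
  by rewrite scale_scalar_mx mxE eqxx mulr1n mulfK.
have sM x y : sub_set B x -> sub_set B y -> s (x * y)%g = s x * s y.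
  move=> Bx By; have e : s (x * y)%g *: v = (s x * s y) *: v.
    by rewrite -sE ?eu_rotM ?mulmxA ?sE -?scalemxAl ?sE ?scalerA 1?mulrC//; exact: subM.
  move/eqP: e; rewrite -subr_eq0 -scalerBl scaler_eq0 (negbTE v0) orbF subr_eq0.
  by move/eqP.
have s_sign x : sub_set B x -> s x = 1 \/ s x = -1.
  move=> Bx; have := orthB x v v; rewrite sE// linearZ /= -scalemxAl -scalemxAr scalerA vv.
  rewrite scale_scalar_mx => /matrixP/(_ 0 0); rewrite !mxE eqxx !mulr1n -[RHS]mul1r.
  move/(mulIf sv) => /eqP; rewrite -expr2 sqrf_eq1 => /orP[] /eqP; by [left|right].
exists (sign_kernel sM s_sign); split.
- by move=> x [].
- exact: sign_kernel_cover.
apply: (@orbit_lattice _ _ _ _ T _ p) => [x [Bx _]|x y [Bx sx] [By _]]; first exact: BH.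
have [al [be ->]] := Fspan _ (dispF x y Bx By).
by rewrite mulmxDl -!scalemxAl [f *m _]fB// [v *m _]sE// sx scale1r.
Qed.

(** If some element of A has a rotation part, [eu_virtually] applies to B;
    otherwise A consists of translations. *)
Lemma eu_split : (n <= 4)%N -> commuting_pairs_split R (pi1 M).
Proof.
move=> n4; exists eu_oriented; split; first exact: sign_kernel_cover.
move=> A B AH BH AB cAB.
have [[a [Aa a1]]|nA] := pselect (exists a, sub_set A a /\ eu_rot a != 1%:M).
  by right; apply: (@eu_virtually a) => //; [exact: AH|move=> b Bb; exact: AB].
left; exists A; split=> //; first exact: fcover_refl.
apply: (@orbit_lattice _ _ _ _ eu_chart A 0) => // x y Ax Ay.
have -> : lin eu_chart x = 1%:M; last by rewrite mulmx1.
by apply/eqP/negPn/negP => x1; apply: nA; exists x.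
Qed.

End EuclidManifold.

(** * Diagonal extensions: curvature *)

Section DiagFrame.
Variables (R : realType) (n : nat) (T : 'I_n) (lam : 'I_n -> R).
Hypothesis lamT : lam T = 0.

Lemma smooth_dexp (mu : 'I_n -> R) (f : 'rV[R]_n -> 'rV[R]_n) : (forall b, smooth (fun x => f x 0 b)) ->
  forall i j, smooth (fun x => diag_mx (\row_k expR (mu k * f x 0 T)) i j).
Proof.
move=> sf i j.
have -> : (fun x => diag_mx (\row_k expR (mu k * f x 0 T)) i j) =
    (fun x => (i == j)%:R * expR (mu j * f x 0 T)).
  by apply/funext => x; rewrite !mxE mulr_natl; case: eqP => [->|].
apply: smooth_mul; first exact: smooth_cst.
by apply: smooth_exp; apply: smooth_mul; [exact: smooth_cst|exact: sf].
Qed.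

Lemma pd_dexp a k x : pd a (fun y => expR (lam k * y 0 T)) x =
  (a == T)%:R * lam k * expR (lam k * x 0 T).
Proof.
have sl : smooth (fun y : 'rV[R]_n => lam k * y 0 T).
  by apply: smooth_mul; [exact: smooth_cst|exact: smooth_coord].
rewrite /pd derive_expR_comp; last exact: smooth_diff.
rewrite deriveM_real; [|exact: differentiable_cst|exact/smooth_diff/smooth_coord].
by rewrite derive_cst mul0r add0r derive_coord_id mxE eqxx /= eq_sym; ring.
Qed.

Definition diag_brk k l m : R :=
  ((k == T) && (l == m))%:R * lam l - ((l == T) && (k == m))%:R * lam k.

(** The left-invariant frame of R^(n-1) ><| R, where the line acts on the
    k-th coordinate with weight lam k. The coordinate T of the acting line
    may be at any place, so that products with a further line, on which the
    weight is zero, are included. *)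
Definition diag_frame : frame R n.
Proof.
refine (@Frame R n (fun x => diag_mx (\row_k expR (lam k * x 0 T)))
  (fun x => diag_mx (\row_k expR (- lam k * x 0 T))) diag_brk _ _ _ _ _).
- move=> x; rewrite mulmx_diag; apply/matrixP => i j; rewrite !mxE -expRD.
  by rewrite mulNr subrr expR0.
- by move=> f sf i j; exact: smooth_dexp.
- by move=> f sf i j; exact: (@smooth_dexp (fun k => - lam k)).
- by move=> k l m; rewrite /diag_brk opprB.
- move=> x k l b.
  have key k' l' : \sum_a diag_mx (\row_k expR (lam k * x 0 T)) k' a *
      pd a (fun y => diag_mx (\row_k expR (lam k * y 0 T)) l' b) x =
      ((k' == T) && (l' == b))%:R * lam l' * expR (lam b * x 0 T).
    rewrite (bigD1 k')//= big1 ?addr0 => [|a ak]; last first.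
      by rewrite !mxE eq_sym (negbTE ak) mulr0n mul0r.
    have -> : (fun y : 'rV[R]_n => diag_mx (\row_k expR (lam k * y 0 T)) l' b) =
       (fun y => (l' == b)%:R * expR (lam b * y 0 T)).
      by apply/funext => y; rewrite !mxE mulr_natl; case: eqP => [->|].
    rewrite {1}/pd deriveM_real; last 2 first.
    - exact: differentiable_cst.
    - apply/smooth_diff/smooth_exp/smooth_mul; [exact: smooth_cst|exact: smooth_coord].
    rewrite derive_cst mul0r add0r -/(pd _ _ _) pd_dexp !mxE eqxx mulr1n.
    have [->|kT] := eqVneq k' T; last by rewrite /= !mul0r !mulr0.
    rewrite lamT mul0r expR0 mul1r /= mul1r.
    by have [->|lb] := eqVneq l' b; rewrite /= ?mul1r// !mul0r.
  rewrite !key -mulrBl -/(diag_brk k l b) (bigD1 b)//= [X in _ = _ + X]big1 ?addr0.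
    rewrite !mxE eqxx mulr1n /diag_brk; ring.
  by move=> m mb; rewrite !mxE (negbTE mb) mulr0n mulr0.
Defined.

Local Notation F := diag_frame.

Lemma diag_om k i j : om F k i j =
  lam k * (((j == T) && (i == k))%:R - ((i == T) && (j == k))%:R).
Proof.
have eql (a b : 'I_n) : (a == b)%:R * lam a = (a == b)%:R * lam b.
  by have [->|_] := eqVneq a b; rewrite ?mul0r.
rewrite /om /= /diag_brk (eq_sym k j) (eq_sym k i) (eq_sym j i) -!mulnb !natrM.
have := eql i j; have := eql i k; have := eql j k.
move: (i == j) (i == k) (j == k) (i == T) (j == T) (k == T) => a b c d e f.
move: (lam i) (lam j) (lam k) a%:R b%:R c%:R d%:R e%:R f%:R.
move=> x y z a' b' c' d' e' f' h1 h2 h3.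
rewrite -[f' * a' * x]mulrA h3 -[e' * b' * x]mulrA h2 -[d' * c' * y]mulrA h1.
by field.
Qed.

Hypothesis lam_sum : \sum_i lam i = 0.

Lemma sum_pick (g : 'I_n -> R) (b : 'I_n) : \sum_i g i * (i == b)%:R = g b.
Proof.
rewrite (bigD1 b)//= eqxx mulr1 big1 ?addr0// => i ib.
by rewrite (negbTE ib) mulr0.
Qed.

Lemma diag_Rm k l j : Rm F k l k j =
  (l == j)%:R * (lam k * lam l) - (k == l)%:R * (k == j)%:R * (lam k * lam l)
  + (k == T)%:R * (lam l ^+ 2 * (l == j)%:R) + (l == T)%:R * (j == T)%:R * lam k ^+ 2.
Proof.
rewrite /Rm !mxE summxE.
have E1 : \sum_m OM F l k m * OM F k m j = - (k == l)%:R * (k == j)%:R * (lam k * lam l).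
  transitivity (\sum_m (lam l * (k == l)%:R * om F k m j * (m == T)%:R
       - lam l * (k == T)%:R * om F k m j * (m == l)%:R)).
    by apply: eq_bigr => m _; rewrite !mxE (diag_om l) -!mulnb !natrM; ring.
  rewrite sumrB !sum_pick !diag_om -!mulnb !natrM eqxx.
  have [kT|kT] := eqVneq k T; first by rewrite kT lamT /=; ring.
  by rewrite ?(eq_sym T k) ?(negbTE kT) (eq_sym j k) /=; ring.
have E2 : \sum_m OM F k k m * OM F l m j = - (l == j)%:R * (lam k * lam l).
  transitivity (\sum_m (lam k * om F l m j * (m == T)%:R)).
    apply: eq_bigr => m _; rewrite !mxE (diag_om k) eqxx andbT.
    have [kT|kT] := eqVneq k T; first by rewrite kT lamT /=; ring.
    by rewrite /=; ring.
  rewrite sum_pick diag_om eqxx /=.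
  have [lT|lT] := eqVneq l T; first by rewrite lT lamT /=; ring.
  by rewrite ?(eq_sym T l) ?(negbTE lT) andbF (eq_sym j l) /=; ring.
have E3 : \sum_m (brk F k l m *: OM F m) k j =
  - (k == T)%:R * (lam l ^+ 2 * (l == j)%:R) - (l == T)%:R * (j == T)%:R * lam k ^+ 2.
  transitivity (\sum_m ((k == T)%:R * lam l * om F m k j * (m == l)%:R
       - (l == T)%:R * lam k * om F m k j * (m == k)%:R)).
    apply: eq_bigr => m _; rewrite !mxE /= /diag_brk -!mulnb !natrM (eq_sym l m) (eq_sym k m); ring.
  rewrite sumrB !sum_pick !diag_om -!mulnb !natrM eqxx.
  have [kT|kT] := eqVneq k T.
    by rewrite kT lamT ?(eq_sym T l) (eq_sym j l); have [lT|lT] := eqVneq l T; rewrite ?lT ?lamT /=; ring.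
  by rewrite /=; ring.
rewrite E1 E2 E3; ring.
Qed.

(** By the vanishing of the sum of the weights, the Ricci curvature is
    concentrated in the direction of the acting line. *)
Lemma diag_Ric : Ric F = diag_mx (\row_i ((i == T)%:R * \sum_k lam k ^+ 2)).
Proof.
apply/matrixP => l j; rewrite !mxE; under eq_bigr do rewrite diag_Rm.
rewrite !big_split /= sumrN.
rewrite -[X in X + _ + _ + _]mulr_sumr -mulr_suml lam_sum mul0r mulr0 add0r.
have -> : \sum_k (k == l)%:R * (k == j)%:R * (lam k * lam l) = (l == j)%:R * lam l ^+ 2.
  transitivity (\sum_k (k == j)%:R * (lam k * lam l) * (k == l)%:R).
    by apply: eq_bigr => k _; ring.
  by rewrite sum_pick; ring.
have -> : \sum_k (k == T)%:R * (lam l ^+ 2 * (l == j)%:R) = lam l ^+ 2 * (l == j)%:R.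
  transitivity (\sum_k (lam l ^+ 2 * (l == j)%:R) * (k == T)%:R).
    by apply: eq_bigr => k _; ring.
  by rewrite sum_pick.
rewrite -mulr_sumr [_ * lam l ^+ 2]mulrC addNr add0r.
have [->|lj] := eqVneq l j; rewrite ?mulr1n ?mulr0n.
  by case: (j == T); rewrite ?mul1r ?mul0r.
have [lT|lT] := eqVneq l T; last by rewrite !mul0r.
by rewrite -lT eq_sym (negbTE lj) mulr0 mul0r.
Qed.

End DiagFrame.

(** * Diagonal extensions: deck group *)

Section DiagManifold.
Variables (R : realType) (X : lie_model R).
Local Notation n := (gdim X).
Variables (T : 'I_n) (lam : 'I_n -> R) (lamT : lam T = 0).
Local Notation F := (diag_frame lamT).
Hypothesis Flink : left_invariant F.
Hypothesis lam_sum : \sum_i lam i = 0.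
Hypothesis lam_ex : exists i, lam i != 0.
Hypothesis lam_zero : forall i j, lam i = 0 -> lam j = 0 -> i != T -> j != T -> i = j.
Variable M : closed_manifold X.
Local Notation dk := (deck M).
Local Notation Q g x := (frot F (dk g) x).

Let sm g b : smooth (fun x => dk g x 0 b).
Proof. exact: (isom_smooth (deck_isometry g)). Qed.
Let df g x : differentiable (dk g) x.
Proof. exact: (isom_diff (deck_isometry g)). Qed.
Let orth g x : Q g x *m (Q g x)^T = 1%:M.
Proof. exact: (isom_rot_orth Flink (deck_isometry g)). Qed.

Lemma diag_rowT g x j : j != T -> Q g x T j = 0.
Proof.
move=> jT; apply: (Ric_diag_rot0 Flink x (deck_isometry g) (diag_Ric lamT lam_sum)).
rewrite eqxx (negbTE jT) mul0r mul1r; apply/eqP => e.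
have [i li] := lam_ex; case/negP: li; rewrite -sqrf_eq0; apply/eqP.
by apply: (psumr_eq0P _ e) => // k _; exact: sqr_ge0.
Qed.

Lemma diag_colT g x j : j != T -> Q g x j T = 0.
Proof. by apply: (rot_col0 Flink (deck_isometry g)) => y k; exact: diag_rowT. Qed.

Lemma diag_TT_sqr g x : Q g x T T * Q g x T T = 1.
Proof. by apply: (rot_diag_sqr Flink (deck_isometry g)) => y k; exact: diag_rowT. Qed.

(** The T-th row of Q is constant; the vanishing of its derivative in
    [fD_rot] is this equation for the other rows. *)
Lemma diag_block g x k j : k != T -> j != T -> Q g x k j * (lam k - Q g x T T * lam j) = 0.
Proof.
move=> kT jT; have : fD F k (fun y => Q g y T j) x = 0.
  have -> : (fun y => Q g y T j) = (fun=> 0) by apply/funext => y; exact: diag_rowT.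
  exact: fD_cst.
rewrite (fD_rot (sm g) (df g) (orth g)).
have -> : \sum_m om F k T m * Q g x m j = - lam k * Q g x k j.
  transitivity (\sum_m (- lam k * Q g x m j) * (m == k)%:R); last exact: sum_pick.
  apply: eq_bigr => m _; rewrite diag_om eqxx.
  by rewrite (eq_sym T k) (negbTE kT) andbF /= ; ring.
have -> : \sum_l \sum_m Q g x k l * Q g x T m * om F l m j = - (Q g x k j * Q g x T T * lam j).
  transitivity (\sum_l (- (Q g x k l * Q g x T T * lam l)) * (l == j)%:R).
    apply: eq_bigr => l _; transitivity (\sum_m Q g x k l * Q g x T m * om F l m j * (m == T)%:R).
      apply: eq_bigr => m _; have [->|mT] := eqVneq m T; first by rewrite mulr1.
      by rewrite diag_rowT// mulr0 !mul0r.
    rewrite sum_pick diag_om eqxx (negbTE jT) (eq_sym j l) /=; ring.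
  by rewrite sum_pick.
by move=> e; rewrite -[RHS]oppr0 -[in RHS]e; ring.
Qed.

Definition diag_I : pred 'I_n := fun i => lam i == 0.

(** Besides the direction T there is at most one direction of weight zero,
    and [diag_block] separates it from the other ones. *)
Lemma diag_rowI g x i j : diag_I i -> j != i -> Q g x i j = 0.
Proof.
move=> /eqP li ji; have [iT|iT] := eqVneq i T.
  by rewrite iT diag_rowT// -iT.
have [->|jT] := eqVneq j T; first exact: diag_colT.
have lj : lam j != 0 by apply: contra ji => /eqP lj; apply/eqP/lam_zero.
have := diag_block g x iT jT; rewrite li sub0r => /eqP.
rewrite mulf_eq0 oppr_eq0 mulf_eq0 (negbTE lj) orbF => /orP[/eqP//|/eqP e].
by have := diag_TT_sqr g x; rewrite e mul0r => /eqP; rewrite eq_sym oner_eq0.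
Qed.

Definition diag_oriented := oriented Flink diag_rowI.
Local Notation H := diag_oriented.

Lemma diag_QII g x i : sub_set H g -> lam i = 0 -> Q g x i i = 1.
Proof.
move=> Hg /eqP li; exact: (@orientedE _ _ _ Flink M diag_I diag_rowI g x i Hg li).
Qed.

Lemma diag_eigen g x k j : sub_set H g -> lam k != lam j -> Q g x k j = 0.
Proof.
move=> Hg kj; have [kT|kT] := eqVneq k T.
  by apply: diag_rowI; [rewrite /diag_I kT lamT|apply: contra kj => /eqP ->].
have [jT|jT] := eqVneq j T; first by rewrite jT diag_colT.
have := diag_block g x kT jT; rewrite diag_QII// mul1r => /eqP.
by rewrite mulf_eq0 subr_eq0 (negbTE kj) orbF => /eqP.
Qed.

Lemma diag_rot_cst g x : sub_set H g -> Q g x = Q g 0.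
Proof.
move=> Hg; apply/matrixP => i j; have [iT|iT] := eqVneq i T.
  have [->|jT] := eqVneq j T; first by rewrite iT !diag_QII.
  by rewrite iT !diag_rowT.
have [->|jT] := eqVneq j T; first by rewrite !diag_colT.
pose h y := Q g y i j; rewrite -/(h x) -/(h 0).
have sh : smooth h by exact: (rot_smooth F (sm g)).
apply: (@fD0_cst _ _ F h sh) => k y.
rewrite (fD_rot (sm g) (df g) (orth g)) !big1 ?subr0// => [l _|m _].
  apply: big1 => m _; rewrite diag_om (negbTE jT) /=.
  by have [->|mT] := eqVneq m T; rewrite /= ?diag_colT// ?mulr0 ?mul0r// subr0 !mulr0.
rewrite diag_om (negbTE iT) /=; have [->|mT] := eqVneq m T; first by rewrite diag_rowT// mulr0.
by rewrite /= subr0 mulr0 mul0r.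
Qed.

Definition diag_shift g : R := dk g 0 0 T.

Lemma diag_pd g a j x : pd a (fun y => dk g y 0 j) x =
  expR (- lam a * x 0 T) * (Q g x a j * expR (lam j * dk g x 0 T)).
Proof.
rewrite (pd_fD F) (bigD1 a)//= [X in _ + X]big1 ?addr0 => [|k ka]; last first.
  by rewrite !mxE eq_sym (negbTE ka) mulr0n mul0r.
rewrite !mxE eqxx mulr1n; congr (_ * _).
rewrite fD_coord (bigD1 j)//= big1 ?addr0 => [|k kj].
  by rewrite !mxE eqxx mulr1n.
by rewrite !mxE (negbTE kj) mulr0n mulr0.
Qed.

Lemma diag_height g x : sub_set H g -> dk g x 0 T = x 0 T + diag_shift g.
Proof.
move=> Hg; rewrite (@affine_of_pd _ _ (fun y => dk g y 0 T) (fun a => (a == T)%:R) (sm g T)).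
  by rewrite sum_pick addrC.
move=> a y; rewrite diag_pd lamT mul0r expR0 mulr1.
have [->|aT] := eqVneq a T; first by rewrite lamT oppr0 mul0r expR0 mul1r diag_QII.
by rewrite diag_colT// mulr0.
Qed.

Definition diag_lin g : 'M[R]_n := \matrix_(i, j) (Q g 0 i j * expR (lam j * diag_shift g)).

Lemma diag_affine g x : sub_set H g -> dk g x = x *m diag_lin g + dk g 0.
Proof.
move=> Hg; apply/rowP => j.
rewrite (@affine_of_pd _ _ (fun y => dk g y 0 j) (fun a => diag_lin g a j) (sm g j)).
  by rewrite addrC !mxE.
move=> a y; rewrite diag_pd diag_height// diag_rot_cst// mxE mulrCA -expRD.
have [aj|aj] := eqVneq (lam a) (lam j); last by rewrite diag_eigen ?mul0r.
by rewrite aj; congr (_ * expR _); ring.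
Qed.

Definition diag_chart : affine_chart H.
Proof.
refine (@AffineChart R X M H id id _ _ _ _ diag_lin (fun g => dk g 0) _ _) => //.
- by move=> x; exact: cvg_id.
- by move=> x; exact: cvg_id.
- by move=> g x; exact: diag_affine.
move=> r; exists (expR ((\sum_i `|lam i|) * (r + r))) => g y Hg yr.
rewrite -diag_affine// => gr.
have cr : `|diag_shift g| <= r + r.
  have -> : diag_shift g = dk g y 0 T - y 0 T by rewrite diag_height// [_ + diag_shift g]addrC addrK.
  apply: le_trans (ler_normB _ _) _; apply: lerD.
    exact: le_trans (entry_le_norm _ _ _) gr.
  exact: le_trans (entry_le_norm _ _ _) yr.
apply: norm_le_entry => [|i j]; first exact: expR_ge0.
rewrite mxE normrM [X in _ * X]ger0_norm ?expR_ge0// -[leRHS]mul1r; apply: ler_pM; rewrite ?expR_ge0//.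
  exact: le_trans (entry_le_norm _ _ _) (orth_norm_le1 (orth g 0)).
rewrite ler_expR; apply: le_trans (ler_norm _) _; rewrite normrM; apply: ler_pM => //.
by rewrite (bigD1 j)//= lerDl sumr_ge0.
Defined.

Lemma diag_lin_fixed g (v : 'rV[R]_n) : sub_set H g -> (forall j, lam j != 0 -> v 0 j = 0) ->
  v *m diag_lin g = v.
Proof.
move=> Hg v0; apply/rowP => j; rewrite mxE.
have [lj|lj] := eqVneq (lam j) 0.
  rewrite (bigD1 j)//= big1 ?addr0 => [|k kj].
    by rewrite mxE diag_QII// lj mul0r expR0 !mulr1.
  have [lk|lk] := eqVneq (lam k) 0; last by rewrite v0 ?mul0r.
  by rewrite mxE diag_rowI 1?eq_sym// ?mul0r ?mulr0// /diag_I lk.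
rewrite v0// big1// => k _; have [lk|lk] := eqVneq (lam k) 0; last by rewrite v0 ?mul0r.
by rewrite mxE diag_eigen ?mul0r ?mulr0// lk eq_sym.
Qed.

(** Put u = v Q and c = diag_shift g, so that v_j = u_j exp (lam_j c). As Q
    preserves the spaces of equal weights, the sums of lam_j u_j^2 and lam_j
    v_j^2 agree. Hence the sum of lam_j c (exp (2 lam_j c) - 1) u_j^2 is
    zero; its terms are nonnegative, and they are zero only if lam_j = 0 or
    u_j = 0. *)
Lemma diag_fixed_support g (v : 'rV[R]_n) : sub_set H g -> diag_shift g != 0 ->
  v *m diag_lin g = v -> forall j, lam j != 0 -> v 0 j = 0.
Proof.
move=> Hg c0 vL; set c := diag_shift g in c0; pose u := v *m Q g 0.
have uv j : v 0 j = u 0 j * expR (lam j * c).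
  rewrite -{1}vL !mxE mulr_suml; apply: eq_bigr => k _.
  by rewrite mxE mulrA.
have wt : \sum_j lam j * u 0 j ^+ 2 = \sum_j lam j * v 0 j ^+ 2.
  pose D : 'M[R]_n := diag_mx (\row_j lam j).
  have QD : Q g 0 *m D = D *m Q g 0.
    apply/matrixP => i j; rewrite mul_diag_mx mul_mx_diag !mxE.
    have [e|e] := eqVneq (lam i) (lam j); first by rewrite e mulrC.
    by rewrite diag_eigen// mul0r mulr0.
  have quad (z : 'rV[R]_n) : (z *m D *m z^T) 0 0 = \sum_j lam j * z 0 j ^+ 2.
    rewrite mxE; apply: eq_bigr => j _; rewrite mul_mx_diag !mxE; ring.
  rewrite -!quad /u trmx_mul !mulmxA -(mulmxA v) QD -!mulmxA [Q g 0 *m _]mulmxA orth.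
  by rewrite mul1mx.
have S0 : \sum_j (lam j * c) * (expR (lam j * c + lam j * c) - 1) * u 0 j ^+ 2 = 0.
  rewrite (eq_bigr (fun j => c * (lam j * v 0 j ^+ 2) - c * (lam j * u 0 j ^+ 2))).
    by rewrite sumrB -!mulr_sumr wt subrr.
  by move=> j _; rewrite uv expRD; ring.
move=> j lj.
have pos k : 0 <= (lam k * c) * (expR (lam k * c + lam k * c) - 1) * u 0 k ^+ 2.
  apply: mulr_ge0; last exact: sqr_ge0.
  have [l0|l0] := leP 0 (lam k * c).
    by apply: mulr_ge0 => //; rewrite subr_ge0 -expR0 ler_expR addr_ge0.
  apply: mulr_le0; first exact: ltW.
  by rewrite subr_le0 -expR0 ler_expR; lra.
have := psumr_eq0P (fun k _ => pos k) S0; move=> /(_ j isT) /eqP.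
have lc : lam j * c != 0 by rewrite mulf_neq0.
rewrite mulf_eq0 [X in X || _]mulf_eq0 (negbTE lc) /= sqrf_eq0 => /orP[|/eqP u0].
  rewrite subr_eq0 -expR0 => /eqP/expR_inj e.
  by exfalso; case/negP: lc; apply/eqP; lra.
by rewrite uv u0 mul0r.
Qed.

(** A vector fixed by an element that changes the height has weight zero by
    [diag_fixed_support], and such vectors are fixed by all of H. *)
Lemma diag_split : commuting_pairs_split R (pi1 M).
Proof.
apply: (@split_by_height _ _ _ _ diag_chart (delta_mx T 0)).
- exact: oriented_cover.
- by apply/eqP => /matrixP/(_ T 0); rewrite !mxE !eqxx => /eqP; rewrite oner_eq0.
- move=> g Hg; apply/colP => i; rewrite -colE !mxE lamT mul0r expR0 mulr1 andbT.
  have [->|iT] := eqVneq i T; first by rewrite diag_QII.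
  by rewrite diag_colT.
move=> a B Ha ca BH aB; have c0 : diag_shift a != 0.
  apply: contra ca => /eqP c0; apply/eqP/matrixP => i j; rewrite !ord1 -colE !mxE.
  exact: c0.
have fixE (v : 'rV[R]_n) : v *m (diag_lin a - 1%:M) = 0 -> v *m diag_lin a = v.
  by rewrite mulmxBr mulmx1 => /eqP; rewrite subr_eq0 => /eqP.
apply: (@centralizer_lattice _ _ _ _ diag_chart a B Ha BH aB) => [x|b v Bb /= va].
  rewrite /= -/(diag_lin a) => xKK; have yL := fixE _ xKK; set y := x *m _ in xKK yL *.
  apply/rowP => j; rewrite [RHS]mxE; have [lj|lj] := eqVneq (lam j) 0; last first.
    exact: (diag_fixed_support Ha c0 yL).
  rewrite /y mulmxBr mulmx1 !mxE (bigD1 j)//= big1 ?addr0 => [|k kj].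
    by rewrite mxE diag_QII// lj mul0r expR0 !mulr1 subrr.
  rewrite mxE (rot_col0 Flink (deck_isometry a) _ _ kj) ?mul0r ?mulr0//.
  by move=> z i; apply: diag_rowI; rewrite /diag_I lj.
apply: diag_lin_fixed; first exact: BH.
exact: (diag_fixed_support Ha c0 va).
Qed.

End DiagManifold.

(** * The Heisenberg group: curvature *)

Section HeisenbergFrame.
Variables (R : realType) (n : nat) (i0 i1 i2 : 'I_n).
Hypothesis i012 : uniq [:: i0; i1; i2].

Lemma i0_neq1 : (i0 == i1) = false. Proof. by move: i012; rewrite /= !inE !negb_or => /andP[/andP[/negbTE]]. Qed.
Lemma i0_neq2 : (i0 == i2) = false.
Proof. by move: i012; rewrite /= !inE !negb_or => /andP[/andP[_ /negbTE]]. Qed.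
Lemma i1_neq2 : (i1 == i2) = false.
Proof. by move: i012; rewrite /= !inE !negb_or => /and3P[_ /negbTE]. Qed.
Definition i_neq := (i0_neq1, i0_neq2, i1_neq2, (eq_sym i1 i0, i0_neq1), (eq_sym i2 i0, i0_neq2), (eq_sym i2 i1, i1_neq2)).

Definition heis_fr (s : R) (x : 'rV[R]_n) : 'M[R]_n :=
  \matrix_(i, j) ((i == j)%:R + (i == i1)%:R * (j == i2)%:R * (s * x 0 i0)).

Lemma heis_fr_smooth s (f : 'rV[R]_n -> 'rV[R]_n) : (forall b, smooth (fun x => f x 0 b)) ->
  forall i j, smooth (fun x => heis_fr s (f x) i j).
Proof.
move=> sf i j.
have -> : (fun x => heis_fr s (f x) i j) =
  (fun x => (i == j)%:R + (i == i1)%:R * (j == i2)%:R * s * f x 0 i0).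
  by apply/funext => x; rewrite mxE !mulrA.
by apply: smooth_add; [exact: smooth_cst|apply: smooth_mul => //; exact: smooth_cst].
Qed.

Definition heis_brk k l m : R :=
  ((k == i0)%:R * (l == i1)%:R - (k == i1)%:R * (l == i0)%:R) * (m == i2)%:R.

(** The left-invariant frame of the product of the Heisenberg group, with
    coordinates x, y, z at the indices i0, i1, i2, and a Euclidean space. *)
Definition heis_frame : frame R n.
Proof.
refine (@Frame R n (heis_fr 1) (heis_fr (-1)) heis_brk _ _ _ _ _).
- move=> x; apply/matrixP => i j; rewrite !mxE.
  transitivity (\sum_m ((m == i)%:R * ((i == j)%:R + (i == i1)%:R * (j == i2)%:R * (- 1 * x 0 i0))
     + (i == i1)%:R * x 0 i0 * (i2 == j)%:R * (m == i2)%:R)).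
    apply: eq_bigr => m _; rewrite !mxE (eq_sym i m).
    have [->|mi] := eqVneq m i.
      have [->|_] := eqVneq i i2; rewrite ?(eq_sym i2 i1) ?i1_neq2 /=; ring.
    have [->|_] := eqVneq m i2; rewrite ?(eq_sym i2 i1) ?i1_neq2 /=; ring.
  rewrite big_split /= sum_pick; under eq_bigr do rewrite mulrC.
  rewrite sum_pick (eq_sym i2 j); ring.
- exact: heis_fr_smooth.
- exact: heis_fr_smooth.
- by move=> k l m; rewrite /heis_brk; ring.
- move=> x k l b.
  have key k' l' : \sum_a heis_fr 1 x k' a * pd a (fun y => heis_fr 1 y l' b) x =
      (k' == i0)%:R * (l' == i1)%:R * (b == i2)%:R.
    have pdE a : pd a (fun y => heis_fr 1 y l' b) x =
       (l' == i1)%:R * (b == i2)%:R * (a == i0)%:R.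
      have -> : (fun y : 'rV[R]_n => heis_fr 1 y l' b) =
         (fun y => (l' == b)%:R + (l' == i1)%:R * (b == i2)%:R * y 0 i0).
        by apply/funext => y; rewrite mxE mul1r.
      have sl : smooth (fun y : 'rV[R]_n => (l' == i1)%:R * (b == i2)%:R * y 0 i0).
        by apply: smooth_mul; [exact: smooth_cst|exact: smooth_coord].
      rewrite /pd deriveD_real; [|exact: differentiable_cst|exact: smooth_diff].
      rewrite derive_cst add0r deriveM_real; [|exact: differentiable_cst|exact/smooth_diff/smooth_coord].
      by rewrite derive_cst mul0r add0r derive_coord_id mxE eqxx /= (eq_sym i0 a).
    under eq_bigr do rewrite pdE mulrA.
    by rewrite sum_pick mxE i0_neq2 /=; ring.
  rewrite !key.
  under eq_bigr do rewrite /heis_brk mulrAC.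
  rewrite sum_pick mxE (eq_sym i2 i1) i1_neq2 (eq_sym i2 b) /=; ring.
Defined.

Local Notation F := heis_frame.

Lemma sum3 (g : 'I_n -> R) : (forall k, k != i0 -> k != i1 -> k != i2 -> g k = 0) ->
  \sum_k g k = g i0 + g i1 + g i2.
Proof.
move=> g0; rewrite (bigD1 i0)//= (bigD1 i1) /=; last by rewrite (eq_sym i1 i0) i0_neq1.
rewrite (bigD1 i2) /=; last by rewrite (eq_sym i2 i0) i0_neq2 (eq_sym i2 i1) i1_neq2.
rewrite big1 ?addr0 ?addrA// => k /andP[/andP[? ?] ?]; exact: g0.
Qed.

Lemma heis_om k i j : om F k i j =
  (heis_brk k i j - heis_brk i j k + heis_brk j k i) / 2.
Proof. by []. Qed.

Lemma heis_Ric : Ric F = diag_mx (\row_i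
  (((i == i0)%:R + (i == i1)%:R - (i == i2)%:R) / 2)).
Proof.
apply/matrixP => l j; rewrite !mxE.
have RmE k : Rm F k l k j =
    (\sum_m om F l k m * om F k m j) - (\sum_m om F k k m * om F l m j)
    - \sum_m brk F k l m * om F m k j.
  rewrite /Rm !mxE summxE; congr (_ - _ - _); apply: eq_bigr => m _; by rewrite !mxE.
under eq_bigr do rewrite RmE.
have z1 k (m : 'I_n) : m != i0 -> m != i1 -> m != i2 -> om F l k m * om F k m j = 0.
  move=> /negbTE m0 /negbTE m1 /negbTE m2.
  by rewrite !heis_om /heis_brk m0 m1 m2 /=; field.
have z2 k (m : 'I_n) : m != i0 -> m != i1 -> m != i2 -> om F k k m * om F l m j = 0.
  move=> /negbTE m0 /negbTE m1 /negbTE m2.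
  by rewrite !heis_om /heis_brk m0 m1 m2 /=; field.
have z3 k (m : 'I_n) : m != i0 -> m != i1 -> m != i2 -> brk F k l m * om F m k j = 0.
  move=> /negbTE m0 /negbTE m1 /negbTE m2.
  by rewrite !heis_om /= /heis_brk m0 m1 m2 /=; field.
under eq_bigr do rewrite (sum3 (z1 _)) (sum3 (z2 _)) (sum3 (z3 _)).
rewrite sum3; last first.
  move=> k /negbTE k0 /negbTE k1 /negbTE k2.
  by rewrite !heis_om /= /heis_brk k0 k1 k2 !eqxx !i_neq /=; field.
rewrite !heis_om /= /heis_brk !eqxx !i_neq /=.
transitivity (((l == i0)%:R * (j == i0)%:R + (l == i1)%:R * (j == i1)%:R
   - (l == i2)%:R * (j == i2)%:R) / 2 : R); first by field.
have [->|lj] := eqVneq l j.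
  rewrite mulr1n; case: (j == i0) (j == i1) (j == i2) => [] [] [] /=; lra.
have dz a : (l == a)%:R * (j == a)%:R = 0 :> R.
  have [<-|_] := eqVneq l a; last by rewrite mul0r.
  by rewrite eq_sym (negbTE lj) mulr0.
by rewrite !dz mulr0n; lra.
Qed.

End HeisenbergFrame.

(** * The Heisenberg group: deck group *)

Section HeisenbergManifold.
Variables (R : realType) (X : lie_model R).
Local Notation n := (gdim X).
Variables (i0 i1 i2 : 'I_n) (i012 : uniq [:: i0; i1; i2]).
Local Notation F := (heis_frame R i012).
Hypothesis Flink : left_invariant F.
Hypothesis one_more : forall s s', s \notin [:: i0; i1; i2] -> s' \notin [:: i0; i1; i2] -> s = s'.
Variable M : closed_manifold X.
Local Notation dk := (deck M).
Local Notation Q g x := (frot F (dk g) x).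
Local Notation ne := (i_neq i012).

Let sm g b : smooth (fun x => dk g x 0 b).
Proof. exact: (isom_smooth (deck_isometry g)). Qed.
Let df g x : differentiable (dk g) x.
Proof. exact: (isom_diff (deck_isometry g)). Qed.
Let orth g x : Q g x *m (Q g x)^T = 1%:M.
Proof. exact: (isom_rot_orth Flink (deck_isometry g)). Qed.

Definition heis_I : pred 'I_n := fun i => (i != i0) && (i != i1).

(** The eigenvalues of [Ric] are 1/2 on the horizontal plane, - 1/2 on the
    center, and 0 on the Euclidean factor, which [one_more] restricts to a
    line. *)
Lemma heis_rowI g x i j : heis_I i -> j != i -> Q g x i j = 0.
Proof.
move=> /andP[/negbTE n0 /negbTE n1] ji.
apply: (Ric_diag_rot0 Flink x (deck_isometry g) (heis_Ric R i012)).
rewrite n0 n1; have [e2|n2] := eqVneq i i2.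
  rewrite e2 in ji *; rewrite (negbTE ji); case: (j == i0); case: (j == i1) => /=;
    by apply/eqP; lra.
have [e0|m0] := eqVneq j i0; first by rewrite e0 !ne /=; apply/eqP; lra.
have [e1|m1] := eqVneq j i1; first by rewrite e1 !ne /=; apply/eqP; lra.
have [e2|m2] := eqVneq j i2; first by rewrite /=; apply/eqP; lra.
case/eqP: ji; apply: one_more; first by rewrite !inE (negbTE m0) (negbTE m1) (negbTE m2).
by rewrite !inE n0 n1 (negbTE n2).
Qed.

Lemma heis_colI g x i j : heis_I i -> j != i -> Q g x j i = 0.
Proof. by move=> Ii ji; apply: (rot_col0 Flink (deck_isometry g)) => // y k; exact: heis_rowI. Qed.

Lemma heis_I2 : heis_I i2. Proof. by rewrite /heis_I !ne. Qed.

Definition heis_oriented := oriented Flink heis_rowI.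
Local Notation H := heis_oriented.

Lemma heis_QII g x i : sub_set H g -> heis_I i -> Q g x i i = 1.
Proof. exact: (@orientedE _ _ _ Flink M heis_I heis_rowI g x i). Qed.

Lemma heis_om0 k i j : k != i2 -> i != i2 -> j != i2 -> om F k i j = 0.
Proof.
move=> /negbTE k2 /negbTE i2' /negbTE j2.
by rewrite heis_om /heis_brk k2 i2' j2 /= !mulr0; lra.
Qed.

Lemma heis_fD_rot0 g k i j x : k != i2 -> i != i2 -> j != i2 ->
  fD F k (fun y => Q g y i j) x = 0.
Proof.
move=> k2 i2' j2; rewrite (fD_rot (sm g) (df g) (orth g)) !big1 ?subr0// => [l _|m _].
  apply: big1 => m _; have [->|m2] := eqVneq m i2.
    by rewrite (heis_colI _ _ heis_I2 i2') mulr0 mul0r.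
  have [->|l2] := eqVneq l i2; first by rewrite (heis_colI _ _ heis_I2 k2) !mul0r.
  by rewrite heis_om0// mulr0.
have [->|m2] := eqVneq m i2; first by rewrite (heis_rowI _ _ heis_I2 j2) mulr0.
by rewrite heis_om0// mul0r.
Qed.

(** The connection coefficients without an index i2 vanish, which gives the
    derivatives along the other directions; the direction i2 is the bracket
    of i0 and i1. *)
Lemma heis_rot_cst g x i j : i != i2 -> j != i2 -> Q g x i j = Q g 0 i j.
Proof.
move=> i2' j2; pose h y := Q g y i j; rewrite -/(h x) -/(h 0).
have sh : smooth h by exact: (rot_smooth F (sm g)).
apply: (@fD0_cst _ _ F h sh) => k y; have [->|k2] := eqVneq k i2; last exact: heis_fD_rot0.
have := fD_comm F i0 i1 y sh.
have -> : fD F i1 h = fun=> 0 by apply/funext => z; apply: heis_fD_rot0 => //; rewrite ne.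
have -> : fD F i0 h = fun=> 0 by apply/funext => z; apply: heis_fD_rot0 => //; rewrite ne.
rewrite !fD_cst subrr /= /heis_brk; under eq_bigr do rewrite mulrAC.
by rewrite sum_pick !eqxx !ne /= !mulr1 mulr0 subr0 mul1r.
Qed.

(** Q respects the bracket of the two horizontal directions, so its
    determinant on the plane is its entry in the center. *)
Lemma heis_det g : sub_set H g ->
  Q g 0 i0 i0 * Q g 0 i1 i1 - Q g 0 i0 i1 * Q g 0 i1 i0 = 1.
Proof.
move=> Hg; have := rot_torsion F (sm g) (df g) i0 i1 i2 0.
have z i : i != i2 -> fD F i (fun y => Q g y i1 i2) 0 = 0.
  move=> _; have -> : (fun y => Q g y i1 i2) = fun=> 0.
    by apply/funext => y; apply: (heis_colI _ _ heis_I2); rewrite ne.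
  exact: fD_cst.
have z' i : fD F i (fun y => Q g y i0 i2) 0 = 0.
  have -> : (fun y => Q g y i0 i2) = fun=> 0.
    by apply/funext => y; apply: (heis_colI _ _ heis_I2); rewrite ne.
  exact: fD_cst.
rewrite z ?ne// z' subrr /= /heis_brk.
under eq_bigr do rewrite mulrAC.
rewrite sum_pick (heis_QII _ Hg heis_I2) !eqxx !ne /=.
have -> : \sum_l \sum_p Q g 0 i0 l * Q g 0 i1 p * (((l == i0)%:R * (p == i1)%:R -
   (l == i1)%:R * (p == i0)%:R) * 1) = Q g 0 i0 i0 * Q g 0 i1 i1 - Q g 0 i0 i1 * Q g 0 i1 i0.
  transitivity (\sum_l (Q g 0 i0 l * Q g 0 i1 i1 * (l == i0)%:R - Q g 0 i0 l * Q g 0 i1 i0 * (l == i1)%:R)).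
    apply: eq_bigr => l _.
    transitivity (\sum_p (Q g 0 i0 l * (l == i0)%:R * Q g 0 i1 p * (p == i1)%:R -
       Q g 0 i0 l * (l == i1)%:R * Q g 0 i1 p * (p == i0)%:R)).
      by apply: eq_bigr => p _; ring.
    by rewrite sumrB !sum_pick; ring.
  by rewrite sumrB !sum_pick.
by move=> /eqP; rewrite eq_sym subr_eq0 => /eqP <-; ring.
Qed.

Local Notation q g i j := (Q g 0 i j).

Lemma heis_frE s x i j : heis_fr i0 i1 i2 s x i j = (i == j)%:R + (i == i1)%:R * (j == i2)%:R * (s * x 0 i0) :> R.
Proof. by rewrite mxE. Qed.

Lemma heis_pdE a h x : pd a h x = fD F a h x - (a == i1)%:R * x 0 i0 * fD F i2 h x.
Proof.
rewrite (pd_fD F) /=.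
transitivity (\sum_k (fD F k h x * (k == a)%:R - (a == i1)%:R * x 0 i0 * fD F k h x * (k == i2)%:R)).
  by apply: eq_bigr => k _; rewrite heis_frE (eq_sym a k); ring.
by rewrite sumrB !sum_pick.
Qed.

Lemma heis_fD_coord g k j x : j != i2 -> fD F k (fun y => dk g y 0 j) x = q g k j.
Proof.
move=> j2; rewrite fD_coord.
transitivity (\sum_l Q g x k l * (l == j)%:R).
  by apply: eq_bigr => l _; rewrite /= heis_frE (negbTE j2) /=; ring.
rewrite sum_pick; have [->|k2] := eqVneq k i2; last exact: heis_rot_cst.
by rewrite !(heis_rowI _ _ heis_I2 j2).
Qed.

Lemma heis_fD_coord2 g k x : sub_set H g -> fD F k (fun y => dk g y 0 i2) x =
  (k == i2)%:R + q g k i1 * dk g x 0 i0.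
Proof.
move=> Hg; rewrite fD_coord.
transitivity (\sum_l (Q g x k l * (l == i2)%:R + Q g x k l * dk g x 0 i0 * (l == i1)%:R)).
  by apply: eq_bigr => l _; rewrite /= heis_frE eqxx /=; ring.
rewrite big_split /= !sum_pick; congr (_ + _ * _).
  have [->|k2] := eqVneq k i2; first exact: heis_QII heis_I2.
  exact: heis_colI heis_I2 _.
have [->|k2] := eqVneq k i2; last by apply: heis_rot_cst => //; rewrite ne.
by rewrite !(heis_rowI _ _ heis_I2) // ne.
Qed.

Lemma heis_pd_coord g a j x : j != i2 -> pd a (fun y => dk g y 0 j) x = q g a j.
Proof.
move=> j2; rewrite heis_pdE !heis_fD_coord// (heis_rowI _ _ heis_I2 j2).
by rewrite mulr0 subr0.
Qed.

Lemma heis_coord g x j : j != i2 -> dk g x 0 j = dk g 0 0 j + \sum_a x 0 a * q g a j.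
Proof.
move=> j2; apply: (@affine_of_pd _ _ (fun y => dk g y 0 j) (fun a => q g a j) (sm g j)).
by move=> a y; exact: heis_pd_coord.
Qed.

Lemma heis_coord01 g x j : (j == i0) || (j == i1) ->
  dk g x 0 j = dk g 0 0 j + (x 0 i0 * q g i0 j + x 0 i1 * q g i1 j).
Proof.
move=> j01; have j2 : j != i2 by case/orP: j01 => /eqP ->; rewrite ne.
rewrite heis_coord//; congr (_ + _).
rewrite (sum3 i012) => [|k k0 k1 k2].
  by rewrite (heis_rowI _ _ heis_I2 j2) mulr0 addr0.
have Ik : heis_I k by rewrite /heis_I k0.
rewrite (heis_rowI _ _ Ik) ?mulr0//.
by case/orP: j01 => /eqP ->; rewrite eq_sym.
Qed.

Definition heis_tr g j : R := dk g 0 0 j.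
(** The derivative, along the a-th coordinate, of the central exponential
    coordinate of the isometry. *)
Definition heis_central g a : R :=
  (a == i2)%:R + (q g a i1 * heis_tr g i0 - q g a i0 * heis_tr g i1) / 2.

(** Exponential coordinates. In them, left translations as well as
    automorphisms of the Heisenberg group are affine. *)
Definition heis_log (x : 'rV[R]_n) : 'rV[R]_n :=
  \row_j (x 0 j - (j == i2)%:R * (x 0 i0 * x 0 i1 / 2)).
Definition heis_exp (x : 'rV[R]_n) : 'rV[R]_n :=
  \row_j (x 0 j + (j == i2)%:R * (x 0 i0 * x 0 i1 / 2)).

Lemma heis_logK : cancel heis_log heis_exp.
Proof. by move=> x; apply/rowP => j; rewrite !mxE !ne /=; ring. Qed.
Lemma heis_expK : cancel heis_exp heis_log.
Proof. by move=> x; apply/rowP => j; rewrite !mxE !ne /=; ring. Qed.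

Lemma continuous_rows m p (f : 'rV[R]_m -> 'rV[R]_p) : (forall j, smooth (fun x => f x 0 j)) -> continuous f.
Proof.
move=> sf x; apply/(@cvgrPdist_lt _ _ _ (nbhs x) (nbhs_filter x)) => e e0.
have : nbhs x [set y | forall j, `|f x 0 j - f y 0 j| < e / 2].
  apply: (@filter_forall _ _ (fun j y => `|f x 0 j - f y 0 j| < e / 2) (nbhs x) _) => j.
  have /cvgrPdist_lt := smooth_continuous (sf j) (x := x); apply; exact: divr_gt0.
apply: filterS => y fy; apply: (@le_lt_trans _ _ (e / 2)); last by rewrite ltr_pdivrMr// ltr_pMr// ltr1n.
apply: norm_le_entry; first by rewrite divr_ge0// ltW.
by move=> i j; rewrite ord1 !mxE; apply: ltW.
Qed.

Lemma smooth_quad (c : R) j : smooth (fun x : 'rV[R]_n => x 0 j + c * (x 0 i0 * x 0 i1 / 2)).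
Proof.
apply: smooth_add; first exact: smooth_coord.
apply: smooth_mul; first exact: smooth_cst.
by apply: smooth_mul; [apply: smooth_mul; exact: smooth_coord|exact: smooth_cst].
Qed.

Lemma heis_log_cont : continuous heis_log.
Proof.
apply: continuous_rows => j.
have -> : (fun x => heis_log x 0 j) = (fun x => x 0 j + - (j == i2)%:R * (x 0 i0 * x 0 i1 / 2)).
  by apply/funext => x; rewrite mxE mulNr.
exact: smooth_quad.
Qed.

Lemma heis_exp_cont : continuous heis_exp.
Proof.
apply: continuous_rows => j.
have -> : (fun x => heis_exp x 0 j) = (fun x => x 0 j + (j == i2)%:R * (x 0 i0 * x 0 i1 / 2)).
  by apply/funext => x; rewrite mxE.
exact: smooth_quad.
Qed.

(** Both sides are affine with the same partial derivatives; the quadratic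
    terms cancel because the horizontal part of Q has determinant one. *)
Lemma heis_height g x : sub_set H g ->
  dk g x 0 i2 - dk g x 0 i0 * dk g x 0 i1 / 2 + x 0 i0 * x 0 i1 / 2 =
  heis_tr g i2 - heis_tr g i0 * heis_tr g i1 / 2 + \sum_a x 0 a * heis_central g a.
Proof.
move=> Hg; pose h y : R := (dk g y 0 i2 + (- 2^-1) * (dk g y 0 i0 * dk g y 0 i1)) +
  2^-1 * (y 0 i0 * y 0 i1).
have s1 : smooth (fun y => dk g y 0 i0 * dk g y 0 i1) by apply: smooth_mul; exact: sm.
have s2 : smooth (fun y : 'rV[R]_n => y 0 i0 * y 0 i1) by apply: smooth_mul; exact: smooth_coord.
have s3 : smooth (fun y => - 2^-1 * (dk g y 0 i0 * dk g y 0 i1)) by apply: smooth_mul => //; exact: smooth_cst.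
have s4 : smooth (fun y : 'rV[R]_n => 2^-1 * (y 0 i0 * y 0 i1)) by apply: smooth_mul => //; exact: smooth_cst.
have s5 : smooth (fun y => dk g y 0 i2 + - 2^-1 * (dk g y 0 i0 * dk g y 0 i1)).
  by apply: smooth_add => //; exact: sm.
have sh : smooth h by exact: smooth_add.
have n0 : i0 != i2 by rewrite ne.
have n1 : i1 != i2 by rewrite ne.
have key a y : pd a h y = heis_central g a.
  rewrite /h /pd deriveD_real; [|exact: smooth_diff|exact: smooth_diff].
  rewrite deriveD_real; [|exact/smooth_diff/sm|exact: smooth_diff].
  rewrite deriveM_real; [|exact: differentiable_cst|exact: smooth_diff].
  rewrite [X in _ + X]deriveM_real; [|exact: differentiable_cst|exact: smooth_diff].
  rewrite (@deriveM_real _ _ (fun y => dk g y 0 i0) (fun y => dk g y 0 i1)); [|exact/smooth_diff/sm|exact/smooth_diff/sm].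
  rewrite (@deriveM_real _ _ (fun y : 'rV[R]_n => y 0 i0) (fun y : 'rV[R]_n => y 0 i1));
    [|exact/smooth_diff/smooth_coord|exact/smooth_diff/smooth_coord].
  rewrite !derive_cst !derive_coord_id !mul0r !add0r -!/(pd a _ y).
  rewrite (heis_pd_coord g a y n0) (heis_pd_coord g a y n1).
  rewrite heis_pdE !heis_fD_coord2// !mxE ?eqxx /=.
  rewrite (heis_rowI _ _ heis_I2 n1) mul0r addr0 mulr1.
  rewrite !(heis_coord01 g y) ?eqxx ?orbT// -!/(heis_tr g _) /heis_central.
  have dt := heis_det Hg.
  have [ea0|a0] := eqVneq a i0.
    rewrite ea0 ?eqxx ?ne /=; move: dt.
    move: (q g i0 i0) (q g i0 i1) (q g i1 i0) (q g i1 i1) => q00 q01 q10 q11 dt.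
    transitivity ((q01 * heis_tr g i0 - q00 * heis_tr g i1) / 2 +
       y 0 i1 * (1 - (q00 * q11 - q01 * q10)) / 2); first by field.
    by rewrite dt; ring.
  have [ea1|a1] := eqVneq a i1.
    rewrite ea1 ?eqxx ?ne /=; move: dt.
    move: (q g i0 i0) (q g i0 i1) (q g i1 i0) (q g i1 i1) => q00 q01 q10 q11 dt.
    transitivity ((q11 * heis_tr g i0 - q10 * heis_tr g i1) / 2 +
       y 0 i0 * ((q00 * q11 - q01 * q10) - 1) / 2); first by field.
    by rewrite dt; ring.
  have Ia : heis_I a by rewrite /heis_I a0 a1.
  have r0 : q g a i0 = 0 by apply: heis_rowI => //; rewrite eq_sym.
  have r1 : q g a i1 = 0 by apply: heis_rowI => //; rewrite eq_sym.
  by rewrite r0 r1 ?(eq_sym i0) ?(eq_sym i1) ?(negbTE a0) ?(negbTE a1) /=; field.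
have := affine_of_pd sh key x; rewrite /h !mxE !mul0r !mulr0 addr0 -!/(heis_tr g _) => e.
transitivity (dk g x 0 i2 + - 2^-1 * (dk g x 0 i0 * dk g x 0 i1) + 2^-1 * (x 0 i0 * x 0 i1)).
  by field.
by rewrite e; congr (_ + _); field.
Qed.

Definition heis_lin g : 'M[R]_n :=
  \matrix_(a, j) (if j == i2 then heis_central g a else q g a j).

Lemma heis_affine g x : sub_set H g ->
  heis_log (dk g x) = heis_log x *m heis_lin g + heis_log (dk g 0).
Proof.
move=> Hg; apply/rowP => j; rewrite !mxE.
have logE a : heis_log x 0 a = x 0 a - (a == i2)%:R * (x 0 i0 * x 0 i1 / 2) by rewrite mxE.
have [->|j2] := eqVneq j i2.
  rewrite /= !mul1r -!/(heis_tr g _).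
  have := heis_height x Hg.
  have -> : \sum_a heis_log x 0 a * heis_lin g a i2 = \sum_a x 0 a * heis_central g a - x 0 i0 * x 0 i1 / 2.
    transitivity (\sum_a (x 0 a * heis_central g a - (x 0 i0 * x 0 i1 / 2) * heis_central g a * (a == i2)%:R)).
      by apply: eq_bigr => a _; rewrite logE mxE eqxx; ring.
    rewrite sumrB sum_pick /heis_central eqxx.
    have n1 : i1 != i2 by rewrite ne.
    have n0 : i0 != i2 by rewrite ne.
    by rewrite (heis_rowI _ _ heis_I2 n1) (heis_rowI _ _ heis_I2 n0) /=; field.
  by set S := \sum_a _; lra.
rewrite /= !mul0r !subr0 heis_coord// addrC; congr (_ + _).
apply: eq_bigr => a _; rewrite logE mxE (negbTE j2).
have [->|a2] := eqVneq a i2; first by rewrite (heis_rowI _ _ heis_I2 j2) !mulr0.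
by rewrite /= mul0r subr0.
Qed.

Lemma heis_rot_le1 g a j : `|q g a j| <= 1.
Proof. by apply: le_trans (orth_norm_le1 (orth g 0)); exact: entry_le_norm. Qed.

Definition heis_chart : affine_chart H.
Proof.
refine (@AffineChart R X M H heis_log heis_exp heis_logK heis_expK heis_log_cont heis_exp_cont heis_lin
  (fun g => heis_log (dk g 0)) _ _).
  by move=> g x; exact: heis_affine.
move=> r; exists (1 + (r + n%:R * r)) => g y Hg yr gr.
have r0 : 0 <= r by apply: le_trans yr.
have trB j : (j == i0) || (j == i1) -> `|heis_tr g j| <= r + n%:R * r.
  move=> j01; have j2 : (j == i2) = false by case/orP: j01 => /eqP ->; rewrite ne.
  have -> : heis_tr g j = (y *m heis_lin g + heis_log (dk g 0)) 0 j - \sum_a y 0 a * q g a j.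
    rewrite !mxE j2 mul0r subr0 -/(heis_tr g j).
    rewrite (eq_bigr (fun a => y 0 a * q g a j)); first by ring.
    by move=> a _; rewrite mxE j2.
  apply: le_trans (ler_normB _ _) _; apply: lerD.
    exact: le_trans (entry_le_norm _ _ _) gr.
  apply: le_trans (ler_norm_sum _ _ _) _.
  apply: (@le_trans _ _ (\sum_(a < n) r)); last by rewrite sumr_const card_ord mulr_natl.
  apply: ler_sum => a _; rewrite normrM -[leRHS]mulr1; apply: ler_pM => //; last exact: heis_rot_le1.
  exact: le_trans (entry_le_norm _ _ _) yr.
have h0 : `|heis_tr g i0| <= r + n%:R * r by apply: trB; rewrite eqxx.
have h1 : `|heis_tr g i1| <= r + n%:R * r by apply: trB; rewrite eqxx orbT.
have rr : 0 <= r + n%:R * r by rewrite addr_ge0// mulr_ge0.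
apply: norm_le_entry => [|a j]; first by rewrite addr_ge0.
rewrite mxE; case: ifP => _; last by apply: le_trans (heis_rot_le1 _ _ _) _; rewrite lerDl.
rewrite /heis_central; apply: le_trans (ler_normD _ _) _; apply: lerD.
  by case: eqP => _; rewrite ?normr1 ?normr0.
have p0 : `|q g a i1 * heis_tr g i0| <= r + n%:R * r.
  by rewrite normrM -[leRHS]mul1r; apply: ler_pM => //; exact: heis_rot_le1.
have p1 : `|q g a i0 * heis_tr g i1| <= r + n%:R * r.
  by rewrite normrM -[leRHS]mul1r; apply: ler_pM => //; exact: heis_rot_le1.
rewrite normrM [X in _ * X]ger0_norm ?invr_ge0// ler_pdivrMr//.
apply: le_trans (ler_normB _ _) _; lra.
Defined.
Local Notation T := heis_chart.

Lemma heis_lin01 g (v : 'rV[R]_n) j : (j == i0) || (j == i1) ->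
  (v *m heis_lin g) 0 j = v 0 i0 * q g i0 j + v 0 i1 * q g i1 j.
Proof.
move=> j01; have j2 : (j == i2) = false by case/orP: j01 => /eqP ->; rewrite ne.
rewrite mxE (eq_bigr (fun a => v 0 a * q g a j)) => [|a _]; last by rewrite mxE j2.
rewrite (sum3 i012) => [|k k0 k1 k2].
  by rewrite (heis_rowI _ _ heis_I2) ?j2// mulr0 addr0.
have Ik : heis_I k by rewrite /heis_I k0.
rewrite (heis_rowI _ _ Ik) ?mulr0//.
by case/orP: j01 => /eqP ->; rewrite eq_sym.
Qed.

Lemma heis_lin_fiber g (v : 'rV[R]_n) : sub_set H g -> v 0 i0 = 0 -> v 0 i1 = 0 ->
  v *m heis_lin g = v.
Proof.
move=> Hg v0 v1; apply/rowP => j.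
have [j01|] := boolP ((j == i0) || (j == i1)).
  by rewrite heis_lin01// v0 v1 !mul0r addr0; case/orP: j01 => /eqP ->.
rewrite negb_or => Ij; have {}Ij : heis_I j by [].
rewrite mxE (bigD1 j)//= big1 ?addr0 => [|a aj].
  rewrite mxE; case: eqVneq => [e|_]; last by rewrite heis_QII// mulr1.
  have n1 : i1 != i2 by rewrite ne.
  have n0 : i0 != i2 by rewrite ne.
  by rewrite /heis_central e eqxx (heis_rowI _ _ heis_I2 n1) (heis_rowI _ _ heis_I2 n0) /= !mul0r subrr mul0r addr0 mulr1.
have [->|a0] := eqVneq a i0; first by rewrite v0 mul0r.
have [->|a1] := eqVneq a i1; first by rewrite v1 mul0r.
have Ia : heis_I a by rewrite /heis_I a0.
rewrite mxE; case: eqVneq => [e|_]; last by rewrite (heis_rowI _ _ Ia) ?mulr0// eq_sym.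
have r0 : q g a i0 = 0 by apply: heis_rowI => //; rewrite eq_sym.
have r1 : q g a i1 = 0 by apply: heis_rowI => //; rewrite eq_sym.
by rewrite /heis_central r0 r1 -e (negbTE aj) !mul0r subrr mul0r addr0 mulr0.
Qed.

(** The restriction of L g - 1 to the plane has determinant 2 (1 - q), where
    q is the cosine of the angle of rotation. *)
Lemma heis_fixed_plane g (v : 'rV[R]_n) : sub_set H g -> q g i0 i0 != 1 ->
  (v *m heis_lin g) 0 i0 = v 0 i0 -> (v *m heis_lin g) 0 i1 = v 0 i1 ->
  v 0 i0 = 0 /\ v 0 i1 = 0.
Proof.
move=> Hg q1; rewrite !heis_lin01 ?eqxx ?orbT//; have dt := heis_det Hg.
have row (i j : 'I_n) : (i == i0) || (i == i1) -> q g i i0 * q g j i0 + q g i i1 * q g j i1 = (i == j)%:R.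
  move=> i01; rewrite -(rot_sumr (orth g) i j 0) (sum3 i012) => [|k k0 k1 k2].
    have ni : i != i2 by case/orP: i01 => /eqP ->; rewrite ne.
    by rewrite (heis_colI _ _ heis_I2 ni) mul0r addr0.
  have Ik : heis_I k by rewrite /heis_I k0.
  rewrite (heis_colI _ _ Ik) ?mul0r//.
  by case/orP: i01 => /eqP ->; rewrite eq_sym.
have := row i0 i0; have := row i0 i1; rewrite !eqxx ne /= => /(_ isT) r2 /(_ isT) r1.
move: q1 dt r1 r2; move: (q g i0 i0) (q g i0 i1) (q g i1 i0) (q g i1 i1) (v 0 i0) (v 0 i1).
move=> a b c d x y a1 dt r1 r2 e1 e2.
have da : d = a.
  transitivity ((a * a + b * b) * d - b * (a * c + b * d)); first by rewrite r1 r2; ring.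
  transitivity (a * (a * d - b * c)); first by ring.
  by rewrite dt mulr1.
have a1' : 2 * (1 - a) != 0 by rewrite mulf_neq0// ?pnatr_eq0// subr_eq0 eq_sym.
have k0 : (a - 1) * (d - 1) - b * c = 2 * (1 - a).
  by rewrite da in dt *; transitivity (a * a - b * c + 1 - 2 * a); [ring|rewrite dt; ring].
have x0 : x * (2 * (1 - a)) = 0.
  by rewrite -k0; transitivity ((x * a + y * c - x) * (d - 1) - (x * b + y * d - y) * c); [ring|rewrite e1 e2; ring].
have y0 : y * (2 * (1 - a)) = 0.
  by rewrite -k0; transitivity ((x * b + y * d - y) * (a - 1) - (x * a + y * c - x) * b); [ring|rewrite e1 e2; ring].
split; apply/eqP.
  by move/eqP: x0; rewrite mulf_eq0 (negbTE a1') orbF.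
by move/eqP: y0; rewrite mulf_eq0 (negbTE a1') orbF.
Qed.

(** A fixed vector of an element that rotates the plane has no horizontal
    part, and such vectors are fixed by all of H. *)
Lemma heis_rotation_lattice a (B : subgrp (pi1 M)) : sub_set H a -> q a i0 i0 != 1 ->
  sub_set B `<=` sub_set H -> (forall b, sub_set B b -> (a * b = b * a)%g) ->
  lattice_like R (sub_set B).
Proof.
move=> Ha qa BH aB.
have fixE (v : 'rV[R]_n) : v *m (heis_lin a - 1%:M) = 0 -> v *m heis_lin a = v.
  by rewrite mulmxBr mulmx1 => /eqP; rewrite subr_eq0 => /eqP.
apply: (@centralizer_lattice _ _ _ _ T a B Ha BH aB) => [x|b v Bb /= va]; last first.
  have [v0 v1] : v 0 i0 = 0 /\ v 0 i1 = 0 by apply: (heis_fixed_plane Ha qa); rewrite va.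
  by apply: heis_lin_fiber => //; exact: BH.
rewrite /= -/(heis_lin a) => xKK; have yL := fixE _ xKK.
have [y0 y1] : (x *m (heis_lin a - 1%:M)) 0 i0 = 0 /\ (x *m (heis_lin a - 1%:M)) 0 i1 = 0.
  by apply: (heis_fixed_plane Ha qa); rewrite yL.
have cE j : (x *m (heis_lin a - 1%:M)) 0 j = (x *m heis_lin a) 0 j - x 0 j.
  by rewrite mulmxBr mulmx1 !mxDE mxNE.
rewrite !cE in y0 y1.
have [x0 x1] : x 0 i0 = 0 /\ x 0 i1 = 0.
  by apply: (heis_fixed_plane Ha qa); apply/eqP; rewrite -subr_eq0 ?y0 ?y1.
by rewrite mulmxBr mulmx1 heis_lin_fiber// subrr.
Qed.

Lemma heis_norotation g : sub_set H g -> q g i0 i0 = 1 ->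
  forall i j, (i == i0) || (i == i1) -> (j == i0) || (j == i1) -> q g i j = (i == j)%:R.
Proof.
move=> Hg q1; have dt := heis_det Hg.
have sq i : (i == i0) || (i == i1) -> q g i i0 ^+ 2 + q g i i1 ^+ 2 = 1.
  move=> i01; transitivity (\sum_m q g i m * q g i m); last by rewrite (rot_sumr (orth g)) eqxx.
  rewrite (sum3 i012) => [|k k0 k1 k2]; last first.
    have Ik : heis_I k by rewrite /heis_I k0.
    by rewrite (heis_colI _ _ Ik) ?mul0r//; case/orP: i01 => /eqP ->; rewrite eq_sym.
  have ni : i != i2 by case/orP: i01 => /eqP ->; rewrite ne.
  by rewrite (heis_colI _ _ heis_I2 ni) mul0r addr0 !expr2.
have b0 : q g i0 i1 = 0.
  have h : (i0 == i0) || (i0 == i1) by rewrite eqxx.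
  have := sq i0 h; rewrite q1 expr1n => e.
  by apply/eqP; rewrite -sqrf_eq0; apply/eqP; lra.
have d1 : q g i1 i1 = 1 by move: dt; rewrite q1 b0 mul1r mul0r subr0.
have c0 : q g i1 i0 = 0.
  have h : (i1 == i0) || (i1 == i1) by rewrite eqxx orbT.
  have := sq i1 h; rewrite d1 expr1n => e.
  by apply/eqP; rewrite -sqrf_eq0; apply/eqP; lra.
by move=> i j /orP[] /eqP -> /orP[] /eqP ->; rewrite ?eqxx ?ne.
Qed.

Lemma heis_lin_translation g i j : sub_set H g -> q g i0 i0 = 1 ->
  heis_lin g i j = (i == j)%:R + (j == i2)%:R *
    (((i == i0)%:R * - heis_tr g i1 + (i == i1)%:R * heis_tr g i0) / 2).
Proof.
move=> Hg q1; have nr := heis_norotation Hg q1.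
have o1 : (i1 == i0) || (i1 == i1) by rewrite eqxx orbT.
have o0 : (i0 == i0) || (i0 == i1) by rewrite eqxx.
rewrite mxE; case: eqVneq => [->|j2] /=.
  rewrite /heis_central mul1r; congr (_ + _ / _).
  have [->|n0] := eqVneq i i0; first by rewrite !nr// eqxx !ne /=; ring.
  have [->|n1] := eqVneq i i1; first by rewrite !nr// eqxx !ne /=; ring.
  have Ii : heis_I i by rewrite /heis_I n0.
  have r0 : q g i i0 = 0 by apply: heis_rowI => //; rewrite eq_sym.
  have r1 : q g i i1 = 0 by apply: heis_rowI => //; rewrite eq_sym.
  by rewrite r0 r1 /=; ring.
rewrite mul0r addr0; have [ij|ij] := eqVneq i j.
  rewrite -ij; have [i01|] := boolP ((i == i0) || (i == i1)); first by rewrite nr// eqxx.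
  by rewrite negb_or => Ii; rewrite heis_QII.
have [i01|] := boolP ((i == i0) || (i == i1)); last first.
  by rewrite negb_or => Ii; rewrite heis_rowI// eq_sym.
have [j01|] := boolP ((j == i0) || (j == i1)); first by rewrite nr// (negbTE ij).
by rewrite negb_or => Ij; rewrite heis_colI.
Qed.

Lemma heis_log_tr g j : j != i2 -> heis_log (dk g 0) 0 j = heis_tr g j.
Proof. by move=> /negbTE j2; rewrite mxE j2 mul0r subr0. Qed.

(** The central coordinate of the commutator of two elements without
    rotation is the area spanned by their horizontal parts. *)
Lemma heis_commute g h : sub_set H g -> sub_set H h -> q g i0 i0 = 1 -> q h i0 i0 = 1 ->
  (g * h = h * g)%g -> heis_tr g i0 * heis_tr h i1 = heis_tr g i1 * heis_tr h i0.
Proof.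
move=> Hg Hh qg qh gh; have n0 : i0 != i2 by rewrite ne.
have n1 : i1 != i2 by rewrite ne.
have E a b : sub_set H a -> sub_set H b -> q a i0 i0 = 1 ->
   tr T (a * b)%g 0 i2 = tr T b 0 i2 + (heis_tr b i1 * heis_tr a i0 - heis_tr b i0 * heis_tr a i1) / 2 + tr T a 0 i2.
  move=> Ha Hb qa; rewrite (trM T Ha Hb) mxDE; congr (_ + _).
  rewrite mxE (eq_bigr (fun j => tr T b 0 j * (j == i2)%:R + (tr T b 0 j * (j == i0)%:R * - heis_tr a i1
      + tr T b 0 j * (j == i1)%:R * heis_tr a i0) / 2)); last first.
    by move=> j _; rewrite [lin T]/= heis_lin_translation// eqxx /=; field.
  rewrite big_split /= sum_pick; congr (_ + _).
  rewrite -mulr_suml big_split /= -!mulr_suml !sum_pick (heis_log_tr b n0) (heis_log_tr b n1); by field.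
have := E g h Hg Hh qg; rewrite gh E//; lra.
Qed.

(** The remaining case is that neither A nor B contains a rotation and both
    contain elements, a and b, with nonzero horizontal parts. By
    [heis_commute] the horizontal parts of B are parallel to that of a,
    those of A to that of b, hence all of them are parallel to a; the
    functional u that vanishes on them is invariant. *)
Lemma heis_split : commuting_pairs_split R (pi1 M).
Proof.
exists H; split; first exact: oriented_cover.
move=> A B AH BH AB cAB.
have vl (C : subgrp (pi1 M)) : lattice_like R (sub_set C) -> virtually_lattice_like R C.
  by move=> lC; exists C; split=> //; exact: fcover_refl.
have [[a [Aa qa]]|nA] := pselect (exists a, sub_set A a /\ q a i0 i0 != 1).
  by right; apply/vl/(heis_rotation_lattice (AH _ Aa) qa BH) => b Bb; exact: AB.
have [[b [Bb qb]]|nB] := pselect (exists b, sub_set B b /\ q b i0 i0 != 1).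
  by left; apply/vl/(heis_rotation_lattice (BH _ Bb) qb AH) => a Aa; exact/esym/AB.
have qA a : sub_set A a -> q a i0 i0 = 1.
  by move=> Aa; apply/eqP/negPn/negP => qa; apply: nA; exists a.
have qB b : sub_set B b -> q b i0 i0 = 1.
  by move=> Bb; apply/eqP/negPn/negP => qb; apply: nB; exists b.
have central (C : subgrp (pi1 M)) : sub_set C `<=` sub_set H ->
    (forall c, sub_set C c -> q c i0 i0 = 1) ->
    ~ (exists c, sub_set C c /\ (heis_tr c i0, heis_tr c i1) != (0, 0)) -> lattice_like R (sub_set C).
  move=> CH qC nC; apply: (@orbit_lattice _ _ _ _ T C 0 CH) => x y Cx Cy.
  have -> : lin T x = 1%:M; last by rewrite mulmx1.
  have : (heis_tr x i0, heis_tr x i1) == (0, 0) by apply/negPn/negP => hx; apply: nC; exists x.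
  move=> /eqP[h0 h1]; apply/matrixP => i j.
  by rewrite [lin T]/= heis_lin_translation ?qC// ?h0 ?h1 ?mxE; [field|exact: CH].
have [[a [Aa wa]]|nA'] := pselect (exists a, sub_set A a /\ (heis_tr a i0, heis_tr a i1) != (0, 0)); last first.
  by left; apply/vl/central.
have [[b [Bb wb]]|nB'] := pselect (exists b, sub_set B b /\ (heis_tr b i0, heis_tr b i1) != (0, 0)); last first.
  by right; apply/vl/central.
exfalso; case/negP: wa.
have ab := heis_commute (AH _ Aa) (BH _ Bb) (qA _ Aa) (qB _ Bb) (AB _ _ Aa Bb).
pose u : 'cV[R]_n := \col_i ((i == i0)%:R * heis_tr a i1 - (i == i1)%:R * heis_tr a i0).
have u0 : u = 0.
  apply: (@no_invariant_functional _ _ _ _ T A B u AH BH cAB) => g gAB.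
  have Hg : sub_set H g by case: gAB => [/AH|/BH].
  have qg : q g i0 i0 = 1 by case: gAB => [/qA|/qB].
  have wu (v : 'rV[R]_n) : (v *m u) 0 0 = v 0 i0 * heis_tr a i1 - v 0 i1 * heis_tr a i0.
    rewrite mxE (eq_bigr (fun i => v 0 i * heis_tr a i1 * (i == i0)%:R - v 0 i * heis_tr a i0 * (i == i1)%:R)).
      by rewrite sumrB !sum_pick.
    by move=> i _; rewrite mxE; ring.
  split.
    apply/matrixP => i k; rewrite !ord1 -[LHS](_ : (row i (lin T g) *m u) 0 0 = _); last first.
      by rewrite -row_mul mxE.
    have rE j : row i (lin T g) 0 j = heis_lin g i j by rewrite mxE.
    rewrite wu !rE !heis_lin_translation// ![(_ == i2)]ne /= [RHS]mxE; ring.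
  apply/matrixP => i k; rewrite !ord1 wu !heis_log_tr ?ne// [RHS]mxE.
  case: gAB => [Ag|Bg]; last first.
    have := heis_commute (AH _ Aa) Hg (qA _ Aa) qg (AB _ _ Aa Bg).
    by move=> e; rewrite [X in X - _]mulrC -e mulrC subrr.
  have gb := heis_commute Hg (BH _ Bb) qg (qB _ Bb) (AB _ _ Ag Bb).
  move: ab gb wb; rewrite xpair_eqE negb_and.
  move: (heis_tr a i0) (heis_tr a i1) (heis_tr b i0) (heis_tr b i1) (heis_tr g i0) (heis_tr g i1) => a0 a1 b0 b1 g0 g1 ab gb.
  case/orP => [bn|bn].
    apply: (mulIf bn); rewrite mul0r.
    transitivity (g0 * (a1 * b0 - a0 * b1) - a0 * (g1 * b0 - g0 * b1)); first by ring.
    by rewrite ab gb !subrr !mulr0 subrr.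
  apply: (mulIf bn); rewrite mul0r.
  transitivity (a1 * (g0 * b1 - g1 * b0) - g1 * (a0 * b1 - a1 * b0)); first by ring.
  by rewrite ab gb !subrr !mulr0 subrr.
have /matrixP/(_ i0 0) := u0; have /matrixP/(_ i1 0) := u0.
rewrite !mxE !eqxx !ne /= !mul1r !mul0r subr0 sub0r => /eqP; rewrite oppr_eq0 => /eqP -> ->.
exact: eqxx.
Qed.

End HeisenbergManifold.

(** * Ricci tensors in dimension four *)

Section FourIndices.
Variables (R : realType) (n : nat) (i0 i1 i2 i3 : 'I_n).
Hypothesis i_uniq : uniq [:: i0; i1; i2; i3].
Hypothesis i_all : forall i, i \in [:: i0; i1; i2; i3].

Definition idx (i : 'I_n) : nat := index i [:: i0; i1; i2; i3].

Lemma idx_neq : [/\ i0 != i1, i0 != i2, i0 != i3, i1 != i2 & i1 != i3 /\ i2 != i3].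
Proof. by move: i_uniq; rewrite /= !inE !negb_or => /and4P[/and3P[-> -> ->] /andP[-> ->] -> _]. Qed.

Lemma idx0 : idx i0 = 0%N. Proof. by rewrite /idx /= eqxx. Qed.
Lemma idx1 : idx i1 = 1%N.
Proof. by have [/negbTE h _ _ _ _] := idx_neq; rewrite /idx /= h eqxx. Qed.
Lemma idx2 : idx i2 = 2%N.
Proof. by have [_ /negbTE h1 _ /negbTE h2 _] := idx_neq; rewrite /idx /= h1 h2 eqxx. Qed.
Lemma idx3 : idx i3 = 3%N.
Proof.
by have [_ _ /negbTE h1 _ [/negbTE h2 /negbTE h3]] := idx_neq; rewrite /idx /= h1 h2 h3 eqxx.
Qed.
Definition idxE := (idx0, idx1, idx2, idx3).

Lemma idx_eq i j : (i == j) = (idx i == idx j).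
Proof.
apply/eqP/eqP => [->//|/(congr1 (nth i0 [:: i0; i1; i2; i3]))].
by rewrite /idx !nth_index.
Qed.

Lemma case4 (P : 'I_n -> Prop) : P i0 -> P i1 -> P i2 -> P i3 -> forall i, P i.
Proof. by move=> p0 p1 p2 p3 i; have := i_all i; rewrite !inE => /or4P[] /eqP ->. Qed.

Lemma sum4 (g : 'I_n -> R) : \sum_i g i = g i0 + g i1 + g i2 + g i3.
Proof.
have -> : \sum_i g i = \sum_(i <- [:: i0; i1; i2; i3]) g i.
  rewrite -big_enum; apply: perm_big; apply: uniq_perm => //; first exact: enum_uniq.
  by move=> i; rewrite mem_enum i_all.
by rewrite !big_cons big_nil addr0 !addrA.
Qed.

(** A matrix whose entries depend on the positions of the indices in the
    list i0, i1, i2, i3; with literal positions, identities between entries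
    hold by computation. *)
Definition table (t : nat -> nat -> R) : 'M[R]_n := \matrix_(i, j) t (idx i) (idx j).

Lemma RicE (F : frame R n) (bk : nat -> nat -> nat -> R) (ric : nat -> R) :
  (forall k l m, brk F k l m = bk (idx k) (idx l) (idx m)) ->
  (forall l j, (l < 4)%N -> (j < 4)%N ->
    let om k i j := (bk k i j - bk i j k + bk j k i) / 2 in
    let s4 g := g 0%N + g 1%N + g 2%N + g 3%N in
    s4 (fun k => s4 (fun m => om l k m * om k m j) - s4 (fun m => om k k m * om l m j)
       - s4 (fun m => bk k l m * om m k j)) = if l == j then ric l else 0) ->
  Ric F = diag_mx (\row_i ric (idx i)).
Proof.
move=> bE rE; apply/matrixP => l j; rewrite !mxE.
have lt4 i : (idx i < 4)%N by rewrite /idx -[4%N]/(size [:: i0; i1; i2; i3]) index_mem.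
have omE k i j' : om F k i j' = (bk (idx k) (idx i) (idx j') - bk (idx i) (idx j') (idx k)
   + bk (idx j') (idx k) (idx i)) / 2 by rewrite /om !bE.
have RmE k : Rm F k l k j =
    (\sum_m om F l k m * om F k m j) - (\sum_m om F k k m * om F l m j)
    - \sum_m brk F k l m * om F m k j.
  rewrite /Rm !mxE summxE; congr (_ - _ - _); apply: eq_bigr => m _; by rewrite !mxE.
rewrite idx_eq mulrb -[RHS]rE//.
rewrite sum4 !RmE !sum4 !omE !bE !idxE.
by [].
Qed.

End FourIndices.

Definition nil4_bk (R : realType) (k l m : nat) : R :=
  match k, l, m with
  | 3, 1, 0 => 1%R | 1, 3, 0 => (-1)%R | 3, 2, 1 => 1%R | 2, 3, 1 => (-1)%R | _, _, _ => 0%R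
  end%N.

Definition nil4_tab (R : realType) (t : R) (i j : nat) : R :=
  match i, j with
  | 0, 0 | 1, 1 | 2, 2 | 3, 3 => 1%R
  | 1, 0 | 2, 1 => t
  | 2, 0 => (t ^+ 2 / 2)%R
  | _, _ => 0%R
  end%N.

Definition sol41_bk (R : realType) (k l m : nat) : R :=
  match k, l, m with
  | 3, 0, 0 => (-1)%R | 0, 3, 0 => 1%R | 3, 1, 1 => 1%R | 1, 3, 1 => (-1)%R
  | 0, 1, 2 => 1%R | 1, 0, 2 => (-1)%R | _, _, _ => 0%R
  end%N.

Lemma nil4_ric (R : realType) l j : (l < 4)%N -> (j < 4)%N ->
    let bk := nil4_bk R in
    let om k i j := (bk k i j - bk i j k + bk j k i) / 2 in
    let s4 g := g 0%N + g 1%N + g 2%N + g 3%N in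
    s4 (fun k => s4 (fun m => om l k m * om k m j) - s4 (fun m => om k k m * om l m j)
       - s4 (fun m => bk k l m * om m k j)) =
    if l == j then nth 0 [:: - 2^-1; 0; 2^-1; 1] l else 0.
Proof.
case: l => [|[|[|[|//]]]] _; case: j => [|[|[|[|//]]]] _ /=; lazy beta zeta iota delta [nil4_bk]; by field.
Qed.

Lemma sol41_ric (R : realType) l j : (l < 4)%N -> (j < 4)%N ->
    let bk := sol41_bk R in
    let om k i j := (bk k i j - bk i j k + bk j k i) / 2 in
    let s4 g := g 0%N + g 1%N + g 2%N + g 3%N in
    s4 (fun k => s4 (fun m => om l k m * om k m j) - s4 (fun m => om k k m * om l m j)
       - s4 (fun m => bk k l m * om m k j)) =
    if l == j then nth 0 [:: 2^-1; 2^-1; - 2^-1; 2] l else 0.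
Proof.
case: l => [|[|[|[|//]]]] _; case: j => [|[|[|[|//]]]] _ /=; lazy beta zeta iota delta [sol41_bk]; by field.
Qed.

(** * The geometry of Nil^4 *)

Section Nil4Frame.
Variables (R : realType) (n : nat) (i0 i1 i2 i3 : 'I_n).
Hypothesis i_uniq : uniq [:: i0; i1; i2; i3].
Hypothesis i_all : forall i, i \in [:: i0; i1; i2; i3].
Local Notation tb := (table i0 i1 i2 i3).
Local Notation id4 := (idxE i_uniq).

Definition nil4_mx (t : R) : 'M[R]_n := tb (nil4_tab t).

Lemma nil4_mxE t i j : nil4_mx t i j = nil4_tab t (idx i0 i1 i2 i3 i) (idx i0 i1 i2 i3 j).
Proof. by rewrite mxE. Qed.

Lemma nil4_mx_add s t : nil4_mx s *m nil4_mx t = nil4_mx (s + t).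
Proof.
apply/matrixP; apply: (case4 i_all); apply: (case4 i_all); rewrite !mxE (sum4 i_uniq i_all) !mxE !id4 /=; by field.
Qed.

Lemma nil4_mx0 : nil4_mx 0 = 1%:M.
Proof.
apply/matrixP; apply: (case4 i_all); apply: (case4 i_all);
  rewrite !mxE (idx_eq i_all) !id4 /= ?expr0n ?mul0r //.
Qed.

Lemma nil4_entry_smooth (f : 'rV[R]_n -> R) a b : smooth f -> smooth (fun x => nil4_tab (f x) a b).
Proof.
move=> sf; case: a => [|[|[|[|a]]]]; case: b => [|[|[|[|b]]]] /=;
  first [exact: smooth_cst | exact: sf | apply: smooth_mul; [exact: smooth_mul|exact: smooth_cst]].
Qed.

Definition nil4_dtab (t : R) (i j : nat) : R :=
  (if (i, j) == (2, 0)%N then t else if ((i, j) == (1, 0)%N) || ((i, j) == (2, 1)%N) then 1 else 0).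

Lemma nil4_pd (a : 'I_n) p q x :
  pd a (fun y => nil4_tab (y 0 i3) p q) x = (a == i3)%:R * nil4_dtab (x 0 i3) p q.
Proof.
have c0 (c : R) : pd a (fun=> c) x = 0 by rewrite /pd derive_cst.
have ct : pd a (fun y : 'rV[R]_n => y 0 i3) x = (a == i3)%:R.
  by rewrite /pd derive_coord_id mxE eqxx eq_sym.
have ctt : pd a (fun y : 'rV[R]_n => y 0 i3 ^+ 2 / 2) x = (a == i3)%:R * x 0 i3.
  have sc : smooth (fun y : 'rV[R]_n => y 0 i3) by exact: smooth_coord.
  rewrite /pd (@deriveM_real _ _ (fun y : 'rV[R]_n => y 0 i3 * y 0 i3) (fun=> 2^-1)); last 2 first.
  - exact/smooth_diff/smooth_mul.
  - exact: differentiable_cst.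
  rewrite derive_cst mulr0 addr0 deriveM_real; [|exact: smooth_diff|exact: smooth_diff].
  by rewrite derive_coord_id mxE eqxx eq_sym /=; field.
case: p => [|[|[|[|p]]]]; case: q => [|[|[|[|q]]]] /=;
  rewrite ?c0 ?ct ?ctt /nil4_dtab /= ?mulr0 ?mulr1 //.
Qed.

Definition nil4_frame : frame R n.
Proof.
refine (@Frame R n (fun x => nil4_mx (x 0 i3)) (fun x => nil4_mx (- x 0 i3))
  (fun k l m => nil4_bk R (idx i0 i1 i2 i3 k) (idx i0 i1 i2 i3 l) (idx i0 i1 i2 i3 m)) _ _ _ _ _).
- by move=> x; rewrite nil4_mx_add subrr nil4_mx0.
- move=> f sf i j; have -> : (fun x => nil4_mx (f x 0 i3) i j) = (fun x => nil4_tab (f x 0 i3) (idx i0 i1 i2 i3 i) (idx i0 i1 i2 i3 j)).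
    by apply/funext => x; rewrite mxE.
  exact: nil4_entry_smooth.
- move=> f sf i j; have -> : (fun x => nil4_mx (- f x 0 i3) i j) = (fun x => nil4_tab (- f x 0 i3) (idx i0 i1 i2 i3 i) (idx i0 i1 i2 i3 j)).
    by apply/funext => x; rewrite mxE.
  by apply: nil4_entry_smooth; exact: smooth_opp.
- apply: (case4 i_all); apply: (case4 i_all); apply: (case4 i_all); rewrite !id4 /= ?oppr0 ?opprK //.
- have pdE x a l b : pd a (fun y => nil4_mx (y 0 i3) l b) x =
     (a == i3)%:R * nil4_dtab (x 0 i3) (idx i0 i1 i2 i3 l) (idx i0 i1 i2 i3 b).
    rewrite -nil4_pd; congr (pd _ _ _); apply/funext => y; by rewrite mxE.
  move=> x k l b.
  have sE k' l' b' : \sum_a nil4_mx (x 0 i3) k' a * pd a (fun y => nil4_mx (y 0 i3) l' b') x =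
     nil4_mx (x 0 i3) k' i3 * nil4_dtab (x 0 i3) (idx i0 i1 i2 i3 l') (idx i0 i1 i2 i3 b').
    transitivity (\sum_a (nil4_mx (x 0 i3) k' a * nil4_dtab (x 0 i3) (idx i0 i1 i2 i3 l') (idx i0 i1 i2 i3 b')) * (a == i3)%:R).
      by apply: eq_bigr => a _; rewrite pdE; ring.
    by rewrite sum_pick.
  rewrite !sE (sum4 i_uniq i_all) !mxE; move: k l b; apply: (case4 i_all); apply: (case4 i_all); apply: (case4 i_all);
    rewrite !id4 /nil4_dtab /=; by ring.
Defined.

Lemma nil4_Ric : Ric nil4_frame =
  diag_mx (\row_i nth 0 [:: - 2^-1; 0; 2^-1; 1] (idx i0 i1 i2 i3 i)).
Proof. by apply: (RicE i_uniq i_all (bk := nil4_bk R)) => // l j l4 j4; exact: nil4_ric. Qed.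

End Nil4Frame.

Section Nil4Manifold.
Variables (R : realType) (X : lie_model R).
Local Notation n := (gdim X).
Variables (i0 i1 i2 i3 : 'I_n).
Hypothesis i_uniq : uniq [:: i0; i1; i2; i3].
Hypothesis i_all : forall i, i \in [:: i0; i1; i2; i3].
Local Notation F := (nil4_frame R i_uniq i_all).
Hypothesis Flink : left_invariant F.
Variable M : closed_manifold X.
Local Notation dk := (deck M).
Local Notation Q g x := (frot F (dk g) x).
Local Notation id4 := (idxE i_uniq).
Local Notation mx := (nil4_mx i0 i1 i2 i3).

Let sm g b : smooth (fun x => dk g x 0 b).
Proof. exact: (isom_smooth (deck_isometry g)). Qed.

(** The four eigenvalues of [Ric] are distinct. *)
Lemma nil4_rowI g x i j : predT i -> j != i -> Q g x i j = 0.
Proof.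
move=> _ ji; apply: (Ric_diag_rot0 Flink x (deck_isometry g) (nil4_Ric R i_uniq i_all)).
move: i j ji; apply: (case4 i_all); apply: (case4 i_all); rewrite (idx_eq i_all) !id4 //= => _;
  by apply/eqP; lra.
Qed.

Definition nil4_oriented := oriented Flink nil4_rowI.
Local Notation H := nil4_oriented.

Lemma nil4_rot g x : sub_set H g -> Q g x = 1%:M.
Proof.
move=> Hg; apply/matrixP => i j; rewrite mxE; have [<-|ij] := eqVneq i j.
  exact: (@orientedE _ _ _ Flink M predT nil4_rowI g x i Hg isT).
by rewrite nil4_rowI// eq_sym.
Qed.

Definition nil4_shift g : R := dk g 0 0 i3.

Lemma nil4_pd_coord g a j x : sub_set H g ->
  pd a (fun y => dk g y 0 j) x = (mx (- x 0 i3) *m mx (dk g x 0 i3)) a j.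
Proof.
move=> Hg; rewrite (pd_fD F) mxE; apply: eq_bigr => k _; congr (_ * _).
rewrite fD_coord nil4_rot//.
transitivity (\sum_l mx (dk g x 0 i3) l j * (l == k)%:R); last exact: sum_pick.
by apply: eq_bigr => l _; rewrite mxE eq_sym mulrC.
Qed.

Lemma nil4_height g x : sub_set H g -> dk g x 0 i3 = x 0 i3 + nil4_shift g.
Proof.
move=> Hg; rewrite (@affine_of_pd _ _ (fun y => dk g y 0 i3) (fun a => (a == i3)%:R) (sm g i3)).
  by rewrite sum_pick addrC.
move=> a y; rewrite nil4_pd_coord// (nil4_mx_add i_uniq i_all) nil4_mxE (idx_eq i_all).
by move: a; apply: (case4 i_all); rewrite !id4.
Qed.

Lemma nil4_affine g x : sub_set H g -> dk g x = x *m mx (nil4_shift g) + dk g 0.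
Proof.
move=> Hg; apply/rowP => j.
rewrite (@affine_of_pd _ _ (fun y => dk g y 0 j) (fun a => mx (nil4_shift g) a j) (sm g j)).
  by rewrite addrC mxDE mxE.
by move=> a y; rewrite nil4_pd_coord// nil4_height// (nil4_mx_add i_uniq i_all) addrA addNr add0r.
Qed.

Definition nil4_chart : affine_chart H.
Proof.
refine (@AffineChart R X M H id id _ _ _ _ (fun g => mx (nil4_shift g)) (fun g => dk g 0) _ _) => //.
- by move=> x; exact: cvg_id.
- by move=> x; exact: cvg_id.
- by move=> g x; exact: nil4_affine.
move=> r; exists (1 + (r + r) + (r + r) ^+ 2) => g y Hg yr.
rewrite -nil4_affine// => gr.
have cr : `|nil4_shift g| <= r + r.
  have -> : nil4_shift g = dk g y 0 i3 - y 0 i3 by rewrite nil4_height// [_ + nil4_shift g]addrC addrK.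
  apply: le_trans (ler_normB _ _) _; apply: lerD.
    exact: le_trans (entry_le_norm _ _ _) gr.
  exact: le_trans (entry_le_norm _ _ _) yr.
have r0 : 0 <= r + r by apply: le_trans cr.
have rr : 0 <= (r + r) ^+ 2 by exact: sqr_ge0.
have c2 : `|nil4_shift g ^+ 2 / 2| <= (r + r) ^+ 2.
  rewrite normrM normrX [X in _ * X]ger0_norm// ler_pdivrMr//.
  have : `|nil4_shift g| ^+ 2 <= (r + r) ^+ 2 by rewrite lerXn2r// nnegrE.
  by lra.
apply: norm_le_entry => [|]; first by apply: addr_ge0 => //; apply: addr_ge0.
by apply: (case4 i_all); apply: (case4 i_all); rewrite nil4_mxE !id4 /= ?normr1 ?normr0; lra.
Defined.
Local Notation T := nil4_chart.

(** A cubic curve with parameter v_0, swept by the direction i0. With the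
    constants kap and mu determined by an element a that changes the height,
    it contains the images of the origin under all elements commuting with a
    ([nil4_tr_commute]), and these act on it as translations of the
    parameters. *)
Definition nil4_orbit (kap mu : R) (v : 'rV[R]_2) : 'rV[R]_n :=
  \row_j nth 0 [:: v 0 1 + kap * v 0 0 ^+ 3 / 6 + mu * v 0 0 ^+ 2 / 2;
    kap * v 0 0 ^+ 2 / 2 + mu * v 0 0; kap * v 0 0; v 0 0] (idx i0 i1 i2 i3 j).

(** Compare the coordinates i0 and i1 of the translation parts of a b and b
    a, and solve for those of b. *)
Lemma nil4_tr_commute a b : sub_set H a -> sub_set H b -> (a * b = b * a)%g -> nil4_shift a != 0 ->
  let kap := dk a 0 0 i2 / nil4_shift a in
  let mu := dk a 0 0 i1 / nil4_shift a - kap * nil4_shift a / 2 in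
  dk b 0 0 i2 = kap * nil4_shift b /\ dk b 0 0 i1 = kap * nil4_shift b ^+ 2 / 2 + mu * nil4_shift b.
Proof.
move=> Ha Hb ab c0 kap mu.
have := trM T Ha Hb; rewrite ab (trM T Hb Ha) /= => e.
have := congr1 (fun v : 'rV[R]_n => v 0 i1) e; have := congr1 (fun v : 'rV[R]_n => v 0 i0) e.
rewrite !mxDE ![(_ *m _) _ _]mxE !(sum4 i_uniq i_all) !nil4_mxE !id4 /=.
rewrite -!/(nil4_shift _) /mu /kap.
move: (nil4_shift a) (nil4_shift b) (dk a 0 0 i0) (dk a 0 0 i1) (dk a 0 0 i2) (dk b 0 0 i0) (dk b 0 0 i1) (dk b 0 0 i2) c0.
move=> c d a0 a1 a2 b0 b1 b2 c0 e0 e1.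
have h2 : b2 = a2 / c * d.
  by apply: (mulIf c0); transitivity (a2 * d); [lra|field].
split=> //; apply: (mulIf c0).
transitivity (d * a1 + d ^+ 2 / 2 * a2 - c ^+ 2 / 2 * b2); first by lra.
by rewrite h2; field.
Qed.

(** The linear part of a is unipotent, so the centralizer of a is not
    covered by [centralizer_lattice]; it acts by translations on the
    parameters of [nil4_orbit]. *)
Lemma nil4_split : commuting_pairs_split R (pi1 M).
Proof.
apply: (@split_by_height _ _ _ _ T (delta_mx i3 0)).
- exact: oriented_cover.
- by apply/eqP => /matrixP/(_ i3 0); rewrite !mxE !eqxx => /eqP; rewrite oner_eq0.
- move=> g Hg; apply/colP => i; rewrite -colE [LHS]mxE nil4_mxE mxE andbT (idx_eq i_all).
  by move: i; apply: (case4 i_all); rewrite !id4.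
move=> a B Ha ca BH aB; have c0 : nil4_shift a != 0.
  apply: contra ca => /eqP c0; apply/eqP/matrixP => i j; rewrite !ord1 -colE !mxE.
  exact: c0.
pose kap := dk a 0 0 i2 / nil4_shift a.
pose mu := dk a 0 0 i1 / nil4_shift a - kap * nil4_shift a / 2.
pose tau b : 'rV[R]_2 := \row_j (if j == 0 then nil4_shift b
  else dk b 0 0 i0 - kap * nil4_shift b ^+ 3 / 6 - mu * nil4_shift b ^+ 2 / 2).
have cen b : sub_set B b -> dk b 0 0 i2 = kap * nil4_shift b /\
    dk b 0 0 i1 = kap * nil4_shift b ^+ 2 / 2 + mu * nil4_shift b.
  by move=> Bb; apply: nil4_tr_commute => //; [exact: BH|exact: aB].
have t0 b : tau b 0 0 = nil4_shift b by rewrite mxE.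
have t1 b : tau b 0 1 = dk b 0 0 i0 - kap * nil4_shift b ^+ 3 / 6 - mu * nil4_shift b ^+ 2 / 2.
  by rewrite mxE.
apply: (@lattice_like_of_orbit _ _ _ _ T B 2 tau (nil4_orbit kap mu) BH).
- apply: continuous_rows => j.
  have -> : (fun v : 'rV[R]_2 => nil4_orbit kap mu v 0 j) = (fun v : 'rV[R]_2 => nth 0 [:: v 0 1 + kap * v 0 0 ^+ 3 / 6 + mu * v 0 0 ^+ 2 / 2;
    kap * v 0 0 ^+ 2 / 2 + mu * v 0 0; kap * v 0 0; v 0 0] (idx i0 i1 i2 i3 j)).
    by apply/funext => v; rewrite mxE.
  have s0 : smooth (fun v : 'rV[R]_2 => v 0 0) by exact: smooth_coord.
  have s1 : smooth (fun v : 'rV[R]_2 => v 0 1) by exact: smooth_coord.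
  have sc (c : R) : smooth (fun v : 'rV[R]_2 => c) by exact: smooth_cst.
  have s2 : smooth (fun v : 'rV[R]_2 => v 0 0 ^+ 2) by exact: smooth_mul.
  have s3 : smooth (fun v : 'rV[R]_2 => v 0 0 ^+ 3) by apply: smooth_mul.
  by move: j; apply: (case4 i_all); rewrite !id4 /=; repeat (first [done | apply: smooth_add | apply: smooth_mul]).
- move=> x y Bx By; have Hx := BH _ Bx; have Hy := BH _ By.
  have := trM T Hx Hy => /= e.
  have sh : nil4_shift (x * y)%g = nil4_shift x + nil4_shift y.
    have := congr1 (fun v : 'rV[R]_n => v 0 i3) e.
    rewrite !mxDE ![(_ *m _) _ _]mxE !(sum4 i_uniq i_all) !nil4_mxE !id4 /= -!/(nil4_shift _) => ->; ring.
  have [y2 y1] := cen y By.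
  have e0 := congr1 (fun v : 'rV[R]_n => v 0 i0) e.
  rewrite !mxDE ![(_ *m _) _ _]mxE !(sum4 i_uniq i_all) !nil4_mxE !id4 /= y2 y1 in e0.
  apply/rowP => j; rewrite mxDE; have [->|j0] := eqVneq j 0; first by rewrite !t0 sh addrC.
  have -> : j = 1 by apply/val_inj; case: j j0 => -[|[|]].
  by rewrite !t1 sh e0; field.
- move=> x Bx; have [x2 x1] := cen x Bx.
  have o0 : nil4_orbit kap mu 0 = 0.
    apply/rowP => j; rewrite !mxE; move: j; apply: (case4 i_all);
      by rewrite !id4 /= ?expr0n /= ?mulr0 ?mul0r ?addr0 ?mulr0 ?mul0r.
  rewrite o0 -tr0; apply/rowP => j; rewrite [RHS]mxE t0 t1; move: j.
  apply: (case4 i_all); rewrite !id4 /= ?x2 ?x1//; by field.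
Qed.

End Nil4Manifold.

(** * The geometry of Sol^4_1 *)

Section Sol41Frame.
Variables (R : realType) (n : nat) (i0 i1 i2 i3 : 'I_n).
Hypothesis i_uniq : uniq [:: i0; i1; i2; i3].
Hypothesis i_all : forall i, i \in [:: i0; i1; i2; i3].
Local Notation tb := (table i0 i1 i2 i3).
Local Notation ix := (idx i0 i1 i2 i3).
Local Notation id4 := (idxE i_uniq).

Definition sol41_tab (x t : R) (i j : nat) : R :=
  match i, j with
  | 0, 0 => expR (- t) | 1, 1 => expR t | 2, 2 => 1%R | 3, 3 => 1%R
  | 1, 2 => (expR t * x)%R | _, _ => 0%R
  end%N.

Definition sol41_itab (x t : R) (i j : nat) : R :=
  match i, j with
  | 0, 0 => expR t | 1, 1 => expR (- t) | 2, 2 => 1%R | 3, 3 => 1%R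
  | 1, 2 => (- x)%R | _, _ => 0%R
  end%N.

Definition sol41_mx (x : 'rV[R]_n) : 'M[R]_n := tb (sol41_tab (x 0 i0) (x 0 i3)).
Definition sol41_imx (x : 'rV[R]_n) : 'M[R]_n := tb (sol41_itab (x 0 i0) (x 0 i3)).

Lemma sol41_mxE x i j : sol41_mx x i j = sol41_tab (x 0 i0) (x 0 i3) (ix i) (ix j).
Proof. by rewrite mxE. Qed.

Lemma sol41_imxE x i j : sol41_imx x i j = sol41_itab (x 0 i0) (x 0 i3) (ix i) (ix j).
Proof. by rewrite mxE. Qed.

Lemma sol41_mxV x : sol41_mx x *m sol41_imx x = 1%:M.
Proof.
have e1 (t : R) : expR (- t) * expR t = 1 by rewrite -expRD addNr expR0.
have e2 (t : R) : expR t * expR (- t) = 1 by rewrite -expRD subrr expR0.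
apply/matrixP; apply: (case4 i_all); apply: (case4 i_all);
  rewrite [LHS]mxE (sum4 i_uniq i_all) !sol41_mxE !sol41_imxE [RHS]mxE (idx_eq i_all) !id4 /=
    !(mul0r, mulr0, add0r, addr0, mul1r, mulr1); first [done|exact: e1|exact: e2|ring].
Qed.

Lemma sol41_tab_smooth (f g : 'rV[R]_n -> R) a b : smooth f -> smooth g ->
  smooth (fun x => sol41_tab (f x) (g x) a b).
Proof.
move=> sf sg; case: a => [|[|[|[|a]]]]; case: b => [|[|[|[|b]]]] /=;
  repeat (first [exact: smooth_cst | done | apply: smooth_mul | apply: smooth_exp | apply: smooth_opp]).
Qed.

Lemma sol41_itab_smooth (f g : 'rV[R]_n -> R) a b : smooth f -> smooth g ->
  smooth (fun x => sol41_itab (f x) (g x) a b).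
Proof.
move=> sf sg; case: a => [|[|[|[|a]]]]; case: b => [|[|[|[|b]]]] /=;
  repeat (first [exact: smooth_cst | done | apply: smooth_mul | apply: smooth_exp | apply: smooth_opp]).
Qed.

Definition sol41_dtab (c0 c3 x t : R) (i j : nat) : R :=
  match i, j with
  | 0, 0 => (- c3 * expR (- t))%R | 1, 1 => (c3 * expR t)%R
  | 1, 2 => (c3 * expR t * x + c0 * expR t)%R | _, _ => 0%R
  end%N.

Lemma sol41_pd (a : 'I_n) p q x :
  pd a (fun y => sol41_tab (y 0 i0) (y 0 i3) p q) x =
  sol41_dtab (a == i0)%:R (a == i3)%:R (x 0 i0) (x 0 i3) p q.
Proof.
have c0 (c : R) : pd a (fun=> c) x = 0 by rewrite /pd derive_cst.
have pc b : 'D_(delta_mx 0 a) (fun y : 'rV[R]_n => y 0 b) x = (a == b)%:R.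
  by rewrite derive_coord_id mxE eqxx eq_sym.
have sc b : smooth (fun y : 'rV[R]_n => y 0 b) by exact: smooth_coord.
have ce : 'D_(delta_mx 0 a) (fun y : 'rV[R]_n => expR (y 0 i3)) x = (a == i3)%:R * expR (x 0 i3).
  by rewrite derive_expR_comp ?pc 1?mulrC//; exact: smooth_diff.
have ceN : pd a (fun y : 'rV[R]_n => expR (- y 0 i3)) x = - (a == i3)%:R * expR (- x 0 i3).
  rewrite /pd derive_expR_comp; last exact/smooth_diff/smooth_opp.
  by rewrite deriveN_real ?pc 1?mulrC//; exact: smooth_diff.
have cex : pd a (fun y : 'rV[R]_n => expR (y 0 i3) * y 0 i0) x =
    (a == i3)%:R * expR (x 0 i3) * x 0 i0 + (a == i0)%:R * expR (x 0 i3).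
  rewrite /pd deriveM_real; [|exact/smooth_diff/smooth_exp|exact: smooth_diff].
  by rewrite ce pc; congr (_ + _); rewrite mulrC.
case: p => [|[|[|[|p]]]]; case: q => [|[|[|[|q]]]] //=.
Qed.

Definition sol41_frame : frame R n.
Proof.
refine (@Frame R n sol41_mx sol41_imx (fun k l m => sol41_bk R (ix k) (ix l) (ix m)) _ _ _ _ _).
- exact: sol41_mxV.
- move=> f sf i j; have -> : (fun x => sol41_mx (f x) i j) = (fun x => sol41_tab (f x 0 i0) (f x 0 i3) (ix i) (ix j)).
    by apply/funext => x; rewrite sol41_mxE.
  exact: sol41_tab_smooth.
- move=> f sf i j; have -> : (fun x => sol41_imx (f x) i j) = (fun x => sol41_itab (f x 0 i0) (f x 0 i3) (ix i) (ix j)).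
    by apply/funext => x; rewrite sol41_imxE.
  exact: sol41_itab_smooth.
- apply: (case4 i_all); apply: (case4 i_all); apply: (case4 i_all); rewrite !id4 /= ?oppr0 ?opprK //.
- have pdE x a l b : pd a (fun y => sol41_mx y l b) x =
     sol41_dtab (a == i0)%:R (a == i3)%:R (x 0 i0) (x 0 i3) (ix l) (ix b).
    rewrite -sol41_pd; have -> : (fun y => sol41_mx y l b) = (fun y => sol41_tab (y 0 i0) (y 0 i3) (ix l) (ix b)) by apply/funext => y; rewrite sol41_mxE.
    by [].
  move=> x k l b; under eq_bigr do rewrite pdE.
  under [X in _ - X]eq_bigr do rewrite pdE.
  rewrite !(sum4 i_uniq i_all) !sol41_mxE !(idx_eq i_all).
  have e1 (t : R) : expR (- t) * expR t = 1 by rewrite -expRD addNr expR0.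
  have e2 (t : R) : expR t * expR (- t) = 1 by rewrite -expRD subrr expR0.
  move: k l b; apply: (case4 i_all); apply: (case4 i_all); apply: (case4 i_all);
    rewrite !id4 /= ?opprD ?expRD; try (by ring).
  + by transitivity (expR (- x 0 i3) * expR (x 0 i3)); [ring|rewrite e1; ring].
  + by transitivity (- (expR (- x 0 i3) * expR (x 0 i3))); [ring|rewrite e1; ring].
Defined.

Lemma sol41_Ric : Ric sol41_frame =
  diag_mx (\row_i nth 0 [:: 2^-1; 2^-1; - 2^-1; 2] (ix i)).
Proof. by apply: (RicE i_uniq i_all (bk := sol41_bk R)) => // l j l4 j4; exact: sol41_ric. Qed.

End Sol41Frame.

Section Sol41Manifold.
Variables (R : realType) (X : lie_model R).
Local Notation n := (gdim X).
Variables (i0 i1 i2 i3 : 'I_n).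
Hypothesis i_uniq : uniq [:: i0; i1; i2; i3].
Hypothesis i_all : forall i, i \in [:: i0; i1; i2; i3].
Local Notation F := (sol41_frame R i_uniq i_all).
Hypothesis Flink : left_invariant F.
Variable M : closed_manifold X.
Local Notation dk := (deck M).
Local Notation Q g x := (frot F (dk g) x).
Local Notation id4 := (idxE i_uniq).
Local Notation ix := (idx i0 i1 i2 i3).

Let sm g b : smooth (fun x => dk g x 0 b).
Proof. exact: (isom_smooth (deck_isometry g)). Qed.
Let df g x : differentiable (dk g) x.
Proof. exact: (isom_diff (deck_isometry g)). Qed.
Let orth g x : Q g x *m (Q g x)^T = 1%:M.
Proof. exact: (isom_rot_orth Flink (deck_isometry g)). Qed.

Definition sol41_I : pred 'I_n := fun i => (ix i == 2)%N || (ix i == 3)%N.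

(** The eigenvalues of [Ric] are 1/2 on the plane spanned by i0 and i1, -
    1/2 on the center i2, and 2 on i3. *)
Lemma sol41_rowI g x i j : sol41_I i -> j != i -> Q g x i j = 0.
Proof.
move=> Ii ji; apply: (Ric_diag_rot0 Flink x (deck_isometry g) (sol41_Ric R i_uniq i_all)).
move: i j Ii ji; apply: (case4 i_all); apply: (case4 i_all); rewrite /sol41_I (idx_eq i_all) !id4 //= => _ _;
  by apply/eqP; lra.
Qed.

Lemma sol41_colI g x i j : sol41_I i -> j != i -> Q g x j i = 0.
Proof. by move=> Ii ji; apply: (rot_col0 Flink (deck_isometry g)) => // y k; exact: sol41_rowI. Qed.

Definition sol41_oriented := oriented Flink sol41_rowI.
Local Notation H := sol41_oriented.

Lemma sol41_QII g x i : sub_set H g -> sol41_I i -> Q g x i i = 1.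
Proof. exact: (@orientedE _ _ _ Flink M sol41_I sol41_rowI g x i). Qed.

Lemma sol41_I2 : sol41_I i2. Proof. by rewrite /sol41_I !id4. Qed.
Lemma sol41_I3 : sol41_I i3. Proof. by rewrite /sol41_I !id4. Qed.

Let n23 : i2 != i3. Proof. by rewrite (idx_eq i_all) !id4. Qed.
Let n32 : i3 != i2. Proof. by rewrite (idx_eq i_all) !id4. Qed.
Let n02 : i0 != i2. Proof. by rewrite (idx_eq i_all) !id4. Qed.
Let n03 : i0 != i3. Proof. by rewrite (idx_eq i_all) !id4. Qed.
Let n12 : i1 != i2. Proof. by rewrite (idx_eq i_all) !id4. Qed.
Let n13 : i1 != i3. Proof. by rewrite (idx_eq i_all) !id4. Qed.

Lemma sol41_row3 g x j : j != i3 -> Q g x i3 j = 0.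
Proof. exact/sol41_rowI/sol41_I3. Qed.
Lemma sol41_row2 g x j : j != i2 -> Q g x i2 j = 0.
Proof. exact/sol41_rowI/sol41_I2. Qed.
Lemma sol41_col3 g x j : j != i3 -> Q g x j i3 = 0.
Proof. exact/sol41_colI/sol41_I3. Qed.
Lemma sol41_col2 g x j : j != i2 -> Q g x j i2 = 0.
Proof. exact/sol41_colI/sol41_I2. Qed.

Let Q0 g x := (sol41_row3 g x n03, sol41_row3 g x n13, sol41_row3 g x n23,
  sol41_row2 g x n02, sol41_row2 g x n12, sol41_row2 g x n32,
  sol41_col3 g x n03, sol41_col3 g x n13, sol41_col2 g x n02, sol41_col2 g x n12).

(** The row of Q at i3 is constant; the vanishing of its derivative in
    [fD_rot] excludes a rotation of the plane of i0 and i1. *)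
Lemma sol41_off g x : sub_set H g -> Q g x i0 i1 = 0 /\ Q g x i1 i0 = 0.
Proof.
move=> Hg; have Q33 := sol41_QII x Hg sol41_I3.
have E k j : j != i3 -> fD F k (fun y => Q g y i3 j) x = 0.
  move=> j3; have -> : (fun y => Q g y i3 j) = fun=> 0 by apply/funext => y; exact: sol41_row3.
  exact: fD_cst.
split.
  have := E i0 i1 n13; rewrite (fD_rot (sm g) (df g) (orth g)) !(sum4 i_uniq i_all) !Q0 Q33 /om /= !id4 /=.
  by lra.
have := E i1 i0 n03; rewrite (fD_rot (sm g) (df g) (orth g)) !(sum4 i_uniq i_all) !Q0 Q33 /om /= !id4 /=.
by lra.
Qed.

Lemma sol41_row0 g x j : sub_set H g -> j != i0 -> Q g x i0 j = 0.
Proof.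
move=> Hg; have [q01 _] := sol41_off x Hg; move: j.
by apply: (case4 i_all) => [/eqP//|_|_|_]; [exact: q01|exact: sol41_col2|exact: sol41_col3].
Qed.

Lemma sol41_row1 g x j : sub_set H g -> j != i1 -> Q g x i1 j = 0.
Proof.
move=> Hg; have [_ q10] := sol41_off x Hg; move: j.
by apply: (case4 i_all) => [_|/eqP//|_|_]; [exact: q10|exact: sol41_col2|exact: sol41_col3].
Qed.

(** Q respects the bracket of the directions i0 and i1, which spans the
    center. *)
Lemma sol41_Q11 g x : sub_set H g -> Q g x i0 i0 * Q g x i1 i1 = 1.
Proof.
move=> Hg; have := rot_torsion F (sm g) (df g) i0 i1 i2 x.
have -> : (fun y => Q g y i1 i2) = fun=> 0 by apply/funext => y; exact: sol41_col2.
have -> : (fun y => Q g y i0 i2) = fun=> 0 by apply/funext => y; exact: sol41_col2.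
have [q01 q10] := sol41_off x Hg.
rewrite !fD_cst subrr !(sum4 i_uniq i_all) !Q0 q01 q10 (sol41_QII _ Hg sol41_I2) /= !id4 /=.
lra.
Qed.

Definition sol41_sign g : R := Q g 0 i0 i0.
Definition sol41_shift g : R := dk g 0 0 i3.

Lemma sol41_Q00 g x : sub_set H g -> Q g x i0 i0 = sol41_sign g.
Proof. by move=> Hg; apply: (rot_diag_cst Flink (deck_isometry g)) => y j; exact: sol41_row0. Qed.

Lemma sol41_sign_sqr g : sub_set H g -> sol41_sign g * sol41_sign g = 1.
Proof.
by move=> Hg; apply: (rot_diag_sqr Flink (deck_isometry g)) => y j; exact: sol41_row0.
Qed.

Lemma sol41_sign11 g x : sub_set H g -> Q g x i1 i1 = sol41_sign g.
Proof.
move=> Hg; have s2 := sol41_sign_sqr Hg; have := sol41_Q11 x Hg; rewrite sol41_Q00// => e.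
by rewrite -[LHS]mul1r -s2 -mulrA e mulr1.
Qed.

Lemma sol41_fD_coord g k j x : sub_set H g ->
  fD F k (fun y => dk g y 0 j) x = Q g x k k * sol41_mx i0 i1 i2 i3 (dk g x) k j.
Proof.
move=> Hg; rewrite fD_coord (bigD1 k)//= big1 ?addr0// => l lk.
suff -> : Q g x k l = 0 by rewrite mul0r.
move: k l lk; apply: (case4 i_all) => l lk;
  [exact: sol41_row0|exact: sol41_row1|exact: sol41_row2|exact: sol41_row3].
Qed.

Definition sol41_lin_tab g (i j : nat) : R :=
  match i, j with
  | 0, 0 => (sol41_sign g * expR (- sol41_shift g))%R
  | 1, 1 => (sol41_sign g * expR (sol41_shift g))%R
  | 2, 2 => 1%R | 3, 3 => 1%R
  | 1, 2 => (sol41_sign g * expR (sol41_shift g) * dk g 0 0 i0)%R | _, _ => 0%R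
  end%N.

Definition sol41_lin g : 'M[R]_n := table i0 i1 i2 i3 (sol41_lin_tab g).

Lemma sol41_linE g i j : sol41_lin g i j = sol41_lin_tab g (ix i) (ix j).
Proof. by rewrite mxE. Qed.

Lemma sol41_pd_coord g a j x : sub_set H g ->
  pd a (fun y => dk g y 0 j) x = \sum_k sol41_imx i0 i1 i2 i3 x a k * (Q g x k k * sol41_mx i0 i1 i2 i3 (dk g x) k j).
Proof.
by move=> Hg; rewrite (pd_fD F); apply: eq_bigr => k _; rewrite sol41_fD_coord.
Qed.

Lemma sol41_height g x : sub_set H g -> dk g x 0 i3 = x 0 i3 + sol41_shift g.
Proof.
move=> Hg; rewrite (@affine_of_pd _ _ (fun y => dk g y 0 i3) (fun a => (a == i3)%:R) (sm g i3)).
  by rewrite sum_pick addrC.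
move=> a y; rewrite sol41_pd_coord// (sum4 i_uniq i_all) !sol41_imxE !sol41_mxE (idx_eq i_all).
rewrite (sol41_QII _ Hg sol41_I3).
by move: a; apply: (case4 i_all); rewrite !id4 /=; ring.
Qed.

Lemma sol41_coord0 g x : sub_set H g ->
  dk g x 0 i0 = dk g 0 0 i0 + x 0 i0 * (sol41_sign g * expR (- sol41_shift g)).
Proof.
move=> Hg; rewrite (@affine_of_pd _ _ (fun y => dk g y 0 i0) (fun a => sol41_lin g a i0) (sm g i0)).
  by rewrite (sum4 i_uniq i_all) !sol41_linE !id4 /=; ring.
move=> a y; rewrite sol41_pd_coord// (sum4 i_uniq i_all) !sol41_imxE !sol41_mxE sol41_linE.
have e : expR (y 0 i3) * expR (- y 0 i3) = 1 by rewrite -expRD subrr expR0.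
move: a; apply: (case4 i_all); rewrite !id4 /=; [|by ring..].
rewrite sol41_Q00// sol41_height// opprD expRD.
transitivity ((expR (y 0 i3) * expR (- y 0 i3)) * (sol41_sign g * expR (- sol41_shift g))); [by ring|by rewrite e mul1r].
Qed.

Lemma sol41_affine g x : sub_set H g -> dk g x = x *m sol41_lin g + dk g 0.
Proof.
move=> Hg; apply/rowP => j.
rewrite (@affine_of_pd _ _ (fun y => dk g y 0 j) (fun a => sol41_lin g a j) (sm g j)).
  by rewrite addrC mxDE mxE.
move=> a y; rewrite sol41_pd_coord// (sum4 i_uniq i_all) !sol41_imxE !sol41_mxE sol41_linE.
rewrite sol41_Q00// sol41_sign11// !sol41_QII ?sol41_I2 ?sol41_I3// sol41_height// sol41_coord0//.
have e : expR (y 0 i3) * expR (- y 0 i3) = 1 by rewrite -expRD subrr expR0.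
have e2 : expR (sol41_shift g) * expR (- sol41_shift g) = 1 by rewrite -expRD subrr expR0.
have ss := sol41_sign_sqr Hg.
move: a j; apply: (case4 i_all); apply: (case4 i_all); rewrite !id4 /= ?opprD ?expRD; try (by ring).
- transitivity ((expR (y 0 i3) * expR (- y 0 i3)) * (sol41_sign g * expR (- sol41_shift g))); [by ring|by rewrite e mul1r].
- transitivity ((expR (y 0 i3) * expR (- y 0 i3)) * (sol41_sign g * expR (sol41_shift g))); [by ring|by rewrite e mul1r].
transitivity ((expR (y 0 i3) * expR (- y 0 i3)) * (sol41_sign g * expR (sol41_shift g) * dk g 0 0 i0 +
  y 0 i0 * (sol41_sign g * sol41_sign g) * (expR (sol41_shift g) * expR (- sol41_shift g))) - y 0 i0); first by ring.
by rewrite e e2 ss; ring.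
Qed.

Definition sol41_chart : affine_chart H.
Proof.
refine (@AffineChart R X M H id id _ _ _ _ sol41_lin (fun g => dk g 0) _ _) => //.
- by move=> x; exact: cvg_id.
- by move=> x; exact: cvg_id.
- by move=> g x; exact: sol41_affine.
move=> r; pose E := expR (r + r); exists (1 + E + E * (r + r * E)) => g y Hg yr.
rewrite -sol41_affine// => gr.
have r0 : 0 <= r by apply: le_trans yr.
have E0 : 0 <= E by exact: expR_ge0.
have cr : `|sol41_shift g| <= r + r.
  have -> : sol41_shift g = dk g y 0 i3 - y 0 i3 by rewrite sol41_height// [_ + sol41_shift g]addrC addrK.
  apply: le_trans (ler_normB _ _) _; apply: lerD.
    exact: le_trans (entry_le_norm _ _ _) gr.
  exact: le_trans (entry_le_norm _ _ _) yr.
have s1 : `|sol41_sign g| = 1.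
  apply/eqP; rewrite -(@eqrXn2 _ 2)// expr1n -normrX expr2 sol41_sign_sqr// normr1//.
have eP : `|sol41_sign g * expR (sol41_shift g)| <= E.
  rewrite normrM s1 mul1r ger0_norm ?expR_ge0// ler_expR; exact: le_trans (ler_norm _) cr.
have eN : `|sol41_sign g * expR (- sol41_shift g)| <= E.
  rewrite normrM s1 mul1r ger0_norm ?expR_ge0// ler_expR; apply: le_trans (ler_norm _) _.
  by rewrite normrN.
have w0 : `|dk g 0 0 i0| <= r + r * E.
  have -> : dk g 0 0 i0 = dk g y 0 i0 - y 0 i0 * (sol41_sign g * expR (- sol41_shift g)).
    by rewrite (sol41_coord0 y Hg) addrK.
  apply: le_trans (ler_normB _ _) _; apply: lerD.
    exact: le_trans (entry_le_norm _ _ _) gr.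
  rewrite normrM ler_pM//; exact: le_trans (entry_le_norm _ _ _) yr.
have ew : `|sol41_sign g * expR (sol41_shift g) * dk g 0 0 i0| <= E * (r + r * E).
  by rewrite normrM ler_pM.
have rE : 0 <= E * (r + r * E) by rewrite mulr_ge0// addr_ge0// mulr_ge0.
apply: norm_le_entry => [|]; first by rewrite addr_ge0// addr_ge0.
by apply: (case4 i_all); apply: (case4 i_all); rewrite sol41_linE !id4 /= ?normr1 ?normr0; lra.
Defined.
Local Notation T := sol41_chart.

Lemma sol41_mul (v : 'rV[R]_n) g :
  [/\ (v *m sol41_lin g) 0 i0 = v 0 i0 * (sol41_sign g * expR (- sol41_shift g)),
      (v *m sol41_lin g) 0 i1 = v 0 i1 * (sol41_sign g * expR (sol41_shift g)),
      (v *m sol41_lin g) 0 i2 = v 0 i2 + v 0 i1 * (sol41_sign g * expR (sol41_shift g) * dk g 0 0 i0) &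
      (v *m sol41_lin g) 0 i3 = v 0 i3].
Proof. by split; rewrite mxE (sum4 i_uniq i_all) !sol41_linE !id4 /=; ring. Qed.

Lemma sol41_fiber (v : 'rV[R]_n) g : v 0 i0 = 0 -> v 0 i1 = 0 -> v *m sol41_lin g = v.
Proof.
move=> v0 v1; have [e0 e1 e2 e3] := sol41_mul v g.
apply/rowP; apply: (case4 i_all); rewrite ?e0 ?e1 ?e2 ?e3 ?v0 ?v1 ?mul0r ?addr0//.
Qed.

(** The linear part multiplies the coordinates i0 and i1 by numbers of
    absolute value different from one. *)
Lemma sol41_no_fixed (v : 'rV[R]_n) g : sub_set H g -> sol41_shift g != 0 ->
  (v *m sol41_lin g) 0 i0 = v 0 i0 -> (v *m sol41_lin g) 0 i1 = v 0 i1 ->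
  v 0 i0 = 0 /\ v 0 i1 = 0.
Proof.
move=> Hg c0; have [-> -> _ _] := sol41_mul v g.
have ss := sol41_sign_sqr Hg.
have key c (z : R) : c != 0 -> z * (sol41_sign g * expR c) = z -> z = 0.
  move=> cn e; apply/eqP/negPn/negP => z0.
  have e1 : sol41_sign g * expR c = 1 by apply: (mulfI z0); rewrite e mulr1.
  have e2 : expR c = sol41_sign g by rewrite -[LHS]mul1r -ss -mulrA e1 mulr1.
  have : expR (c + c) = 1 by rewrite expRD e2.
  rewrite -expR0 => /expR_inj ec; case/eqP: cn; lra.
move=> z0 z1; split; last exact: key z1.
by apply: key z0; rewrite oppr_eq0.
Qed.

(** The vectors fixed by an element that changes the height have no
    coordinates i0 and i1 by [sol41_no_fixed], and such vectors are fixed by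
    all of H. *)
Lemma sol41_split : commuting_pairs_split R (pi1 M).
Proof.
apply: (@split_by_height _ _ _ _ T (delta_mx i3 0)).
- exact: oriented_cover.
- by apply/eqP => /matrixP/(_ i3 0); rewrite !mxE !eqxx => /eqP; rewrite oner_eq0.
- move=> g Hg; apply/colP => i; rewrite -colE [LHS]mxE sol41_linE mxE andbT (idx_eq i_all).
  by move: i; apply: (case4 i_all); rewrite !id4.
move=> a B Ha ca BH aB; have c0 : sol41_shift a != 0.
  apply: contra ca => /eqP c0; apply/eqP/matrixP => i j; rewrite !ord1 -colE !mxE.
  exact: c0.
have fixE (v : 'rV[R]_n) : v *m (sol41_lin a - 1%:M) = 0 -> v *m sol41_lin a = v.
  by rewrite mulmxBr mulmx1 => /eqP; rewrite subr_eq0 => /eqP.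
apply: (@centralizer_lattice _ _ _ _ T a B Ha BH aB) => [x|b v Bb /= va]; last first.
  have [v0 v1] : v 0 i0 = 0 /\ v 0 i1 = 0 by apply: (sol41_no_fixed Ha c0); rewrite va.
  exact: sol41_fiber.
rewrite /= -/(sol41_lin a) => xKK; have yL := fixE _ xKK.
have [y0 y1] : (x *m (sol41_lin a - 1%:M)) 0 i0 = 0 /\ (x *m (sol41_lin a - 1%:M)) 0 i1 = 0.
  by apply: (sol41_no_fixed Ha c0); rewrite yL.
have cE j : (x *m (sol41_lin a - 1%:M)) 0 j = (x *m sol41_lin a) 0 j - x 0 j.
  by rewrite mulmxBr mulmx1 !mxDE mxNE.
rewrite !cE in y0 y1.
have [x0 x1] : x 0 i0 = 0 /\ x 0 i1 = 0.
  by apply: (sol41_no_fixed Ha c0); apply/eqP; rewrite -subr_eq0 ?y0 ?y1.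
by rewrite mulmxBr mulmx1 sol41_fiber// subrr.
Qed.

End Sol41Manifold.

(** * The models *)

Section Models.
Variable R : realType.

(** In the coordinates of the models, left translation by a is an affine
    map, with translation part a since it carries 0 to a. *)
Definition left_affine (X : lie_model R) (L : 'rV[R]_(gdim X) -> 'M[R]_(gdim X)) :=
  forall a y, gmul a y = y *m L a + a :> 'rV[R]_(gdim X).

Lemma left_affine_invariant (X : lie_model R) L (F : frame R (gdim X)) :
  left_affine L -> (forall p : 'rV_(gdim X), L (ginv p) = cofr F p) -> left_invariant F.
Proof.
move=> XL Lp p u; rewrite -Lp; apply: (@diff_affine _ _ _ (ginv p)) => y.
exact: XL.
Qed.

Lemma semidirect_affine (N : lie_model R) phi (P : R -> 'M[R]_(gdim N)) L :
  left_affine L -> (forall t v, phi t v = v *m P t) ->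
  @left_affine (semidirect phi)
    (fun a => block_mx (P (rsubmx a 0 0) *m L (lsubmx a)) 0 0 1%:M).
Proof.
move=> NL phiP a y; rewrite [LHS]/gmul/= NL phiP -mulmxA.
rewrite -[X in _ = X *m _ + _]hsubmxK mul_row_block !mulmx0 addr0 add0r mulmx1.
by rewrite -[X in _ = _ + X]hsubmxK add_row_mx; congr row_mx; rewrite addrC.
Qed.

Lemma euclid_affine n : @left_affine (euclid R n) (fun=> 1%:M).
Proof. by move=> a y; rewrite mulmx1 addrC. Qed.

Lemma euclid_by_affine n (A : R -> 'M[R]_n) :
  @left_affine (euclid_by A) (fun a => block_mx (A (rsubmx a 0 0))^T 0 0 1%:M).
Proof.
move=> a y; rewrite (@semidirect_affine (euclid R n) _ (fun t => (A t)^T) _ (@euclid_affine n))//.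
by rewrite mulmx1.
Qed.

Lemma times_line_affine (N : lie_model R) L : left_affine L ->
  @left_affine (times_line N) (fun a => block_mx (L (lsubmx a)) 0 0 1%:M).
Proof.
move=> NL a y; rewrite (@semidirect_affine N _ (fun t => 1%:M) _ NL) ?mul1mx// => t v.
by rewrite mulmx1.
Qed.

Lemma nil3_affine : @left_affine (nil3 R)
  (fun a => \matrix_(i, j) ((i == j)%:R + (i == 1)%:R * (j == 2%:R)%:R * a 0 0)).
Proof.
move=> a y; apply/rowP => j; rewrite !mxE.
transitivity (\sum_i (y 0 i * (j == i)%:R + y 0 i * (j == 2%:R)%:R * a 0 0 * (i == 1)%:R) + a 0 j); last first.
  by congr (_ + _); apply: eq_bigr => i _; rewrite mxE (eq_sym i j); ring.
rewrite big_split /= sum_pick.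
under eq_bigr do rewrite eq_sym.
rewrite sum_pick.
by case: j => -[|[|[|//]]] h /=; rewrite ?mulr0 ?mul0r ?addr0 ?mulr1; ring.
Qed.

(** The weights after adding a line on which the weight is zero, which is
    either the acting line or a further factor. *)
Definition ext0 n (w : 'rV[R]_n) : 'rV[R]_(n + 1) := row_mx w 0.

Lemma ext0r n (w : 'rV[R]_n) (k : 'I_1) : ext0 w 0 (rshift n k) = 0.
Proof. by rewrite row_mxEr mxE. Qed.

Lemma ext0_diag n (w : 'rV[R]_n) (s : R) :
  block_mx (diag_mx (\row_k expR (- w 0 k * s))) 0 0 1%:M = 
    diag_mx (\row_k expR (- ext0 w 0 k * s)) :> 'M[R]_(n + 1).
Proof.
have <- : row_mx (\row_k expR (- w 0 k * s)) (const_mx 1) = \row_k expR (- ext0 w 0 k * s).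
  apply/rowP => k; rewrite [RHS]mxE /ext0; case: (split_ordP k) => i ->.
    by rewrite !row_mxEl mxE.
  by rewrite !row_mxEr !mxE oppr0 mul0r expR0.
by rewrite diag_mx_row diag_const_mx.
Qed.

Lemma ext0_sum n (w : 'rV[R]_n) : \sum_i ext0 w 0 i = \sum_i w 0 i.
Proof.
rewrite big_split_ord /= big_ord_recl big_ord0 ext0r !addr0.
by apply: eq_bigr => i _; rewrite row_mxEl.
Qed.

Section DiagonalModels.
Variables (m : nat) (w : 'rV[R]_m) (A : R -> 'M[R]_m).
Hypothesis AE : forall t, A t = diag_mx (\row_k expR (w 0 k * t)).
Hypothesis w_sum : \sum_i w 0 i = 0.
Hypothesis w_ex : exists i, w 0 i != 0.

Let top : 'I_(m + 1) := rshift m ord0.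

Lemma euclid_by_diag_invariant (p : 'rV[R]_(m + 1)) :
  block_mx (A (rsubmx (@ginv _ (euclid_by A) p : 'rV_(m + 1)) 0 0))^T 0 0 1%:M
  = diag_mx (\row_k expR (- ext0 w 0 k * p 0 top)) :> 'M[R]_(m + 1).
Proof.
rewrite -ext0_diag AE tr_diag_mx /= row_mxKr; congr block_mx; congr diag_mx.
by apply/rowP => k; rewrite !mxE mulrN mulNr.
Qed.

Lemma euclid_by_diag_split (M : closed_manifold (euclid_by A)) :
  (forall i j, w 0 i = 0 -> w 0 j = 0 -> i = j) -> commuting_pairs_split R (pi1 M).
Proof.
move=> w_zero.
apply: (@diag_split R (euclid_by A) top (ext0 w 0) (ext0r w ord0)).
- by apply: (left_affine_invariant (@euclid_by_affine _ A)) => p; exact: euclid_by_diag_invariant.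
- by rewrite ext0_sum.
- by have [i wi] := w_ex; exists (lshift 1 i); rewrite row_mxEl.
move=> i j; case: (split_ordP i) => k ->; last by rewrite (ord1 k) eqxx.
case: (split_ordP j) => l ->; last by rewrite (ord1 l) eqxx.
by rewrite !row_mxEl => wk wl _ _; rewrite (w_zero k l).
Qed.

Lemma times_line_diag_split (M : closed_manifold (times_line (euclid_by A))) :
  (forall i, w 0 i != 0) -> commuting_pairs_split R (pi1 M).
Proof.
move=> w_n0.
apply: (@diag_split R (times_line (euclid_by A)) (lshift 1 top) (ext0 (ext0 w) 0)).
  by rewrite row_mxEl ext0r.
move=> lamT.
- apply: (left_affine_invariant (times_line_affine (@euclid_by_affine _ A))) => p.
  rewrite /= row_mxKl euclid_by_diag_invariant ext0_diag.
  by congr diag_mx; apply/rowP => k; rewrite !mxE.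
- by rewrite !ext0_sum.
- by have [i wi] := w_ex; exists (lshift 1 (lshift 1 i)); rewrite !row_mxEl.
have nz i : ext0 (ext0 w) 0 i = 0 -> i != lshift 1 top -> i = rshift _ ord0.
  case: (split_ordP i) => k ->; last by rewrite (ord1 k).
  rewrite row_mxEl; case: (split_ordP k) => l ->; last by rewrite (ord1 l) eqxx.
  by rewrite row_mxEl => /eqP; rewrite (negbTE (w_n0 l)).
by move=> i j wi wj iT jT; rewrite (nz i)// (nz j).
Qed.

End DiagonalModels.

Lemma vecE n (s : seq R) (i : 'I_n) : vec n s 0 i = s`_i.
Proof. by rewrite mxE. Qed.

Lemma diag_vec_exp n (s s' : seq R) (t : R) :
  (forall i, (i < n)%N -> s`_i = expR (s'`_i * t)) ->
  diag_mx (vec n s) = diag_mx (\row_k expR (vec n s' 0 k * t)).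
Proof. by move=> sE; congr diag_mx; apply/rowP => k; rewrite !mxE sE. Qed.

Lemma sol3_diag t : diag_mx (vec 2 [:: expR t; expR (- t)]) =
  diag_mx (\row_k expR (vec 2 [:: 1; - 1] 0 k * t)) :> 'M[R]_2.
Proof. by apply: diag_vec_exp => -[|[|//]] _ /=; rewrite ?mul1r ?mulN1r. Qed.

Lemma sol3_weights : [/\ \sum_i vec 2 [:: 1; - 1] 0 i = 0 :> R &
  forall i, vec 2 [:: 1; - 1] 0 i != 0 :> R].
Proof.
split; first by rewrite !big_ord_recl big_ord0 !vecE /= addr0 subrr.
by move=> i; rewrite vecE; case: i => -[|[|//]] _ /=; rewrite ?oppr_eq0 oner_eq0.
Qed.

Lemma sol3_split (M : closed_manifold (sol3 R)) : commuting_pairs_split R (pi1 M).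
Proof.
have [s0 n0] := sol3_weights.
apply: (euclid_by_diag_split sol3_diag s0); first by exists 0.
by move=> i j /eqP; rewrite (negbTE (n0 i)).
Qed.

Lemma sol3_line_split (M : closed_manifold (times_line (sol3 R))) :
  commuting_pairs_split R (pi1 M).
Proof.
have [s0 n0] := sol3_weights.
by apply: (times_line_diag_split sol3_diag s0) => //; exists 0.
Qed.

Lemma sol4mn_split (a b c : R) (M : closed_manifold (sol4mn a b c)) :
  a > b -> b > c -> a + b + c = 0 -> commuting_pairs_split R (pi1 M).
Proof.
move=> ab bc abc; apply: (@euclid_by_diag_split _ (vec 3 [:: a; b; c])).
- by move=> t; apply: diag_vec_exp => -[|[|[|//]]] _.
- by rewrite !big_ord_recl big_ord0 !vecE /= addr0 addrA.
- by exists 0; rewrite vecE /=; apply/eqP; lra.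
move=> i j; rewrite !vecE => vi vj; apply/val_inj.
case: i vi => -[|[|[|//]]] hi /= vi; case: j vj => -[|[|[|//]]] hj /= vj //; exfalso; lra.
Qed.

Lemma sol40_split (M : closed_manifold (sol40 R)) : commuting_pairs_split R (pi1 M).
Proof.
apply: (@euclid_by_diag_split _ (vec 3 [:: 1; 1; - 2])).
- by move=> t; apply: diag_vec_exp => -[|[|[|//]]] _ /=; congr expR; ring.
- by rewrite !big_ord_recl big_ord0 !vecE /=; ring.
- by exists 0; rewrite vecE /= oner_eq0.
move=> i j; rewrite !vecE => vi vj; apply/val_inj.
case: i vi => -[|[|[|//]]] hi /= vi; case: j vj => -[|[|[|//]]] hj /= vj //; exfalso; lra.
Qed.

Lemma nil3_invariant (p : 'rV[R]_3) :
  \matrix_(i, j) ((i == j)%:R + (i == 1)%:R * (j == 2%:R)%:R * @ginv _ (nil3 R) p 0 0) =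
  heis_fr 0 1 2%:R (-1) p :> 'M[R]_3.
Proof. by apply/matrixP => i j; rewrite !mxE /= addr0 mulN1r. Qed.

Lemma nil3_split (M : closed_manifold (nil3 R)) : commuting_pairs_split R (pi1 M).
Proof.
have u : uniq [:: 0; 1; 2%:R : 'I_3] by [].
apply: (@heis_split R (nil3 R) _ _ _ u).
  by apply: (left_affine_invariant nil3_affine) => p; exact: nil3_invariant.
by case=> -[|[|[|//]]].
Qed.

Lemma nil3_line_split (M : closed_manifold (times_line (nil3 R))) :
  commuting_pairs_split R (pi1 M).
Proof.
have u : uniq [:: lshift 1 0; lshift 1 1; lshift 1 (2%:R : 'I_3)] by [].
apply: (@heis_split R (times_line (nil3 R)) _ _ _ u).
  apply: (left_affine_invariant (times_line_affine nil3_affine)) => p.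
  rewrite /= row_mxKl nil3_invariant; apply/matrixP => i j.
  case: (split_ordP i) => k ->; case: (split_ordP j) => l ->;
    rewrite ?block_mxEul ?block_mxEur ?block_mxEdl ?block_mxEdr [RHS]mxE mxE ?[(lsubmx _) _ _]mxE
      ?(inj_eq (@lshift_inj _ _)) ?(inj_eq (@rshift_inj _ _)) ?eq_lrshift ?eq_rlshift /=; by ring.
move=> s s'; case: (split_ordP s) => k ->; first by case: k => -[|[|[|//]]].
case: (split_ordP s') => l ->; first by case: l => -[|[|[|//]]].
by rewrite (ord1 k) (ord1 l).
Qed.

Let e0 : 'I_4 := 0.
Let e1 : 'I_4 := 1.
Let e2 : 'I_4 := 2%:R.
Let e3 : 'I_4 := 3%:R.
Let e_uniq : uniq [:: e0; e1; e2; e3]. Proof. by []. Qed.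
Let e_all (i : 'I_4) : i \in [:: e0; e1; e2; e3].
Proof. by case: i => -[|[|[|[|//]]]]. Qed.

Let e_idx (i : 'I_4) : idx e0 e1 e2 e3 i = i.
Proof. by case: i => -[|[|[|[|//]]]]. Qed.

Lemma jordan3_exp (t : R) : (\sum_(k < 3) k`!%:R^-1 *: (t *: jordan3 R) ^+ k)^T =
  \matrix_(i, j) nil4_tab t i j :> 'M[R]_3.
Proof.
have -> : \sum_(k < 3) k`!%:R^-1 *: (t *: jordan3 R) ^+ k =
    1%:M + t *: jordan3 R + 2^-1 *: ((t *: jordan3 R) *m (t *: jordan3 R)).
  rewrite !big_ord_recr big_ord0 /= add0r; congr (_ + _ + _).
    by rewrite -[RHS]scale1r; congr (_ *: _); exact: invr1.
  by rewrite -[RHS]scale1r; congr (_ *: _); exact: invr1.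
apply/matrixP => i j; rewrite !mxE !big_ord_recl big_ord0 !mxE.
by case: i => -[|[|[|//]]] hi; case: j => -[|[|[|//]]] hj; rewrite /=; by field.
Qed.

Lemma nil4_model_split (M : closed_manifold (nil4 R)) : commuting_pairs_split R (pi1 M).
Proof.
apply: (@nil4_split R (nil4 R) _ _ _ _ e_uniq e_all).
apply: (left_affine_invariant (@euclid_by_affine _ _)) => p.
rewrite jordan3_exp /= row_mxKr; apply/matrixP => i j; rewrite [RHS]mxE.
case: (split_ordP i) => k ->; case: (split_ordP j) => l ->;
  rewrite ?block_mxEul ?block_mxEur ?block_mxEdl ?block_mxEdr !mxE.
- rewrite !e_idx; congr (nil4_tab (- p 0 _) _ _); exact/val_inj.
- by rewrite !e_idx (ord1 l); case: k => -[|[|[|//]]].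
- by rewrite !e_idx (ord1 k); case: l => -[|[|[|//]]].
by rewrite !e_idx (ord1 k) (ord1 l).
Qed.

Lemma sol41_diag t (v : 'rV[R]_3) : vec 3 [:: expR (- t) * v 0 0; expR t * v 0 1; v 0 2%:R] =
  v *m diag_mx (vec 3 [:: expR (- t); expR t; 1]).
Proof.
apply/rowP => i; rewrite mul_mx_diag mxE [RHS]mxE vecE.
case: i => -[|[|[|//]]] hi; rewrite /= ?mulr1; last by congr (v _ _); exact/val_inj.
  by rewrite mulrC; congr (v _ _ * _); exact/val_inj.
by rewrite mulrC; congr (v _ _ * _); exact/val_inj.
Qed.

Lemma sol41_linear_part (s z : R) (i j : 'I_3) :
  (diag_mx (vec 3 [:: expR (- s); expR s; 1]) *m
    \matrix_(i, j) ((i == j)%:R + (i == 1)%:R * (j == 2%:R)%:R * z)) i j = sol41_tab z s i j.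
Proof.
rewrite mul_diag_mx !mxE.
by case: i => -[|[|[|//]]] hi; case: j => -[|[|[|//]]] hj /=; ring.
Qed.

Lemma sol41_model_split (M : closed_manifold (sol41 R)) : commuting_pairs_split R (pi1 M).
Proof.
apply: (@sol41_split R (sol41 R) _ _ _ _ e_uniq e_all).
apply: (left_affine_invariant (@semidirect_affine (nil3 R) _ _ _ nil3_affine sol41_diag)) => p.
rewrite /= row_mxKr row_mxKl; apply/matrixP => i j; rewrite [RHS]mxE.
have t3 : rsubmx p 0 0 = p 0 e3 by rewrite mxE; congr (p _ _); exact/val_inj.
have x0 : lsubmx p 0 0 = p 0 e0 by rewrite mxE; congr (p _ _); exact/val_inj.
have eV : expR (- p 0 e3) * expR (p 0 e3) = 1 by rewrite -expRD addNr expR0.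
case: (split_ordP i) => k ->; case: (split_ordP j) => l ->;
  rewrite ?block_mxEul ?block_mxEur ?block_mxEdl ?block_mxEdr !e_idx.
- rewrite sol41_linear_part vecE /= !mxNE mxDE mxNE vecE /= t3 x0 addr0 opprK.
  by case: k => -[|[|[|//]]] hk; case: l => -[|[|[|//]]] hl //=; rewrite ?opprK// mulrA eV mul1r.
- by rewrite mxE (ord1 l); case: k => -[|[|[|//]]].
- by rewrite mxE (ord1 k); case: l => -[|[|[|//]]].
by rewrite mxE (ord1 k) (ord1 l).
Qed.

End Models.

Theorem theoremE (R : realType) (X : lie_model R) (M : closed_manifold X) :
  solvable_geometry X -> (gdim X <= 4)%N -> irreducible (pi1 M) ->
  ~ IIPP (pi1 M).
Proof.
move=> sX dX; apply: (@not_IIPP R); move: M dX.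
case: {X} sX => [n _||||||m n a b c _ _ _ ab bc abc _||] M dX.
- exact: eu_split.
- exact: nil3_split.
- exact: sol3_split.
- exact: nil3_line_split.
- exact: sol3_line_split.
- exact: nil4_model_split.
- exact: sol4mn_split ab bc abc.
- exact: sol40_split.
exact: sol41_model_split.
Qed.
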